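(* Let $\mathcal{M}=(M,<,\ldots)$ be an o-minimal structure. Let $\{(X_c,\tau_c):c\in C\}$ be a definable family of topological spaces, i.e. there exist a definable set $B\subseteq M^{n+m}$ and a formula $\sigma(x,u,v)$, with $|u|=n$ and $|v|=m$, such that $C$ is the projection of $B$ to the last $m$ coordinates and, for every $c\in C$, the family $\{\sigma(M,b,c):b\in B_c\}$, where $B_c=\{b\in M^n:\langle b,c\rangle\in B\}$, is a basis for $\tau_c$. Then the subfamily of all definably compact spaces is definable, i.e. there exists a definable set $D\subseteq C$ such that, for every $c\in C$, $(X_c,\tau_c)$ is definably compact if and only if $c\in D$. In particular, given any definable family of subsets of a definable topological space, the subfamily of those that are definably compact (with the subspace topology) is definable.
   Context: $\mathcal{M}$ expands a dense linear order without endpoints. ''Definable'' means definable in $\mathcal{M}$ with parameters. $\sigma(M,b,c)=\{a\in M^{|x|}:\mathcal{M}\models\sigma(a,b,c)\}$. A definable family of sets is one of the form $\{\varphi(M,b): b\in B\}$ with $\varphi(x,y)$ a formula and $B$ definable; families are taken nonempty. A definable topological space $(X,\tau)$, $X\subseteq M^k$, is a topological space for which some definable family of subsets of $X$ is a basis of $\tau$. Types are complete types over $M$, identified with families of definable sets; $S_X(M)$ is the set of those containing $X$; a type $p(x)$ is definable if for every formula $\varphi(x,y)$ the set $\{b:\varphi(x,b)\in p(x)\}$ is definable. In an o-minimal structure, a definable topological space $(X,\tau)$ is called definably compact if it satisfies any of the following conditions, which are equivalent in that setting (the equivalence may be taken as known): (a) type-compactness: every definable type $p\in S_X(M)$ has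 a $\tau$-limit, i.e. a point of $X$ lying in every $\tau$-closed set in $p$; (b) filter-compactness: every downward directed definable family of nonempty $\tau$-closed subsets of $X$ has nonempty intersection; (c) transversal-compactness: for every definable family of $\tau$-closed sets all of whose finite subfamilies have nonempty intersection there is a finite set meeting every member of the family. (A family is downward directed if the intersection of any two members contains a member.) *)

(* Defs.v *)
From mathcomp Require Import all_boot all_order all_algebra.
From mathcomp Require Import boolp classical_sets.

Set Implicit Arguments.
Unset Strict Implicit.
Unset Printing Implicit Defensive.

Local Open Scope classical_set_scope.

(* The symbols of a language other than [=] and [<], which are logical
   primitives of [formula] below. *)
Record language : Type := Language {
  fun_symbol : Type;
  fun_arity : fun_symbol -> nat;
  rel_symbol : Type;
  rel_arity : rel_symbol -> nat }.

(* An expansion of the ordered set M to a structure in the language {<} u L. *)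
Record structure (L : language) (M : Type) : Type := Structure {
  fun_interp : forall f : fun_symbol L, (fun_arity f).-tuple M -> M;
  rel_interp : forall r : rel_symbol L, (rel_arity r).-tuple M -> Prop }.

(* Terms and formulas have their free variables among n variables indexed by
   'I_n, and may use the elements of M as parameters (constructor [Par]). *)
Inductive term (L : language) (M : Type) (n : nat) : Type :=
| Var of 'I_n
| Par of M
| App (f : fun_symbol L) of ('I_(fun_arity f) -> term L M n).

Arguments Var {L M n}.
Arguments Par {L M n}.
Arguments App {L M n}.

(* The quantifier [FEx] binds variable 0 and shifts the others by one. *)
Inductive formula (L : language) (M : Type) : nat -> Type :=
| FEq n of term L M n & term L M n : formula L M n
| FLt n of term L M n & term L M n : formula L M n
| FRel n (r : rel_symbol L) of ('I_(rel_arity r) -> term L M n) : formula L M n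
| FNot n of formula L M n : formula L M n
| FAnd n of formula L M n & formula L M n : formula L M n
| FEx n of formula L M n.+1 : formula L M n.

Section FirstOrder.
Variables (L : language) (d : Order.disp_t) (M : orderType d).
Variable (S : structure L M).

Fixpoint eval n (e : n.-tuple M) (t : term L M n) : M :=
  match t with
  | Var i => tnth e i
  | Par a => a
  | App f args => fun_interp S [tuple eval e (args i) | i < fun_arity f]
  end.

Fixpoint sat n (phi : formula L M n) : n.-tuple M -> Prop :=
  match phi in formula _ _ n return n.-tuple M -> Prop with
  | FEq _ s t => fun e => eval e s = eval e t
  | FLt _ s t => fun e => (eval e s < eval e t)%O
  | FRel _ r args => fun e =>
      rel_interp S [tuple eval e (args i) | i < rel_arity r]
  | FNot _ phi => fun e => ~ sat phi e
  | FAnd _ phi psi => fun e => sat phi e /\ sat psi e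
  | FEx _ phi => fun e => exists a : M, sat phi (cons_tuple a e)
  end.

Definition definable n (A : set (n.-tuple M)) : Prop :=
  exists phi : formula L M n, A = [set a | sat phi a].

(* phi(M, b) *)
Definition fiber k m (phi : formula L M (k + m)) (b : m.-tuple M) :
    set (k.-tuple M) :=
  [set a | sat phi (cat_tuple a b)].

Definition definable_family k (F : set (set (k.-tuple M))) : Prop :=
  exists m (B : set (m.-tuple M)) (phi : formula L M (k + m)),
    [/\ definable B, B !=set0 & F = [set fiber phi b | b in B]].

Definition dense_linear_order_without_endpoints : Prop :=
  [/\ inhabited M,
      forall x y : M, (x < y)%O -> exists z, (x < z < y)%O,
      forall x : M, exists y, (y < x)%O &
      forall x : M, exists y, (x < y)%O].

(* [interval M] has endpoints in M u {-oo, +oo} and includes the points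
   `[x, x], so that these are the finite unions of points and open intervals. *)
Definition o_minimal : Prop :=
  dense_linear_order_without_endpoints /\
  forall A : set (1.-tuple M), definable A ->
    exists s : seq (interval M),
      forall x : M, A [tuple x] <-> has (fun i : interval M => x \in i) s.

(* Complete types over M in k variables, as ultrafilters of the boolean
   algebra of definable subsets of M^k. *)
Record complete_type k (p : set (set (k.-tuple M))) : Prop := {
  type_definable : forall A, p A -> definable A;
  type_setT : p setT;
  type_set0 : ~ p set0;
  type_setI : forall A A', p A -> p A' -> p (A `&` A');
  type_up : forall A A', p A -> definable A' -> A `<=` A' -> p A';
  type_or : forall A, definable A -> p A \/ p (~` A) }.

Definition definable_type k (p : set (set (k.-tuple M))) : Prop :=
  complete_type p /\
  forall m (phi : formula L M (k + m)), definable [set b | p (fiber phi b)].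

End FirstOrder.

(* [tau] is the set of open sets of a topology on the subset X of T. *)
Record topology_on (T : Type) (X : set T) (tau : set (set T)) : Prop := {
  topology_sub : forall U, tau U -> U `<=` X;
  topology_set0 : tau set0;
  topology_full : tau X;
  topology_setI : forall U V, tau U -> tau V -> tau (U `&` V);
  topology_bigcup : forall F : set (set T),
    F `<=` tau -> tau (\bigcup_(U in F) U) }.

Definition topology_basis (T : Type) (tau F : set (set T)) : Prop :=
  F `<=` tau /\
  forall U x, tau U -> U x -> exists V, [/\ F V, V x & V `<=` U].

Definition tau_closed (T : Type) (X : set T) (tau : set (set T)) (Z : set T) :
    Prop :=
  Z `<=` X /\ tau (X `\` Z).

Definition subspace_topology (T : Type) (tau : set (set T)) (Y : set T) :
    set (set T) :=
  [set U `&` Y | U in tau].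

Section DefinableTopology.
Variables (L : language) (d : Order.disp_t) (M : orderType d).
Variable (S : structure L M).

Definition definable_topological_space k (X : set (k.-tuple M))
    (tau : set (set (k.-tuple M))) : Prop :=
  topology_on X tau /\
  exists F : set (set (k.-tuple M)),
    definable_family S F /\ topology_basis tau F.

Definition type_limit k (X : set (k.-tuple M)) (tau : set (set (k.-tuple M)))
    (p : set (set (k.-tuple M))) (x : k.-tuple M) : Prop :=
  X x /\ forall Z, tau_closed X tau Z -> p Z -> Z x.

(* Definable compactness is taken in the form of type-compactness; in an
   o-minimal structure this is equivalent to filter-compactness and to
   transversal-compactness. *)
Definition definably_compact k (X : set (k.-tuple M))
    (tau : set (set (k.-tuple M))) : Prop :=
  forall p, definable_type S p -> p X -> exists x, type_limit X tau p x.

(* The family {(X c, tau c) : c in C} is definable, through the formula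
   sigma(x, u, v) and the set B of pairs (b, c), which projects onto C; the
   sets sigma(M, b, c) with (b, c) in B form a basis of tau c. *)
Definition definable_family_of_spaces k n m
    (B : set ((n + m).-tuple M)) (sigma : formula L M (k + (n + m)))
    (C : set (m.-tuple M)) (X : m.-tuple M -> set (k.-tuple M))
    (tau : m.-tuple M -> set (set (k.-tuple M))) : Prop :=
  [/\ definable S B,
      C = [set c | exists b : n.-tuple M, B (cat_tuple b c)],
      C !=set0 &
      forall c, C c ->
        topology_on (X c) (tau c) /\
        topology_basis (tau c)
          [set fiber S sigma (cat_tuple b c)
             | b in [set b : n.-tuple M | B (cat_tuple b c)]]].

End DefinableTopology.

(* Main.v *)
Require Import Defs.
From Stdlib Require List.
From mathcomp Require Import all_boot all_order all_algebra.
From mathcomp Require Import boolp classical_sets.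

Set Implicit Arguments.
Unset Strict Implicit.
Unset Printing Implicit Defensive.

Import Order.TTheory.

Local Open Scope classical_set_scope.

(* A point x of X_c is a limit of a definable type p iff p contains every basic
   open neighbourhood of x, so compactness of X_c only involves the traces
   {y : phi(x, y) in p} of definable types on one formula phi; it is enough that
   these traces form a definable family.  This is proved by induction on the
   number of variables.  A definable type of (v, x) extending a type q of x
   amounts to a definable cut among the endpoints f_i(x, y) of the fibres of phi,
   preordered by q; uniform finiteness bounds their number, and the limit of any
   definable set of endpoints is again a definable type.  So one needs that the
   definable cuts I of a definable family of total preorders on M^n form a
   definable family.  If x0 in I and x1 not in I bound an interval of smaller
   dimension, or a fibre {u} x M^(n-1) accumulates at the cut, use induction.
   Otherwise, for every u the fibre over u leaves a gap of full dimension around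
   the cut; it is one of boundedly many equivalence classes of full dimension, and
   I is recovered from the index of this class and a definable 1-type of u. *)

(** Compactness quantifies over all definable types, which is not a first-order quantifier; a
    definable family of traces turns it into one over the parameter of the family. That family must
    consist of traces and of nothing else. Points are selected only as least elements of finite
    sets, as left ends of first intervals, or by their rank in a finite set. The finiteness and
    dimension arguments rest on one statement in two variables, [fat_fubini], in place of
    monotonicity and cell decomposition. In the induction on variables the preorder of the endpoints
    and the values of phi at these endpoints must be read off from the same type q; a tag variable
    merges the two formulas into one. *)

Section OMinimal.
Local Open Scope order_scope.
Variables (L : language) (d : Order.disp_t) (M : orderType d).
Variable (S : structure L M).

(** * Definable predicates *)

Fixpoint tsubst n m (s : 'I_n -> 'I_m + M) (t : term L M n) : term L M m :=
  match t with
  | Var i => match s i with inl j => Var j | inr a => Par a end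
  | Par a => Par a
  | App f args => App f (fun i => tsubst s (args i))
  end.

Definition up_subst n m (s : 'I_n -> 'I_m + M) (i : 'I_n.+1) : 'I_m.+1 + M :=
  match unlift ord0 i with
  | None => inl ord0
  | Some j => match s j with inl k => inl (lift ord0 k) | inr a => inr a end
  end.

Fixpoint fsubst n (phi : formula L M n) :
    forall m, ('I_n -> 'I_m + M) -> formula L M m :=
  match phi in formula _ _ n
    return forall m, ('I_n -> 'I_m + M) -> formula L M m with
  | FEq _ t u => fun m s => FEq (tsubst s t) (tsubst s u)
  | FLt _ t u => fun m s => FLt (tsubst s t) (tsubst s u)
  | FRel _ r args => fun m s => FRel (fun i => tsubst s (args i))
  | FNot _ phi => fun m s => FNot (fsubst phi s)
  | FAnd _ phi psi => fun m s => FAnd (fsubst phi s) (fsubst psi s)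
  | FEx _ phi => fun m s => FEx (fsubst phi (up_subst s))
  end.

Definition pull n m (s : 'I_n -> 'I_m + M) (e : m.-tuple M) : n.-tuple M :=
  [tuple match s i with inl j => tnth e j | inr a => a end | i < n].

Lemma eval_tsubst n m (s : 'I_n -> 'I_m + M) e t :
  eval S e (tsubst s t) = eval S (pull s e) t.
Proof.
elim: t => [i|a|f args IH] //=.
  by rewrite tnth_mktuple; case: (s i).
by congr fun_interp; apply: eq_from_tnth => i; rewrite !tnth_mktuple IH.
Qed.

Lemma pull_up n m (s : 'I_n -> 'I_m + M) e a :
  pull (up_subst s) (cons_tuple a e) = cons_tuple a (pull s e).
Proof.
apply: eq_from_tnth => i; rewrite tnth_mktuple /up_subst.
case: unliftP => [j|] ->; last by rewrite !tnth0.
rewrite tnthS tnth_mktuple; case: (s j) => [k|b] //.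
by rewrite tnthS.
Qed.

Lemma sat_fsubst n (phi : formula L M n) m (s : 'I_n -> 'I_m + M) e :
  sat S (fsubst phi s) e <-> sat S phi (pull s e).
Proof.
elim: phi m s e => {n} [n t u|n t u|n r args|n phi IH|n phi IH psi IH'|n phi IH]
  m s e /=; rewrite ?eval_tsubst //.
- rewrite (_ : [tuple _ | i < _] =
    [tuple eval S (pull s e) (args i) | i < rel_arity r]) //.
  by apply: eq_from_tnth => i; rewrite !tnth_mktuple eval_tsubst.
- by rewrite IH.
- by rewrite IH IH'.
- split=> -[a] H; exists a; move: H; first by rewrite IH pull_up.
  by rewrite IH pull_up.
Qed.

(* X is in a fixed bijection with M^n; definability in products of such types
   does not involve any reindexing of tuples. *)
Class dtype (X : Type) := DType {
  dn : nat;
  co : X -> 'I_dn -> M;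
  mk : ('I_dn -> M) -> X;
  mkK : forall f i, co (mk f) i = f i;
  coK : forall x, mk (co x) = x }.

Arguments dn X {_}.

#[export] Instance dtype_M : dtype M.
Proof.
apply: (@DType M 1 (fun x _ => x) (fun f => f ord0)) => // f i.
by rewrite [i]ord1.
Defined.

#[export] Instance dtype_unit : dtype unit.
Proof.
apply: (@DType unit 0 (fun _ i => match notF (ltn_ord i) with end) (fun _ =>
  tt)).
  by move=> f [].
by case.
Defined.

#[export] Instance dtype_prod X Y {dX : dtype X} {dY : dtype Y} :
  dtype (X * Y).
Proof.
apply: (@DType (X * Y) (dn X + dn Y)
  (fun p i => match split i with inl j => co p.1 j | inr j => co p.2 j end)
  (fun f => (mk (fun i => f (lshift _ i)), mk (fun i => f (rshift _ i))))).
  by move=> f i; rewrite -[in RHS](splitK i); case: (split i) => j; rewrite mkK.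
move=> [x y] /=; congr pair; rewrite -[RHS]coK; congr mk.
  by apply: functional_extensionality_dep => i; rewrite (unsplitK (inl i)).
by apply: functional_extensionality_dep => i; rewrite (unsplitK (inr i)).
Defined.

(** Nested pairs let quantifiers, dimension, cuts and types over M^n be treated one coordinate at a
    time; [to_pw] and [of_pw] carry the results to any [dtype]. *)
Fixpoint pw n : Type := match n with 0 => unit | n.+1 => (M * pw n)%type end.

#[export] Instance dtype_pw n : dtype (pw n) :=
  (fix F n : dtype (pw n) :=
    match n return dtype (pw n) with
    | 0 => dtype_unit
    | n.+1 => @dtype_prod M (pw n) dtype_M (F n)
    end) n.

#[export] Instance dtype_tuple k : dtype (k.-tuple M).
Proof.
apply: (@DType (k.-tuple M) k (fun t => tnth t) (fun f => [tuple f i | i < k])).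
  by move=> f i; rewrite tnth_mktuple.
by move=> x; apply: eq_from_tnth => i; rewrite tnth_mktuple.
Defined.

Section Definable.
Context {X : Type} {dX : dtype X}.

Definition coords (x : X) : (dn X).-tuple M := [tuple co x i | i < dn X].

Definition dfn (P : X -> Prop) : Prop :=
  exists phi : formula L M (dn X), forall x, P x <-> sat S phi (coords x).

(** Every coordinate of f is a coordinate of the argument or a constant. Along such maps a formula
    is pulled back by renaming variables and inserting parameters. *)
Definition dmap {Y} {dY : dtype Y} (f : X -> Y) : Prop :=
  forall i, (exists j, forall x, co (f x) i = co x j) \/
            (exists a, forall x, co (f x) i = a).

Lemma dfn_ext P Q : (forall x, P x <-> Q x) -> dfn Q -> dfn P.
Proof. by move=> PQ [phi H]; exists phi => x; rewrite PQ. Qed.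

Lemma dfn_and P Q : dfn P -> dfn Q -> dfn (fun x => P x /\ Q x).
Proof. by move=> [p pP] [q qQ]; exists (FAnd p q) => x; rewrite pP qQ. Qed.

Lemma dfn_not P : dfn P -> dfn (fun x => ~ P x).
Proof. by move=> [p pP]; exists (FNot p) => x; rewrite pP. Qed.

Lemma dfn_or P Q : dfn P -> dfn Q -> dfn (fun x => P x \/ Q x).
Proof.
move=> hP hQ; apply: (@dfn_ext _ (fun x => ~ (~ P x /\ ~ Q x))).
  by move=> x; rewrite not_andP !notK.
by apply: dfn_not; apply: dfn_and; apply: dfn_not.
Qed.

Lemma dfn_imp P Q : dfn P -> dfn Q -> dfn (fun x => P x -> Q x).
Proof.
move=> hP hQ; apply: (@dfn_ext _ (fun x => ~ P x \/ Q x)).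
  by move=> x; rewrite implyE.
by apply: dfn_or => //; apply: dfn_not.
Qed.

Lemma dfn_iff P Q : dfn P -> dfn Q -> dfn (fun x => P x <-> Q x).
Proof. by move=> hP hQ; apply: dfn_and; apply: dfn_imp. Qed.

Lemma dfn_and3 P Q R : dfn P -> dfn Q -> dfn R -> dfn (fun x =>
  [/\ P x, Q x & R x]).
Proof.
move=> hP hQ hR; apply: (@dfn_ext _ (fun x => P x /\ Q x /\ R x)).
  by move=> x; split=> [[]|[? []]].
by do 2!apply: dfn_and => //.
Qed.

Lemma dfn_and4 P Q R T : dfn P -> dfn Q -> dfn R -> dfn T ->
  dfn (fun x => [/\ P x, Q x, R x & T x]).
Proof.
move=> hP hQ hR hT; apply: (@dfn_ext _ (fun x => P x /\ Q x /\ R x /\ T x)).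
  by move=> x; split=> [[]|[? [? []]]].
by do 3!apply: dfn_and => //.
Qed.

Lemma dmap_fst {Y Z} {dY : dtype Y} {dZ : dtype Z} (f : X -> Y * Z) :
  dmap f -> dmap (fun x => (f x).1).
Proof.
by move=> h i; have := h (lshift _ i); rewrite /= (unsplitK (inl i)).
Qed.

Lemma dmap_snd {Y Z} {dY : dtype Y} {dZ : dtype Z} (f : X -> Y * Z) :
  dmap f -> dmap (fun x => (f x).2).
Proof.
by move=> h i; have := h (rshift _ i); rewrite /= (unsplitK (inr i)).
Qed.

Lemma dmap_pair {Y Z} {dY : dtype Y} {dZ : dtype Z} (f : X -> Y) (g : X -> Z) :
  dmap f -> dmap g -> dmap (fun x => (f x, g x)).
Proof. by move=> hf hg i /=; case: splitP => j _; [apply: hf|apply: hg]. Qed.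

Lemma dmap_id : dmap (fun x => x).
Proof. by move=> i; left; exists i. Qed.

Lemma dmap_const {Y} {dY : dtype Y} (y : Y) : dmap (fun _ => y).
Proof. by move=> i; right; exists (co y i). Qed.

Lemma dfn_const (P : Prop) : dfn (fun _ : X => P).
Proof.
case: (pselect P) => HP.
  exists (FNot (FEx (FNot (FEq (Var ord0) (Var ord0))))) => x /=; split=> // _.
  by move=> [a []].
by exists (FEx (FNot (FEq (Var ord0) (Var ord0)))) => x /=; split=> // -[a []].
Qed.

Lemma dmap_subst {Y} {dY : dtype Y} (f : X -> Y) : dmap f ->
  exists s : 'I_(dn Y) -> 'I_(dn X) + M, forall x,
    [tuple co (f x) i | i < dn Y] = pull s (coords x).
Proof.
move=> hf; have /choice [s hs] : forall i, exists r : 'I_(dn X) + M,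
  forall x, co (f x) i = match r with inl j => co x j | inr a => a end.
  by move=> i; case: (hf i) => [[j]|[a]] h; [exists (inl j)|exists (inr a)].
exists s => x; apply: eq_from_tnth => i; rewrite !tnth_mktuple hs.
by case: (s i) => // j; rewrite tnth_mktuple.
Qed.

Lemma dfn_lt (f g : X -> M) : dmap f -> dmap g -> dfn (fun x => f x < g x).
Proof.
have tm (h : X -> M) : dmap h ->
    exists t : term L M (dn X), forall x, eval S (coords x) t = h x.
  move=> hh; case: (hh ord0) => [[j hj]|[a ha]]; last by exists (Par a) => x;
    rewrite -(ha x).
  by exists (Var j) => x; rewrite /= tnth_mktuple -hj.
move=> /tm [t ht] /tm [u hu]; exists (FLt t u) => x /=; by rewrite ht hu.
Qed.

Lemma dfn_eq (f g : X -> M) : dmap f -> dmap g -> dfn (fun x => f x = g x).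
Proof.
move=> hf hg; apply: (@dfn_ext _ (fun x => ~ (f x < g x) /\ ~ (g x < f x))).
  move=> x; split=> [->|[]]; first by rewrite ltxx.
  by case: ltgtP.
by apply: dfn_and; apply: dfn_not; apply: dfn_lt.
Qed.

Lemma dfn_le (f g : X -> M) : dmap f -> dmap g -> dfn (fun x => f x <= g x).
Proof.
move=> hf hg; apply: (@dfn_ext _ (fun x => ~ (g x < f x))).
  by move=> x; rewrite leNgt; split => /negP.
by apply: dfn_not; apply: dfn_lt.
Qed.

End Definable.

Lemma dfn_comp {X Y} {dX : dtype X} {dY : dtype Y} (f : X -> Y) (P : Y -> Prop)
  :
  dfn P -> dmap f -> dfn (fun x => P (f x)).
Proof.
move=> [phi hphi] /dmap_subst [s hs]; exists (fsubst phi s) => x.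
by rewrite hphi sat_fsubst -hs.
Qed.

Lemma dmap_comp {X Y Z} {dX : dtype X} {dY : dtype Y} {dZ : dtype Z}
  (f : Y -> Z) (g : X -> Y) : dmap f -> dmap g -> dmap (fun x => f (g x)).
Proof.
move=> hf hg i; case: (hf i) => [[j hj]|[a ha]]; last by right; exists a.
by case: (hg j) => -[k hk]; [left|right]; exists k => x; rewrite hj hk.
Qed.

Lemma dfn_exM {X} {dX : dtype X} (A : M -> X -> Prop) :
  dfn (fun p : M * X => A p.1 p.2) -> dfn (fun x => exists a, A a x).
Proof.
(* [dn (M * X)] computes to [(dn X).+1] with M in front, so [FEx] binds exactly this coordinate. *)
move=> [phi hphi]; exists (FEx (phi : formula L M (dn X).+1)) => x /=.
suff E a : cons_tuple a (coords x) = @coords (M * X) (@dtype_prod M X dtype_M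
  dX) (a, x).
  split=> -[a ha]; exists a; first by rewrite E; apply/(hphi (a, x)).
  by move: ha; rewrite E => /(hphi (a, x)).
apply: eq_from_tnth => i; rewrite [RHS]tnth_mktuple /=.
case: splitP => j e; first by rewrite (_ : i = ord0) ?tnth0 //;
  apply: val_inj; rewrite /= e [j]ord1.
by rewrite (_ : i = lift ord0 j) ?tnthS ?tnth_mktuple //; apply: val_inj.
Qed.

Lemma dfn_expw {X} {dX : dtype X} n (A : pw n -> X -> Prop) :
  dfn (fun p : pw n * X => A p.1 p.2) -> dfn (fun x => exists a, A a x).
Proof.
elim: n X dX A => [|n IH] X dX A hA.
  apply: (@dfn_ext _ _ _ (fun x => A tt x)); first by move=> x;
    split=> [[[]]|] // ?; exists tt.
  apply: (@dfn_comp _ _ _ _ (fun x => (tt, x)) _ hA).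
  by apply: dmap_pair; [exact: dmap_const|exact: dmap_id].
apply: (@dfn_ext _ _ _ (fun x => exists b : pw n, exists a : M, A (a, b) x)).
  by move=> x; split=> [[[a b]]|[b [a]]] ?; [exists b, a|exists (a, b)].
apply: (IH _ _ (fun b x => exists a, A (a, b) x));
  apply: (@dfn_exM _ _ (fun a p => A (a, p.1) p.2)).
apply: (@dfn_comp _ _ _ _ (fun p : M * (pw n * X) =>
  ((p.1, p.2.1), p.2.2)) _ hA).
have id1 := @dmap_id (M * (pw n * X)) _.
by do !apply: dmap_pair; do ?[apply: dmap_fst|apply: dmap_snd].
Qed.

Lemma dn_pw n : dn (pw n) = n.
Proof. by elim: n => //= n IH; rewrite IH. Qed.

Section ToPw.
Context {Y : Type} {dY : dtype Y}.

Definition to_pw (y : Y) : pw (dn Y) := mk (fun i =>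
  co y (cast_ord (dn_pw _) i)).
Definition of_pw (z : pw (dn Y)) : Y :=
  mk (fun i => co z (cast_ord (esym (dn_pw _)) i)).

Lemma to_pwK : cancel to_pw of_pw.
Proof.
move=> y; rewrite /of_pw -[RHS]coK; congr mk;
  apply: functional_extensionality_dep => i.
by rewrite mkK cast_ordKV.
Qed.

Lemma dmap_to_pw {X} {dX : dtype X} (f : X -> Y) : dmap f -> dmap (fun x =>
  to_pw (f x)).
Proof.
move=> hf i; case: (hf (cast_ord (dn_pw _) i)) => -[j hj]; [left|right];
  by exists j => x; rewrite mkK hj.
Qed.

Lemma dmap_of_pw {X} {dX : dtype X} (f : X -> pw (dn Y)) :
  dmap f -> dmap (fun x => of_pw (f x)).
Proof.
move=> hf i; case: (hf (cast_ord (esym (dn_pw _)) i)) => -[j hj]; [left|right];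
  by exists j => x; rewrite mkK hj.
Qed.
End ToPw.

Lemma dfn_ex {X Y} {dX : dtype X} {dY : dtype Y} (A : X -> Y -> Prop) :
  dfn (fun p : X * Y => A p.1 p.2) -> dfn (fun x => exists y, A x y).
Proof.
move=> hA; apply: (@dfn_ext _ _ _ (fun x => exists z, A x (of_pw z))).
  by move=> x; split=> [[y]|[z]] ?; [exists (to_pw y);
    rewrite to_pwK|exists (of_pw z)].
apply: (@dfn_expw _ _ _ (fun z x => A x (of_pw z))).
have h := @dmap_id (pw (dn Y) * X) _.
apply: (@dfn_comp _ _ _ _ (fun p : pw (dn Y) * X => (p.2, of_pw p.1)) _ hA).
by apply: dmap_pair; [apply: dmap_snd|apply/dmap_of_pw/dmap_fst].
Qed.

Lemma dfn_all {X Y} {dX : dtype X} {dY : dtype Y} (A : X -> Y -> Prop) :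
  dfn (fun p : X * Y => A p.1 p.2) -> dfn (fun x => forall y, A x y).
Proof.
move=> hA; apply: (@dfn_ext _ _ _ (fun x => ~ exists y, ~ A x y)).
  move=> x; split=> [h [y /(_ (h y))]//|h y].
  by apply: contrapT => ny; apply: h; exists y.
by apply: dfn_not; apply: dfn_ex; apply: dfn_not.
Qed.

Section Apply.
Context {X Y Z W : Type} {dX : dtype X} {dY : dtype Y} {dZ : dtype Z} {dW :
  dtype W}.

Definition dfn2 (A : X -> Y -> Prop) := dfn (fun p : X * Y => A p.1 p.2).
Definition dfn3 (A : X -> Y -> Z -> Prop) := dfn (fun p : X * Y * Z =>
  A p.1.1 p.1.2 p.2).

Lemma dfn_app2 A (f : W -> X) (g : W -> Y) : dfn2 A -> dmap f -> dmap g ->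
  dfn (fun w => A (f w) (g w)).
Proof.
move=> hA hf hg; apply: (@dfn_comp _ _ _ _ (fun w => (f w, g w)) _ hA).
exact: dmap_pair.
Qed.

Lemma dfn_app3 A (f : W -> X) (g : W -> Y) (h : W -> Z) :
  dfn3 A -> dmap f -> dmap g -> dmap h -> dfn (fun w => A (f w) (g w) (h w)).
Proof.
move=> hA hf hg hh; apply: (@dfn_comp _ _ _ _ (fun w => (f w, g w, h w)) _ hA).
by do !apply: dmap_pair.
Qed.
End Apply.

Ltac dmap_eta := lazymatch goal with
  | |- dmap (fun x => _) => idtac
  | |- @dmap ?X ?dX ?Y ?dY ?f => change (@dmap X dX Y dY (fun x => f x))
  end.

Ltac dmap_tac := dmap_eta; lazymatch goal with
  | H : dmap ?f |- dmap ?f => exact H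
  | |- dmap (fun x => x) => exact dmap_id
  | |- dmap (fun x => fst (@?f x)) => apply (@dmap_fst _ _ _ _ _ _ f); dmap_tac
  | |- dmap (fun x => snd (@?f x)) => apply (@dmap_snd _ _ _ _ _ _ f); dmap_tac
  | |- dmap (fun x => (@?f x, @?g x)) => apply (@dmap_pair _ _ _ _ _ _ f g);
    dmap_tac
  | |- dmap (fun x => to_pw (@?f x)) => apply (@dmap_to_pw _ _ _ _ f); dmap_tac
  | |- dmap (fun x => of_pw (@?f x)) => apply (@dmap_of_pw _ _ _ _ f); dmap_tac
  | H : dmap ?f |- dmap (fun x => ?f (@?g x)) =>
    apply (@dmap_comp _ _ _ _ _ _ f g H); dmap_tac
  | |- dmap (fun _ => ?c) => apply dmap_const
  end.

(* Hooks for the definable operators introduced below. *)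
Ltac dfn_germ := fail.
Ltac dfn_card := fail.
Ltac dfn_dim := fail.

Ltac dfn_eta := lazymatch goal with
  | |- dfn2 _ => unfold dfn2
  | |- dfn3 _ => unfold dfn3
  | |- dfn (fun x => _) => idtac
  | |- @dfn ?X ?dX ?P => change (@dfn X dX (fun x => P x))
  end.

(** Definability is read off from the shape of the predicate: connectives and quantifiers are peeled
    off, and what remains is a comparison of coordinate maps or a relation whose definability is in
    the context. Hence the many auxiliary relations below that are named and shown definable before
    they are used. *)
Ltac dfn_tac := dfn_eta; lazy beta; first
 [ lazymatch goal with
  | |- dfn (fun _ => ?P) => apply dfn_const
  | |- dfn (fun x => _ /\ _) => apply dfn_and; dfn_tac
  | |- dfn (fun x => and3 _ _ _) => apply dfn_and3; dfn_tac
  | |- dfn (fun x => and4 _ _ _ _) => apply dfn_and4; dfn_tac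
  | |- dfn (fun x => _ \/ _) => apply dfn_or; dfn_tac
  | |- dfn (fun x => ~ _) => apply dfn_not; dfn_tac
  | |- dfn (fun x => _ <-> _) => apply dfn_iff; dfn_tac
  | |- dfn (fun x => exists y : ?Y, @?A x y) => apply (@dfn_ex _ Y _ _ A);
    dfn_tac
  | |- dfn (fun x => @?A x -> @?B x) => apply (@dfn_imp _ _ A B); dfn_tac
  | |- dfn (fun x => forall y : ?Y, @?A x y) => apply (@dfn_all _ Y _ _ A);
    dfn_tac
  | |- dfn (fun x => @eq _ (@?f x) (@?g x)) => apply (@dfn_eq _ _ f g); dmap_tac
  | |- dfn (fun x => is_true (Order.le (@?f x) (@?g x))) =>
    apply (@dfn_le _ _ f g); dmap_tac
  | |- dfn (fun x => is_true (Order.lt (@?f x) (@?g x))) =>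
    apply (@dfn_lt _ _ f g); dmap_tac
  | |- dfn (fun x => is_true (andb (@?f x) (@?g x))) =>
     apply (@dfn_ext _ _ _ (fun x => is_true (f x) /\ is_true (g x)));
     [intro; split; [move/andP|move=> ?; apply/andP]; done | dfn_tac]
  end
 | match goal with
  | H : dfn ?P |- dfn (fun x => ?P (@?f x)) =>
    apply (@dfn_comp _ _ _ _ f P H); dmap_tac
  | H : dfn2 ?A |- dfn (fun x => ?A (@?f x) (@?g x)) =>
    apply (@dfn_app2 _ _ _ _ _ _ A f g H); dmap_tac
  | H : dfn3 ?A |- dfn (fun x => ?A (@?f x) (@?g x) (@?h x)) =>
     apply (@dfn_app3 _ _ _ _ _ _ _ _ A f g h H); dmap_tac
  end
 | progress first [dfn_germ | dfn_card | dfn_dim]; dfn_tac ].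

(** * Definable subsets of the line *)

Hypothesis HM : o_minimal S.

Lemma M_dense (x y : M) : x < y -> exists z, x < z < y.
Proof. by case: HM => -[_ h _ _] _; apply: h. Qed.

Lemma M_below (x : M) : exists y, y < x.
Proof. by case: HM => -[_ _ h _] _; apply: h. Qed.

Lemma M_above (x : M) : exists y, x < y.
Proof. by case: HM => -[_ _ _ h] _; apply: h. Qed.

Lemma M_point : inhabited M.
Proof. by case: HM => -[]. Qed.

(** F collects the finite endpoints of the intervals that make up P: if no point of F lies in
    [x, y], then x and y belong to the same intervals. All later uses of o-minimality for sets go
    through this form. *)
Lemma breakpoints (P : M -> Prop) : dfn P -> exists F : seq M,
  forall x y, x < y -> (forall f, f \in F -> ~ (x <= f <= y)) -> (P x <-> P y).
Proof.
move=> [phi hphi]; case: HM => _ /(_ [set a | sat S phi a]) [|s hs].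
  by exists phi.
have {hs} hs x : P x <-> has (fun i : interval M => x \in i) s.
  rewrite hphi -hs /= (_ : [tuple x] = @coords M dtype_M x) //.
  by apply: eq_from_tnth => i; rewrite tnth_mktuple [i]ord1.
suff [F hF] : exists F : seq M, forall x y, x < y ->
    (forall f, f \in F -> ~ (x <= f <= y)) ->
    has (fun i : interval M => x \in i) s = has (fun i : interval M =>
      y \in i) s.
  by exists F => x y xy h; rewrite !hs (hF x y).
elim: {hs} s => [|[l u] s [F hF]]; first by exists [::].
pose pt (b : itv_bound M) := if b is BSide _ a then [:: a] else [::].
exists (pt l ++ pt u ++ F) => x y xy h /=.
rewrite (hF x y) //; last by move=> f fF; apply: h; rewrite !mem_cat fF !orbT.
congr orb; rewrite !itv_boundlr.
have hb a : a \in pt l ++ pt u ++ F -> ((a <= x) = (a <= y)) * ((a < x) = (a <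
  y)) *
   ((x <= a) = (y <= a)) * ((x < a) = (y < a)).
  move=> /h /negP; rewrite negb_and -!ltNge => /orP[ax|ya].
    have ay := lt_trans ax xy.
    by rewrite ax ay (ltW ax) (ltW ay) (lt_geF ax) (lt_geF ay) (lt_gtF ax)
      (lt_gtF ay).
  have xa := lt_trans xy ya.
  by rewrite xa ya (ltW xa) (ltW ya) (lt_geF xa) (lt_geF ya) (lt_gtF xa)
    (lt_gtF ya).
congr andb.
  case: l h hb => [[] a|[]] h hb //=; rewrite !bnd_simp;
  by rewrite hb //= inE eqxx.
case: u h hb => [[] a|[]] h hb //=; rewrite !bnd_simp;
by rewrite hb // mem_cat inE eqxx orbT.
Qed.

Lemma seq_max (s : seq M) (Q : M -> Prop) : (exists x, x \in s /\ Q x) ->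
  exists x, [/\ x \in s, Q x & forall y, y \in s -> Q y -> y <= x].
Proof.
elim: s => [|a s IH] [x [xs Qx]] //.
case: (pselect (exists y, y \in s /\ Q y)) => [/IH [m [ms Qm hm]]|no];
  last first.
  have Qa : Q a by move: xs; rewrite inE => /orP[/eqP<-//|xs]; case: no;
    exists x.
  exists a; split=> //; first by rewrite inE eqxx.
  by move=> y; rewrite inE => /orP[/eqP->//|ys Qy]; case: no; exists y.
case: (pselect (Q a /\ m <= a)) => [[Qa ma]|no].
  exists a; split=> //; first by rewrite inE eqxx.
  by move=> y; rewrite inE => /orP[/eqP->//|ys Qy];
    apply: le_trans (hm _ ys Qy) ma.
exists m; split=> //; first by rewrite inE ms orbT.
move=> y; rewrite inE => /orP[/eqP-> Qa|]; last exact: hm.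
by rewrite leNgt; apply/negP => ma; case: no; split => //; apply: ltW.
Qed.

Lemma seq_min (s : seq M) (Q : M -> Prop) : (exists x, x \in s /\ Q x) ->
  exists x, [/\ x \in s, Q x & forall y, y \in s -> Q y -> x <= y].
Proof.
elim: s => [|a s IH] [x [xs Qx]] //.
case: (pselect (exists y, y \in s /\ Q y)) => [/IH [m [ms Qm hm]]|no];
  last first.
  have Qa : Q a by move: xs; rewrite inE => /orP[/eqP<-//|xs]; case: no;
    exists x.
  exists a; split=> //; first by rewrite inE eqxx.
  by move=> y; rewrite inE => /orP[/eqP->//|ys Qy]; case: no; exists y.
case: (pselect (Q a /\ a <= m)) => [[Qa ma]|no].
  exists a; split=> //; first by rewrite inE eqxx.
  by move=> y; rewrite inE => /orP[/eqP->//|ys Qy];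
    apply: le_trans ma (hm _ ys Qy).
exists m; split=> //; first by rewrite inE ms orbT.
move=> y; rewrite inE => /orP[/eqP-> Qa|]; last exact: hm.
by rewrite leNgt; apply/negP => ma; case: no; split => //; apply: ltW.
Qed.

Lemma seq_gap_right (F : seq M) a :
  exists b, a < b /\ forall f, f \in F -> ~ (a < f < b).
Proof.
case: (pselect (exists f, f \in F /\ a < f)) => [/seq_min [b [_ ab hb]]|no].
  by exists b; split=> // f fF /andP[af]; rewrite ltNge hb.
have [b ab] := M_above a; exists b; split=> // f fF /andP[af _].
by apply: no; exists f.
Qed.

Lemma seq_gap_left (F : seq M) a :
  exists b, b < a /\ forall f, f \in F -> ~ (b < f < a).
Proof.
case: (pselect (exists f, f \in F /\ f < a)) => [/seq_max [b [_ ab hb]]|no].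
  by exists b; split=> // f fF /andP[bf fa]; move: bf; rewrite ltNge hb.
have [b ab] := M_below a; exists b; split=> // f fF /andP[_ af].
by apply: no; exists f.
Qed.

Lemma seq_gap_const (P : M -> Prop) (F : seq M) (l u : M) :
  (forall x y, x < y -> (forall f,
    f \in F -> ~ (x <= f <= y)) -> (P x <-> P y)) ->
  (forall f, f \in F -> ~ (l < f < u)) ->
  forall x y, l < x < u -> l < y < u -> (P x <-> P y).
Proof.
move=> hF hlu; suff W x y : l < x < u -> l < y < u -> x < y -> (P x <-> P y).
  move=> x y hx hy; case: (ltgtP x y) => [| |->//]; first exact: W.
  by move=> yx; rewrite (W y x).
move=> /andP[lx xu] /andP[ly yu] xy; apply: hF => // f fF /andP[xf fy].
by apply: (hlu f fF); rewrite (lt_le_trans lx xf) (le_lt_trans fy yu).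
Qed.

(** * Fat sets and one-sided germs *)

Definition fat (P : M -> Prop) :=
  exists a b, a < b /\ forall x, a < x < b -> P x.
(** The four germs are the definable 1-types a+, a-, plus and minus infinity; the lemmas [germR_dec]
    to [germN_dec] say that each decides every definable set. *)
Definition germR a (P : M -> Prop) :=
  exists b, a < b /\ forall x, a < x < b -> P x.
Definition germL a (P : M -> Prop) :=
  exists b, b < a /\ forall x, b < x < a -> P x.
Definition germP (P : M -> Prop) := exists b, forall x, b < x -> P x.
Definition germN (P : M -> Prop) := exists b, forall x, x < b -> P x.

Section Germs.
Variables (P Q : M -> Prop).
Hypothesis hP : dfn P.

Lemma germR_dec a : germR a P \/ germR a (fun x => ~ P x).
Proof.
have [F hF] := breakpoints hP; have [b [ab hb]] := seq_gap_right F a.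
have [m hm] := M_dense ab; case: (pselect (P m)) => Pm; [left|right];
  exists b; split=> // x hx; by rewrite (seq_gap_const hF hb hx hm).
Qed.

Lemma germL_dec a : germL a P \/ germL a (fun x => ~ P x).
Proof.
have [F hF] := breakpoints hP; have [b [ab hb]] := seq_gap_left F a.
have [m hm] := M_dense ab; case: (pselect (P m)) => Pm; [left|right];
  exists b; split=> // x hx; by rewrite (seq_gap_const hF hb hx hm).
Qed.

Lemma germP_dec : germP P \/ germP (fun x => ~ P x).
Proof.
have [F hF] := breakpoints hP; have [a] := M_point.
have [b hb] : exists b, forall f, f \in F -> f < b.
  case: (seq_max (s := a :: F) (Q := fun _ => True)).
    by exists a; rewrite inE eqxx.
  move=> m [_ _ hm]; have [b mb] := M_above m; exists b => f fF.
  by apply: le_lt_trans mb; apply: hm => //; rewrite inE fF orbT.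
have K x : b < x -> (P b <-> P x).
  by move=> bx; apply: hF => // f /hb fb /andP[]; rewrite leNgt fb.
by case: (pselect (P b)) => Pb; [left|right]; exists b => x /K <-.
Qed.

Lemma germN_dec : germN P \/ germN (fun x => ~ P x).
Proof.
have [F hF] := breakpoints hP; have [a] := M_point.
have [b hb] : exists b, forall f, f \in F -> b < f.
  case: (seq_min (s := a :: F) (Q := fun _ => True)).
    by exists a; rewrite inE eqxx.
  move=> m [_ _ hm]; have [b mb] := M_below m; exists b => f fF.
  by apply: lt_le_trans mb _; apply: hm => //; rewrite inE fF orbT.
have K x : x < b -> (P x <-> P b).
  by move=> bx; apply: hF => // f /hb fb /andP[_]; rewrite leNgt fb.
by case: (pselect (P b)) => Pb; [left|right]; exists b => x /K ->.
Qed.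

(** Definable completeness: a definable initial segment that is neither empty nor everything has a
    supremum in M. This replaces Dedekind completeness in every sup argument below. *)
Lemma dfn_sup : (exists x, P x) -> (exists x, ~ P x) ->
  (forall x y, x <= y -> P y -> P x) ->
  exists a, (forall x, x < a -> P x) /\ (forall x, a < x -> ~ P x).
Proof.
move=> [x0 Px0] [y0 Py0] dn; have [F hF] := breakpoints hP.
have [a [_ Pa ha]] : exists a, [/\ a \in x0 :: F, P a & forall y,
  y \in x0 :: F -> P y -> y <= a].
  by apply: seq_max; exists x0; rewrite inE eqxx.
have [b [_ Pb hb]] : exists a, [/\ a \in y0 :: F, ~ P a & forall y,
  y \in y0 :: F -> ~ P y -> a <= y].
  by apply: seq_min; exists y0; rewrite inE eqxx.
(* No breakpoint lies strictly between a and b, so P is constant there and the supremum is a or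
   b. *)
have ab : a < b by rewrite ltNge; apply/negP => ba; apply: Pb; apply: dn Pa.
have [m hm] := M_dense ab.
have K x y : a < x < b -> a < y < b -> (P x <-> P y).
  apply: (seq_gap_const hF) => f fF /andP[af fb].
  case: (pselect (P f)) => Pf.
    by move: af; rewrite ltNge ha // inE fF orbT.
  by move: fb; rewrite ltNge hb // inE fF orbT.
case: (pselect (P m)) => Pm.
  exists b; split=> x hx; last by move=> Px; apply: Pb; apply: dn Px;
    apply: ltW.
  case: (leP x a) => xa; first exact: dn xa Pa.
  by apply/(K x m) => //; rewrite xa.
exists a; split=> x hx; first by apply: dn Pa; apply: ltW.
move=> Px; case: (ltP x b) => xb; first by apply/Pm/(K m x) => //; rewrite hx.
by apply: Pb; apply: dn Px.
Qed.

(** A point of P away from all breakpoints has a whole interval of P around it. With [fat_not_seq]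
    this identifies the fat definable sets with the infinite ones. *)
Lemma nonfat_seq : ~ fat P -> exists s : seq M, forall x, P x -> x \in s.
Proof.
move=> nf; have [F hF] := breakpoints hP; exists F => x Px.
apply: contrapT => /negP xF; apply: nf.
have [l [lx hl]] := seq_gap_left F x; have [u [xu hu]] := seq_gap_right F x.
exists l, u; split; first exact: lt_trans lx xu.
have K : forall f, f \in F -> ~ (l < f < u).
  move=> f fF /andP[lf fu]; case: (ltgtP f x) => fx.
  - by apply: (hl f); rewrite // lf.
  - by apply: (hu f); rewrite // fx.
  - by move: xF; rewrite -fx fF.
by move=> y hy; apply/(seq_gap_const hF K hy (y := x)); rewrite ?lx.
Qed.

Lemma fat_mono : (forall x, P x -> Q x) -> fat P -> fat Q.
Proof. by move=> PQ [a [b [ab h]]]; exists a, b; split=> // x /h /PQ. Qed.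

Lemma fat_itv a b : a < b -> exists c, [/\ a < c, c <= b &
  (forall x, a < x < c -> P x) \/ (forall x, a < x < c -> ~ P x)].
Proof.
move=> ab; case: (germR_dec a) => -[c [ac hc]]; exists (Order.min b c);
  rewrite lt_min ab ac ge_min lexx; split=> //; [left|right] => x /andP[ax];
  by rewrite lt_min => /andP[_ xc]; apply: hc; rewrite ax.
Qed.

Lemma fat_or : fat (fun x => P x \/ Q x) -> fat P \/ fat Q.
Proof.
move=> [a [b [ab h]]]; have [c [ac cb [hc|hc]]] := fat_itv ab; first by left;
  exists a, c.
right; exists a, c; split=> // x /andP[ax xc].
case: (h x); rewrite ?ax ?(lt_le_trans xc cb) // => Px.
by case: (hc x) => //; rewrite ax.
Qed.

Lemma nonfat_min : ~ fat P -> (exists x, P x) ->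
  exists m, P m /\ forall x, P x -> m <= x.
Proof.
move=> /nonfat_seq [s hs] [x Px]; have [|m [ms Pm hm]] := @seq_min s P.
  by exists x; split=> //; apply: hs.
by exists m; split=> // y Py; apply: hm => //; apply: hs.
Qed.

Lemma nonfat_max : ~ fat P -> (exists x, P x) ->
  exists m, P m /\ forall x, P x -> x <= m.
Proof.
move=> /nonfat_seq [s hs] [x Px]; have [|m [ms Pm hm]] := @seq_max s P.
  by exists x; split=> //; apply: hs.
by exists m; split=> // y Py; apply: hm => //; apply: hs.
Qed.

End Germs.

Lemma itv_not_seq (a b : M) (s : seq M) : a < b -> exists x,
  a < x < b /\ x \notin s.
Proof.
elim: s b => [|c s IH] b ab; first by have [x hx] := M_dense ab; exists x.
case: (boolP (a < c < b)) => hc.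
  case/andP: (hc) => ac cb; have [x [/andP[ax xc] xs]] := IH c ac; exists x;
    split.
    by rewrite ax (lt_trans xc cb).
  by rewrite inE negb_or xs (lt_eqF xc).
have [x [hx xs]] := IH b ab; exists x; split=> //.
by rewrite inE negb_or xs andbT; apply: contraNneq hc => <-.
Qed.

Lemma fat_not_seq (P : M -> Prop) (s : seq M) : fat P -> exists x,
  P x /\ x \notin s.
Proof.
by move=> [a [b [/(@itv_not_seq _ _ s) [x [hx xs]] h]]]; exists x; split=> //;
  apply: h.
Qed.

Lemma dfn_fat {X} {dX : dtype X} (A : X -> M -> Prop) : dfn2 A -> dfn (fun x =>
  fat (A x)).
Proof. by move=> hA; rewrite /fat; dfn_tac. Qed.
Lemma dfn_germR {X} {dX : dtype X} (f : X -> M) (A : X -> M -> Prop) :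
  dmap f -> dfn2 A -> dfn (fun x => germR (f x) (A x)).
Proof. by move=> hf hA; rewrite /germR; dfn_tac. Qed.
Lemma dfn_germL {X} {dX : dtype X} (f : X -> M) (A : X -> M -> Prop) :
  dmap f -> dfn2 A -> dfn (fun x => germL (f x) (A x)).
Proof. by move=> hf hA; rewrite /germL; dfn_tac. Qed.
Lemma dfn_germP {X} {dX : dtype X} (A : X -> M -> Prop) : dfn2 A -> dfn (fun x
  => germP (A x)).
Proof. by move=> hA; rewrite /germP; dfn_tac. Qed.
Lemma dfn_germN {X} {dX : dtype X} (A : X -> M -> Prop) : dfn2 A -> dfn (fun x
  => germN (A x)).
Proof. by move=> hA; rewrite /germN; dfn_tac. Qed.

Ltac dfn_germ ::= lazymatch goal with
  | |- dfn (fun x => fat (@?A x)) => apply (@dfn_fat _ _ A)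
  | |- dfn (fun x => germR (@?f x) (@?A x)) => apply (@dfn_germR _ _ f A);
    [dmap_tac|]
  | |- dfn (fun x => germL (@?f x) (@?A x)) => apply (@dfn_germL _ _ f A);
    [dmap_tac|]
  | |- dfn (fun x => germP (@?A x)) => apply (@dfn_germP _ _ A)
  | |- dfn (fun x => germN (@?A x)) => apply (@dfn_germN _ _ A)
  end.

(** Intervals are definably connected: local constancy at the supremum of the initial part on which
    P agrees with P x pushes this part further, until it reaches y. *)
Lemma dfn_connected (P : M -> Prop) x y : dfn P -> x < y ->
  (forall z, x <= z <= y -> exists l u, l < z < u /\ forall w,
    l < w < u -> (P w <-> P z)) ->
  (P x <-> P y).
Proof.
move=> hP xy loc.
(* The points below x are included to make Q an initial segment of M, as [dfn_sup] requires. *)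
pose Q z := z < x \/ z <= y /\ forall w, x <= w <= z -> (P w <-> P x).
have [] := @dfn_sup Q.
- by rewrite /Q; dfn_tac.
- by exists x; right; split; [exact: ltW|] => w; rewrite -eq_le => /eqP <-.
- have [z yz] := M_above y; exists z => -[zx|[zy _]].
    by move: (lt_trans (lt_trans zx xy) yz); rewrite ltxx.
  by move: yz; rewrite ltNge zy.
- move=> u v uv [vx|[vy h]]; first by left; apply: le_lt_trans uv vx.
  right; split; first exact: le_trans uv vy.
  by move=> w /andP[xw wu]; apply: h; rewrite xw (le_trans wu uv).
move=> a [hlo hhi].
have Qx : Q x by right; split; [exact: ltW|] => w; rewrite -eq_le => /eqP <-.
have xa : x <= a by rewrite leNgt; apply/negP => /hhi.
have ay : a <= y.
  rewrite leNgt; apply/negP => ya;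
    have [z /andP[yz /hlo [zx|[zy _]]]] := M_dense ya.
    by move: (lt_trans (lt_trans zx xy) yz); rewrite ltxx.
  by move: yz; rewrite ltNge zy.
have [l [u [/andP[la au] hlu]]] := loc a (introT andP (conj xa ay)).
have below w : x <= w -> w < a -> (P w <-> P x).
  move=> xw wa; case: (hlo w wa) => [|[_]]; first by rewrite ltNge xw.
  by apply; rewrite xw lexx.
have Pa : P a <-> P x.
  case: (ltgtP x a) xa => [xa _| |->] //.
  have [w /andP[]] : exists w, Order.max l x < w < a by apply: M_dense;
    rewrite gt_max la.
  rewrite gt_max => /andP[lw xw] wa; rewrite -(hlu w);
    last by rewrite lw (lt_trans wa au).
  by apply: below => //; apply: ltW.
case: (ltgtP a y) ay => [ay _| // |<- _]; last by rewrite Pa.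
have [w /andP[aw]] : exists w, a < w < Order.min u y by apply: M_dense;
  rewrite lt_min au.
rewrite lt_min => /andP[wu wy]; case: (hhi w aw); right; split;
  first exact: ltW.
move=> v /andP[xv vw]; case: (ltgtP v a) => [va|av|->] //; first exact: below.
by rewrite hlu // (lt_trans la av) (le_lt_trans vw wu).
Qed.

(* The minimum m of {a | H a x} is locally constant to the right of every x,
   hence constant near c+, where it would have to be both > c and < x. *)
Lemma selfmap_uniform (H : M -> M -> Prop) c c' : dfn2 H -> c < c' ->
  (forall a s, H a s -> a < s) ->
  (forall a s, H a s -> exists s', s < s' /\ H a s') ->
  (forall a s s', H a s -> a < s' -> s' <= s -> H a s') ->
  (forall a, c < a < c' -> exists s, H a s) ->
  exists s, fat (fun a => c < a < c' /\ H a s).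
Proof.
move=> hH cc' Hlt Hup Hdn Hex; apply: contrapT => /forallNP nofat.
pose T x a := c < a < c' /\ H a x.
have hT x : dfn (T x) by rewrite /T; dfn_tac.
pose mu x m := T x m /\ forall a, T x a -> m <= a.
have mu_inj x m m' : mu x m -> mu x m' -> m = m'.
  by move=> [h1 h2] [h3 h4]; apply/eqP; rewrite eq_le h2 // h4.
have [e1 [ce1 he1]] : germR c (fun x => c < x < c' /\ exists a, T x a).
  have [[e [ce he]]|[e [ce he]]] := @germR_dec (fun x =>
    c < x < c' /\ exists a, T x a) ltac:(rewrite /T; dfn_tac) c.
    by exists e.
  have [a /andP[ca]] : exists a, c < a < Order.min e c' by apply: M_dense;
    rewrite lt_min ce.
  rewrite lt_min => /andP[ae ac']; have [|s Hs] := Hex a; first by rewrite ca.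
  have [x /andP[ax]] : exists x, a < x < Order.min (Order.min e c') s.
    by apply: M_dense; rewrite !lt_min ae ac' (Hlt _ _ Hs).
  rewrite !lt_min => /andP[/andP[xe xc'] xs].
  case: (he x); first by rewrite (lt_trans ca ax).
  split; first by rewrite (lt_trans ca ax).
  by exists a; split; [rewrite ca|apply: Hdn Hs _ _ => //; apply: ltW].
have mu_ex x : c < x < e1 -> exists m, mu x m.
  by move=> /he1 [_ hx]; apply: nonfat_min (hT x) (nofat x) hx.
have mu_right x m : mu x m -> germR x (fun x' => mu x' m).
  move=> [[hm Hm] hmin]; have [s' [xs' Hs']] := Hup _ _ Hm.
  exists s'; split=> // x' /andP[xx' x's']; split.
    by split=> //; apply: Hdn Hs' _ _;
      [apply: lt_trans (Hlt _ _ Hm) xx'|apply: ltW].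
  move=> a [ha Ha]; rewrite leNgt; apply/negP => am.
  have : m <= a; last by rewrite leNgt am.
  apply: hmin; split=> //; apply: Hdn Ha _ _; last exact: ltW.
  exact: lt_trans am (Hlt _ _ Hm).
have hmu : dfn2 mu by rewrite /mu /T; dfn_tac.
(* W holds where [mu] jumps from the left. It cannot fill an interval, since constancy to the right
   of x gives constancy to the left of every y slightly beyond x. *)
pose W x := exists m, mu x m /\ ~ germL x (fun y => mu y m).
have [e2 [ce2 he2]] : germR c (fun x => ~ W x).
  have [|[e [ce he]]|//] := @germR_dec W _ c; first by rewrite /W; dfn_tac.
  have [x /andP[cx]] : exists x, c < x < Order.min e e1 by apply: M_dense;
    rewrite lt_min ce.
  rewrite lt_min => /andP[xe xe1].
  have [|m hm] := mu_ex x; first by rewrite cx.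
  have [b [xb hb]] := mu_right _ _ hm.
  have [y /andP[xy]] : exists y, x < y < Order.min e b by apply: M_dense;
    rewrite lt_min xe.
  rewrite lt_min => /andP[ye yb]; have [|m' [hm' []]] := he y;
    first by rewrite ye (lt_trans cx xy).
  have <- : m = m' by apply: mu_inj hm'; apply: hb; rewrite xy.
  by exists x; split=> // z /andP[xz zy]; apply: hb; rewrite xz (lt_trans zy).
have [x0 /andP[cx0]] : exists x, c < x < Order.min e1 e2 by apply: M_dense;
  rewrite lt_min ce1.
rewrite lt_min => /andP[x0e1 x0e2].
have [|m hm] := mu_ex x0; first by rewrite cx0.
have cm : c < m by case: hm => -[/andP[]].
have mx0 : m < x0 by case: hm => -[_ /Hlt].
have [x /andP[cx xm]] := M_dense cm.
suff [_ /(_ hm) [[_ /Hlt]]] : mu x m <-> mu x0 m by rewrite ltNge ltW.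
apply: (@dfn_connected (fun x => mu x m)); [dfn_tac|exact: lt_trans xm mx0|].
move=> z /andP[xz zx0]; have cz := lt_le_trans cx xz.
have [|n hn] := mu_ex z; first by rewrite cz (le_lt_trans zx0).
have [u [zu hu]] := mu_right _ _ hn.
have [l [lz hl]] : germL z (fun y => mu y n).
  apply: contrapT => nz; apply: (he2 z); first by rewrite cz (le_lt_trans zx0).
  by exists n.
exists l, u; rewrite lz zu; split=> // w /andP[lw wu].
have hw : mu w n.
  by case: (ltgtP w z) => [wz|zw|->//]; [apply: hl; rewrite lw|apply: hu;
    rewrite zw].
by split=> h; [rewrite (mu_inj _ _ _ h hw)|rewrite (mu_inj _ _ _ h hn)].
Qed.

(** Consider the maxima of the finite sets [D s] inside an interval covered by their union. If they
    fill an interval, monotonicity puts all those below a given maximum into a single [D s]. If not,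
    there is a largest one, and the points beyond it are not covered. *)
Lemma nonfat_directed_union (Q : M -> Prop) (D : M -> M -> Prop) : dfn Q ->
  dfn2 D ->
  (forall s, Q s -> ~ fat (D s)) ->
  (forall s s' y, Q s -> Q s' -> s < s' -> D s' y -> D s y) ->
  ~ fat (fun y => exists s, Q s /\ D s y).
Proof.
move=> hQ hD nf mono [e [e' [ee' he]]].
pose mx s y := (e < y < e' /\ D s y) /\ forall y',
  e < y' < e' /\ D s y' -> y' <= y.
have mx_ex s y : Q s -> e < y < e' -> D s y -> exists z, mx s z /\ y <= z.
  move=> Qs ey Dy; have [|||z [hz hm]] := @nonfat_max (fun y =>
    e < y < e' /\ D s y).
  - by dfn_tac.
  - by move=> /fat_mono h; apply: (nf s) => //; apply: h => ? [].
  - by exists y.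
  - by exists z; split=> //; apply: hm.
pose Y y := exists s, Q s /\ mx s y.
have hY : dfn Y by rewrite /Y /mx; dfn_tac.
case: (pselect (fat Y)) => [[f [f' [ff' hf]]]|nY].
  have [y2 hy2] := M_dense ff'; have [s2 [Qs2 [[ey2 Dy2] hm2]]] := hf _ hy2.
  apply: (nf s2) => //; exists f, y2; case/andP: hy2 => fy2 y2f';
    split=> // y /andP[fy yy2].
  have [|s [Qs [[ey Dy] hm]]] := hf y; first by rewrite fy (lt_trans yy2).
  case: (ltgtP s2 s) => s2s; first exact: mono Dy.
    have : y2 <= y by apply: hm; split=> //; apply: mono Dy2.
    by rewrite leNgt yy2.
  by rewrite s2s.
have [y0 hy0] := M_dense ee'; have [s0 [Qs0 Dy0]] := he _ hy0.
have [z0 [hz0 _]] := mx_ex _ _ Qs0 hy0 Dy0.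
have [|z [[s [Qs [[/andP[ez ze'] _] _]]] hz]] := nonfat_max hY nY;
  first by exists z0, s0.
have [y /andP[zy ye']] := M_dense ze';
  have ey : e < y < e' by rewrite ye' (lt_trans ez).
have [s1 [Qs1 Dy]] := he _ ey; have [w [hw yw]] := mx_ex _ _ Qs1 ey Dy.
have : w <= z by apply: hz; exists s1.
by rewrite leNgt (lt_le_trans zy yw).
Qed.

Lemma mem_In (s : seq M) x : x \in s -> List.In x s.
Proof.
by elim: s => //= y s IH; rewrite inE => /orP[/eqP->|/IH]; [left|right].
Qed.

Lemma fat_not_cover (P : M -> Prop) (T : Type) (ts : seq T) (R : T -> M ->
  Prop) :
  fat P -> (forall t x y, R t x -> R t y -> x = y) ->
  exists x, P x /\ forall t, List.In t ts -> ~ R t x.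
Proof.
move=> fP inj; suff [s hs] : exists s : seq M, forall t x,
  List.In t ts -> R t x -> x \in s.
  by have [x [Px xs]] := fat_not_seq s fP; exists x;
    split=> // t tts /(hs _ _ tts); exact/negP.
elim: ts => [|t ts [s hs]]; first by exists [::].
case: (pselect (exists x, R t x)) => [[x Rx]|no].
  exists (x :: s) => u y /= [<- /(inj _ _ _ Rx) ->|uts /(hs _ _ uts)];
    rewrite inE ?eqxx //.
  by move=> ->; rewrite orbT.
by exists s => u y /= [<- Ry|uts /(hs _ _ uts)//]; case: no; exists y.
Qed.

Lemma fat_bigor (T : Type) (ts : seq T) (R : T -> M -> Prop) : (forall t,
  dfn (R t)) ->
  fat (fun x => exists t, List.In t ts /\ R t x) -> exists t,
    List.In t ts /\ fat (R t).
Proof.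
move=> hR; elim: ts => [|t ts IH].
  by move=> [a [b [/M_dense [x hx] /(_ x hx) [? []]]]].
move=> /(fat_mono (Q := fun x => R t x \/ exists u, List.In u ts /\ R u x)) h.
have {h} /(fat_or (hR t)) [|/IH [u [uts fu]]] : fat (fun x =>
  R t x \/ exists u, List.In u ts /\ R u x).
- by apply: h => x [u [/= [<-|uts] Ru]]; [left|right; exists u].
- by exists t; split=> //; left.
- by exists u; split=> //; right.
Qed.

(** The left end of the first interval inside P: a substitute for definable choice from a fat set.
    It is the supremum of the points l such that no interval of P starts at or before l. *)
Lemma left_end (P : M -> Prop) : dfn P -> fat P ->
  germN P \/ exists l, germR l P /\ forall l', l' < l -> ~ germR l' P.
Proof.
move=> hP [c [c' [cc' hc]]]; pose B l := forall l', l' <= l -> ~ germR l' P.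
have hB : dfn B by rewrite /B; dfn_tac.
case: (pselect (exists l, B l)) => [exB|noB]; last first.
  left; have [//|[b hb]] := germN_dec hP; have [a ab] := M_below b.
  case: noB; exists a => l' l'a [u [l'u hu]].
  have [x /andP[l'x]] : exists x, l' < x < Order.min u b.
    by apply: M_dense; rewrite lt_min l'u (le_lt_trans l'a).
  by rewrite lt_min => /andP[xu /hb]; apply; apply: hu; rewrite l'x.
right; have [//||x y xy By l' l'x|a [alo ahi]] := dfn_sup hB.
- by exists c => /(_ c (lexx _)); apply; exists c'.
- by apply: By; apply: le_trans l'x xy.
exists a; split=> [|l' /alo]; last by apply.
have [//|[b [ab hb]]] := germR_dec hP a.
have [x /andP[ax xb]] := M_dense ab; case: (ahi x ax) => l' l'x [u [l'u hu]].
case: (ltP l' a) => [/alo /(_ l' (lexx _))|al']; first by apply; exists u.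
have [y /andP[l'y]] : exists y, l' < y < Order.min u b.
  by apply: M_dense; rewrite lt_min l'u (le_lt_trans l'x).
rewrite lt_min => /andP[yu yb]; case: (hb y);
  first by rewrite yb (le_lt_trans al').
by apply: hu; rewrite l'y.
Qed.

(** Otherwise every s belongs to finitely many [S' t] only. If all [S' t] in an interval contain a
    neighbourhood of minus infinity, or infinitely many of them share their left end, then
    [nonfat_directed_union] is contradicted. The remaining case, infinitely many left ends, is
    settled by [selfmap_uniform]. *)
Lemma fat_fubini (S' : M -> M -> Prop) a b : dfn2 S' -> a < b ->
  (forall t, a < t < b -> fat (S' t)) ->
  exists s, fat (fun t => a < t < b /\ S' t s).
Proof.
move=> hS ab fS; apply: contrapT => /forallNP nofat.
have nf (P : M -> Prop) s : (forall t, P t -> a < t < b /\ S' t s) -> ~ fat P.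
  by move=> h /(fat_mono h); apply: nofat.
have dS t : dfn (S' t) by dfn_tac.
have [|c [ac cb [gN|gN]]] := @fat_itv (fun t => germN (S' t)) _ a b ab.
- by dfn_tac.
- apply: (@nonfat_directed_union (fun _ => True) (fun s t =>
    a < t < c /\ forall z, z <= s -> S' t z)).
  + by dfn_tac.
  + by dfn_tac.
  + move=> s _; apply: (nf _ s) => t [/andP[at_ tc] h];
      rewrite at_ (lt_le_trans tc cb).
    by split=> //; apply: h.
  + by move=> s s' t _ _ ss' [? h]; split=> // z zs; apply: h;
      apply: le_trans zs (ltW ss').
  + exists a, c; split=> // t at_; have [l hl] := gN t at_;
      have [s sl] := M_below l.
    by exists s; split=> //; split=> // z zs; apply: hl;
      apply: le_lt_trans zs sl.
pose LE t l := germR l (S' t) /\ forall l', l' < l -> ~ germR l' (S' t).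
have hLE : dfn2 LE by rewrite /LE; dfn_tac.
have LE_inj t l l' : LE t l -> LE t l' -> l = l'.
  by move=> [h1 h2] [h3 h4]; case: (ltgtP l l') => // [/h4|/h2].
have sub t : a < t < c -> a < t < b.
  by move=> /andP[at_ tc]; rewrite at_ (lt_le_trans tc cb).
have LE_ex t : a < t < c -> exists l, LE t l.
  by move=> at_; have [/(gN _ at_)|] := left_end (dS t) (fS _ (sub _ at_)).
case: (pselect (exists l, fat (fun t => a < t < c /\ LE t l))) => [[l fl]|nol].
  apply: (@nonfat_directed_union (fun s => l < s)
    (fun s t => a < t < c /\ forall z, l < z <= s -> S' t z)).
  + by dfn_tac.
  + by dfn_tac.
  + by move=> s ls; apply: (nf _ s) => t [/sub at_ h]; split=> //; apply: h;
      rewrite ls lexx.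
  + by move=> s s' t _ _ ss' [? h]; split=> // z /andP[lz zs]; apply: h;
      rewrite lz (le_trans zs (ltW ss')).
  + apply: fat_mono fl => t [at_ [[u [lu hu]] _]];
      have [s /andP[ls su]] := M_dense lu.
    by exists s; split=> //; split=> // z /andP[lz zs]; apply: hu;
      rewrite lz (le_lt_trans zs su).
have [e [e' [ee' he]]] : fat (fun l => exists t, a < t < c /\ LE t l).
  apply: contrapT => /nonfat_seq [|s hs]; first by dfn_tac.
  have [||l [_ fl]] := @fat_bigor M s (fun l t => a < t < c /\ LE t l).
  - by move=> l; dfn_tac.
  - exists a, c; split=> // t at_; have [l hl] := LE_ex t at_.
    by exists l; split=> //; apply/mem_In/hs; exists t.
  - by apply: nol; exists l.
(* Each left end belongs to finitely many t, and [tau] picks the least one. *)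
pose tau l t := (a < t < c /\ LE t l) /\ forall t',
  a < t' < c /\ LE t' l -> t <= t'.
have htau : dfn2 tau by rewrite /tau; dfn_tac.
have tau_inj l t t' : tau l t -> tau l t' -> t = t'.
  by move=> [h1 h2] [h3 h4]; apply/eqP; rewrite eq_le h2 // h4.
have tau_ex l : e < l < e' -> exists t, tau l t.
  move=> /he hl; apply: nonfat_min => //; first by dfn_tac.
  by move=> fl; apply: nol; exists l.
have [||||||s fs] := @selfmap_uniform (fun l s =>
  l < s /\ exists t s', tau l t /\ s < s' /\ forall z,
  l < z < s' -> S' t z) e e'.
- by dfn_tac.
- by [].
- by move=> l s [].
- move=> l s [ls [t [s' [ht [ss' hz]]]]]; have [u /andP[su us']] := M_dense ss'.
  by exists u; split=> //; split; [apply: lt_trans su|exists t, s'].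
- move=> l s s1 [ls [t [s' [ht [ss' hz]]]]] ls1 s1s; split=> //; exists t, s'.
  by split=> //; split=> //; apply: le_lt_trans s1s ss'.
- move=> l /tau_ex [t ht]; have [[_ [[u [lu hu]] _]] _] := ht;
    have [s /andP[ls su]] := M_dense lu.
  by exists s; split=> //; exists t, u.
apply: (nofat s); apply: contrapT => /nonfat_seq [|ts hts]; first by dfn_tac.
(* Infinitely many l have s in the first interval of [S' t] for t = tau(l). The finitely many t with
   s in [S' t] have finitely many left ends, so some such l is not among these. *)
have [l [[_ [ls [t [s' [ht [ss' hz]]]]]] nl]] := fat_not_cover ts fs LE_inj.
have [[at_ hl] _] := ht; apply: (nl t) => //; apply/mem_In/hts; split;
  first exact: sub.
by apply: hz; rewrite ls.
Qed.

(** * Uniform finiteness *)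

(** B is the graph of a partial function, v a threshold that separates its value at s from its
    values on the germ G at s. The thresholds that work at s form a fat set, so [fat_fubini] finds
    one that works on a whole interval of s. There it would have to be on both sides of the same
    value. *)
Lemma no_jump (C : M -> M -> Prop) (G : M -> (M -> Prop) -> Prop) (B : M -> M
  -> Prop) :
  dfn2 (fun s v => exists y, B s y /\ ~ C v y /\
                     G s (fun s' => exists y', B s' y' /\ C v y')) ->
  (forall s y y', B s y -> B s y' -> y = y') ->
  (forall y v, ~ C v y -> fat (fun v' =>
    ~ C v' y /\ forall y', C v y' -> C v' y')) ->
  (forall s (P Q : M -> Prop), (forall x, P x -> Q x) -> G s P -> G s Q) ->
  (forall s e e' (P : M -> Prop), e < s < e' -> G s P -> exists s',
    e < s' < e' /\ P s') ->
  ~ fat (fun s => exists v y, B s y /\ ~ C v y /\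
                     G s (fun s' => exists y', B s' y' /\ C v y')).
Proof.
move=> hS inj hC Gmono Gmeet [e [e' [ee' he]]].
have [t /he [v [y [By [nC hG]]]]|v [f [f' [ff' hf]]]] := fat_fubini hS ee'.
  apply: fat_mono (hC _ _ nC) => v' [nC' hv']; exists y; split=> //; split=> //.
  by apply: Gmono hG => s' [y' [? /hv' ?]]; exists y'.
have [s hs] := M_dense ff'; have [_ [y [By [nC hG]]]] := hf _ hs.
have [s' [hs' [y' [By' Cy']]]] := Gmeet _ _ _ _ hs hG.
by have [_ [z [Bz [nCz _]]]] := hf _ hs'; apply: nCz;
  rewrite (inj _ _ _ Bz By').
Qed.

Lemma germR_mono a (P Q : M -> Prop) : (forall x,
  P x -> Q x) -> germR a P -> germR a Q.
Proof. by move=> PQ [b [ab h]]; exists b; split=> // x /h /PQ. Qed.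

Lemma germL_mono a (P Q : M -> Prop) : (forall x,
  P x -> Q x) -> germL a P -> germL a Q.
Proof. by move=> PQ [b [ab h]]; exists b; split=> // x /h /PQ. Qed.

Lemma germR_meet s e e' (P : M -> Prop) : e < s < e' -> germR s P -> exists s',
  e < s' < e' /\ P s'.
Proof.
move=> /andP[es se'] [b [sb h]].
have [x /andP[sx]] : exists x, s < x < Order.min e' b by apply: M_dense;
  rewrite lt_min se'.
rewrite lt_min => /andP[xe xb]; exists x; rewrite (lt_trans es sx) xe;
  split=> //.
by apply: h; rewrite sx.
Qed.

Lemma germL_meet s e e' (P : M -> Prop) : e < s < e' -> germL s P -> exists s',
  e < s' < e' /\ P s'.
Proof.
move=> /andP[es se'] [b [sb h]].
have [x /andP[]] : exists x, Order.max e b < x < s by apply: M_dense;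
  rewrite gt_max es.
rewrite gt_max => /andP[ex bx] xs; exists x; rewrite (lt_trans xs se') ex;
  split=> //.
by apply: h; rewrite bx.
Qed.

(** A discontinuity at s is a jump upwards or downwards, seen from the left or from the right,
    because germs decide on which side of a threshold the values lie. By [no_jump] none of the four
    kinds is fat, so they do not fill (a, b). *)
Lemma continuity_point (B : M -> M -> Prop) a b : dfn2 B -> a < b ->
  (forall s y y', B s y -> B s y' -> y = y') ->
  (forall s, a < s < b -> exists y, B s y) ->
  exists s y, [/\ a < s < b, B s y & forall v w, v < y < w ->
    exists l u, l < s < u /\ forall s', l < s' < u -> a < s' < b -> exists y',
      B s' y' /\ v < y' < w].
Proof.
move=> hB ab inj Bex.
have up y v : ~ v <= y -> fat (fun v' =>
  ~ v' <= y /\ forall y', v <= y' -> v' <= y').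
  move=> /negP; rewrite -ltNge => yv; exists y, v; split=> // x /andP[yx xv].
  split; first by apply/negP; rewrite -ltNge.
  by move=> y' vy'; apply: le_trans vy'; apply: ltW.
have down y v : ~ y <= v -> fat (fun v' =>
  ~ y <= v' /\ forall y', y' <= v -> y' <= v').
  move=> /negP; rewrite -ltNge => yv; exists v, y; split=> // x /andP[yx xv].
  split; first by apply/negP; rewrite -ltNge.
  by move=> y' vy'; apply: le_trans vy' _; apply: ltW.
have n1 := @no_jump (fun v y =>
  v <= y) germR B ltac:(dfn_tac) inj up germR_mono germR_meet.
have n2 := @no_jump (fun v y =>
  y <= v) germR B ltac:(dfn_tac) inj down germR_mono germR_meet.
have n3 := @no_jump (fun v y =>
  v <= y) germL B ltac:(dfn_tac) inj up germL_mono germL_meet.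
have n4 := @no_jump (fun v y =>
  y <= v) germL B ltac:(dfn_tac) inj down germL_mono germL_meet.
have [s [hs nbad]] : exists s, a < s < b /\ ~ ((exists v y, B s y /\ ~ v <= y /\
    germR s (fun s' => exists y', B s' y' /\ v <= y')) \/ (exists v y,
      B s y /\ ~ y <= v /\
    germR s (fun s' => exists y', B s' y' /\ y' <= v)) \/ (exists v y,
      B s y /\ ~ v <= y /\
    germL s (fun s' => exists y', B s' y' /\ v <= y')) \/ (exists v y,
      B s y /\ ~ y <= v /\
    germL s (fun s' => exists y', B s' y' /\ y' <= v))).
  apply: contrapT => no.
  have : fat (fun s => (exists v y, B s y /\ ~ v <= y /\
    germR s (fun s' => exists y', B s' y' /\ v <= y')) \/ (exists v y,
      B s y /\ ~ y <= v /\
    germR s (fun s' => exists y', B s' y' /\ y' <= v)) \/ (exists v y,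
      B s y /\ ~ v <= y /\
    germL s (fun s' => exists y', B s' y' /\ v <= y')) \/ (exists v y,
      B s y /\ ~ y <= v /\
    germL s (fun s' => exists y', B s' y' /\ y' <= v))).
    exists a, b; split=> // s hs; apply: contrapT => h; apply: no; exists s;
      split=> //.
  do 3![case/fat_or; [by dfn_tac|by []|]]; exact: n4.
have [y By] := Bex s hs; exists s, y; split=> // v w /andP[vy yw].
have [l [ls hl]] : germL s (fun s' => (exists y', B s' y' /\ y' <= v) -> False).
  have [|h|//] := @germL_dec (fun s' => exists y', B s' y' /\ y' <= v) _ s;
    first by dfn_tac.
  by case: nbad; do 3!right; exists v, y; do !split=> //; apply/negP;
    rewrite -ltNge.
have [l' [ls' hl']] : germL s (fun s' =>
  (exists y', B s' y' /\ w <= y') -> False).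
  have [|h|//] := @germL_dec (fun s' => exists y', B s' y' /\ w <= y') _ s;
    first by dfn_tac.
  by case: nbad; do 2!right; left; exists w, y; do !split=> //; apply/negP;
    rewrite -ltNge.
have [u [us hu]] : germR s (fun s' => (exists y', B s' y' /\ y' <= v) -> False).
  have [|h|//] := @germR_dec (fun s' => exists y', B s' y' /\ y' <= v) _ s;
    first by dfn_tac.
  by case: nbad; right; left; exists v, y; do !split=> //; apply/negP;
    rewrite -ltNge.
have [u' [us' hu']] : germR s (fun s' =>
  (exists y', B s' y' /\ w <= y') -> False).
  have [|h|//] := @germR_dec (fun s' => exists y', B s' y' /\ w <= y') _ s;
    first by dfn_tac.
  by case: nbad; left; exists w, y; do !split=> //; apply/negP; rewrite -ltNge.
exists (Order.max l l'), (Order.min u u');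
  rewrite gt_max lt_min ls ls' us us'; split=> //.
move=> s'; rewrite gt_max lt_min => /andP[/andP[ls1 ls1'] /andP[us1 us1']] hs'.
have [y' By'] := Bex s' hs'; exists y'; split=> //.
case: (ltgtP s' s) => [ss|ss|E]; last first.
  have -> : y' = y by apply: (inj s) By; rewrite -E.
  by rewrite vy.
  rewrite !ltNge; apply/andP; split; apply/negP => h.
    by apply: (hu s'); [rewrite us1 ss|exists y'].
  by apply: (hu' s'); [rewrite us1' ss|exists y'].
rewrite !ltNge; apply/andP; split; apply/negP => h.
  by apply: (hl s'); [rewrite ls1 ss|exists y'].
by apply: (hl' s'); [rewrite ls1' ss|exists y'].
Qed.

(** * Cardinality in a one-parameter family of finite sets *)

Fixpoint hasn n (P : M -> Prop) : Prop :=
  match n with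
  | 0 => forall x, ~ P x
  | n.+1 => exists x, [/\ P x, forall y, P y -> x <= y & hasn n (fun y =>
    P y /\ x < y)]
  end.

Lemma hasn_ext n (P Q : M -> Prop) : (forall x,
  P x <-> Q x) -> hasn n P -> hasn n Q.
Proof.
move=> PQ; suff -> : P = Q by [].
by apply: functional_extensionality_dep => x;
  apply: propositional_extensionality.
Qed.

Lemma hasn_inj n m P : hasn n P -> hasn m P -> n = m.
Proof.
elim: n m P => [|n IH] [|m] P //=.
- by move=> h [x [/h]].
- by move=> [x [Px _ _]] /(_ x).
move=> [x [Px hx hn]] [y [Py hy hm]]; congr _.+1.
have xy : x = y by apply/eqP; rewrite eq_le hx // hy.
by apply: IH hn _; rewrite xy.
Qed.

Lemma hasn_seq n P : hasn n P ->
  exists s : seq M, [/\ size s = n, uniq s & forall x, P x <-> x \in s].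
Proof.
elim: n P => [|n IH] P /=; first by move=> h; exists [::]; split=> // x;
  split=> // /h.
move=> [x [Px hx /IH [s [ss us hs]]]]; exists (x :: s);
  rewrite /= ss us andbT; split=> //.
  by apply/negP => /hs []; rewrite ltxx.
move=> y; rewrite inE; split=> [Py|/orP[/eqP->|/hs []]] //.
by have := hx _ Py; rewrite le_eqVlt => /orP[/eqP->|xy];
  rewrite ?eqxx // orbC; apply/orP; left; apply/hs.
Qed.

Lemma hasn_ltn n m (P Q : M -> Prop) z : hasn n P -> hasn m Q ->
  (forall x, P x -> Q x) -> Q z -> ~ P z -> (n < m)%N.
Proof.
move=> /hasn_seq [s [<- us hs]] /hasn_seq [r [<- ur hr]] PQ Qz nPz.
apply: (@uniq_leq_size _ (z :: s)); first by rewrite /= us andbT;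
  apply/negP => /hs.
by move=> x; rewrite inE => /orP[/eqP->|/hs /PQ /hr //]; apply/hr.
Qed.

Lemma seq_hasn (s : seq M) P : (forall x, P x -> x \in s) -> exists n,
  (n <= size s)%N /\ hasn n P.
Proof.
move: {2}(size s) (leqnn (size s)) => k; elim: k s P => [|k IH] s P sk hs.
  exists 0%N; split=> // x /hs; by move: sk; rewrite leqn0 size_eq0 => /eqP->.
case: (pselect (exists x, P x)) => [[x0 Px0]|no]; last first.
  by exists 0%N; split=> // x Px; apply: no; exists x.
have [|x [xs Px hx]] := @seq_min s P; first by exists x0; split=> //; apply: hs.
have sz : (size [seq y <- s | (x < y)%O] < size s)%N.
  rewrite size_filter -(count_predC (fun y =>
    (x < y)%O) s) -[X in (X < _)%N]addn0 ltn_add2l.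
  by rewrite -has_count; apply/hasP; exists x; rewrite //= ltxx.
have [||n [nk hn]] := IH [seq y <- s | (x < y)%O] (fun y => P y /\ x < y).
- by rewrite -ltnS; apply: leq_trans sz sk.
- by move=> y [Py xy]; rewrite mem_filter xy hs.
exists n.+1; split; first exact: leq_ltn_trans nk sz.
by exists x; split=> // y Py; apply: hx => //; apply: hs.
Qed.

Lemma nonfat_hasn P : dfn P -> ~ fat P -> exists n, hasn n P.
Proof. by move=> hP nf; have [s /seq_hasn [n [_ ?]]] := nonfat_seq hP nf;
  exists n. Qed.

(** Peeling off least elements makes [hasn n], having exactly n elements, a formula for each fixed
    n. *)
Lemma dfn_hasn n {X} {dX : dtype X} (A : X -> M -> Prop) : dfn2 A -> dfn (fun x
  => hasn n (A x)).
Proof.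
elim: n X dX A => [|n IH] X dX A hA /=; first by dfn_tac.
apply: (@dfn_ext _ _ _ (fun x =>
  exists y, A x y /\ (forall z, A x z -> y <= z) /\
  hasn n (fun z => A x z /\ y < z))).
  by move=> x; split=> [[y [h1 h2 h3]]|[y [h1 [h2 h3]]]]; exists y.
have h := IH (X * M)%type _ (fun p z => A p.1 z /\ p.2 < z).
apply: dfn_ex; apply: dfn_and; first by dfn_tac.
by apply: dfn_and; [by dfn_tac|apply: h; dfn_tac].
Qed.

Ltac dfn_card ::= lazymatch goal with
  | |- dfn (fun x => hasn ?n (@?A x)) => apply (@dfn_hasn n _ _ A)
  end.

Section Jumps.
Variable A : M -> M -> Prop.
Hypothesis hA : dfn2 A.
Hypothesis Anf : forall s, ~ fat (A s).

Let dA s : dfn (A s). Proof. by dfn_tac. Qed.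

Definition near s (P : M -> Prop) := exists l u, l < s < u /\ forall s',
  l < s' < u -> P s'.

(** In arbitrarily small boxes around (s, y) the family is, for s' near s, either empty or the graph
    of a function that is continuous at s. *)
Definition normal s y := forall v w, v < y < w -> exists v' w',
  [/\ v <= v', v' < y < w', w' <= w &
     A s y /\ near s (fun s' => exists z, (v' < z < w' /\ A s' z) /\
                         forall z', v' < z' < w' -> A s' z' -> z' = z) \/
     ~ A s y /\ near s (fun s' => forall z, v' < z < w' -> ~ A s' z)].

(** The two bounds prevent points of [A s'] from escaping to infinity as s' tends to s; with
    normality at every y they make the cardinality locally constant. *)
Definition jump s := ~ [/\ exists v, near s (fun s' =>
  forall y, A s' y -> v < y),
  exists v, near s (fun s' => forall y, A s' y -> y < v) & forall y,
    normal s y].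

Lemma near_and s (P Q : M -> Prop) : near s P -> near s Q -> near s (fun x => P
  x /\ Q x).
Proof.
move=> [l [u [/andP[ls su] h]]] [l' [u' [/andP[ls' su'] h']]].
exists (Order.max l l'), (Order.min u u');
  rewrite gt_max lt_min ls ls' su su'; split=> //.
move=> x; rewrite gt_max lt_min => /andP[/andP[a b] /andP[c e]].
by split; [apply: h; rewrite a|apply: h'; rewrite b].
Qed.

Lemma near_mono s (P Q : M -> Prop) : (forall x,
  P x -> Q x) -> near s P -> near s Q.
Proof. by move=> PQ [l [u [h hP]]]; exists l, u; split=> // x /hP /PQ. Qed.

Lemma near_self s (P : M -> Prop) : near s P -> P s.
Proof. by move=> [l [u [h hP]]]; apply: hP. Qed.

Lemma near_itv s a b : a < s < b -> near s (fun x => a < x < b).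
Proof. by exists a, b. Qed.

Lemma dfn_normal {X} {dX : dtype X} (f g : X -> M) : dmap f -> dmap g -> dfn
  (fun x => normal (f x) (g x)).
Proof.
by move=> hf hg; rewrite /normal /near; dfn_tac.
Qed.

(** Compactness of [p, q] in definable form: the supremum of the y for which one neighbourhood of s
    serves all of [p, y] is q. *)
Lemma normal_empty s p q : p <= q -> (forall y,
  p <= y <= q -> ~ A s y /\ normal s y) ->
  near s (fun s' => forall y, p <= y <= q -> ~ A s' y).
Proof.
move=> pq h.
have loc y : p <= y <= q -> exists v w, v < y < w /\ near s (fun s' =>
  forall z, v < z < w -> ~ A s' z).
  move=> /h [nA /(_ _ _)]; have [v vy] := M_below y; have [w yw] := M_above y.
  case/(_ v w); first by rewrite vy.
  by move=> v' [w' [_ hy _ [[]//|[_ hn]]]]; exists v', w'.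
pose Q y := y < p \/ y <= q /\ near s (fun s' =>
  forall y', p <= y' <= y -> ~ A s' y').
have Qp : Q p.
  right; split=> //; have [|v [w [hp hn]]] := loc p; first by rewrite lexx.
  by apply: near_mono hn => s' hs' y'; rewrite -eq_le => /eqP <-; apply: hs'.
have [||||a [alo ahi]] := @dfn_sup Q.
- by rewrite /Q /near; dfn_tac.
- by exists p.
- have [z qz] := M_above q; exists z => -[zp|[zq _]].
    by move: (lt_trans (le_lt_trans pq qz) zp); rewrite ltxx.
  by move: qz; rewrite ltNge zq.
- move=> x y xy [yp|[yq hn]]; first by left; apply: le_lt_trans xy yp.
  right; split; first exact: le_trans yq.
  by apply: near_mono hn => s' hs' y' /andP[py yx]; apply: hs';
    rewrite py (le_trans yx xy).
have pa : p <= a by rewrite leNgt; apply/negP => /ahi.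
have aq : a <= q.
  rewrite leNgt; apply/negP => qa; have [z /andP[qz /alo]] := M_dense qa;
    case=> [zp|[zq _]].
    by move: (lt_trans (le_lt_trans pq qz) zp); rewrite ltxx.
  by move: qz; rewrite ltNge zq.
have [|v [w [/andP[va aw] hn]]] := loc a; first by rewrite pa.
have {hn} hn : near s (fun s' => forall y, p <= y < w -> ~ A s' y).
  case: (leP p v) => pv.
    have [z /andP[vz za]] := M_dense va; case: (alo z za) => [zp|[_ hz]].
      by move: (lt_trans vz zp); rewrite ltNge pv.
    apply: near_mono (near_and hz hn) => s' [h1 h2] y /andP[py yw].
    case: (leP y z) => yz; first by apply: h1; rewrite py.
    by apply: h2; rewrite yw (lt_trans vz).
  apply: near_mono hn => s' h2 y /andP[py yw]; apply: h2.
  by rewrite yw (lt_le_trans pv).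
case: (ltP a q) => [aq'|qa].
  have [c /andP[ac]] : exists c, a < c < Order.min w q by apply: M_dense;
    rewrite lt_min aw.
  rewrite lt_min => /andP[cw cq]; case: (ahi c ac); right; split;
    first exact: ltW.
  by apply: near_mono hn => s' h' y /andP[py yc]; apply: h';
    rewrite py (le_lt_trans yc).
by apply: near_mono hn => s' h' y /andP[py yq]; apply: h';
  rewrite py (le_lt_trans yq (le_lt_trans qa aw)).
Qed.

(** Induction on n, splitting off the least point y1 of [A s] above z and counting the others above
    a separating point z2. The induction ends with the local upper bound b, beyond which nothing is
    left to count. *)
Lemma normal_card s n z : (forall y, normal s y) ->
  (exists v, near s (fun s' => forall y, A s' y -> y < v)) ->
  ~ A s z -> hasn n (fun y => A s y /\ z < y) ->
  near s (fun s' => ~ A s' z /\ hasn n (fun y => A s' y /\ z < y)).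
Proof.
move=> hnrm [b hb]; elim: n z => [|n IH] z nz /=.
  move=> hz; have [c zc] : exists c, Order.max z b < c by apply: M_above.
  have {}zc : z < c /\ b < c by move: zc; rewrite gt_max => /andP[].
  have he y : z <= y <= c -> ~ A s y /\ normal s y.
    move=> /andP[zy _]; split=> // Ay; move: zy;
      rewrite le_eqVlt => /orP[/eqP E|zy].
      by apply: nz; rewrite E.
    exact: (hz y).
  have zc' : z <= c by apply: ltW; case: zc.
  apply: near_mono (near_and hb (normal_empty zc' he)) => s' [h1 h2].
  split=> [|y [Ay zy]]; first by apply: h2; rewrite lexx.
  apply: (h2 y) => //; rewrite ltW //= ltW //; apply: lt_trans (h1 _ Ay) _;
    by case: zc.
case=> y1 [[Ay1 zy1] hmin hn].
have [w1 yw1] := M_above y1.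
have [|v [w [zv /andP[vy yw] _ [[_ hn1]|[]//]]]] := hnrm y1 z w1;
  first by rewrite zy1.
(* Two nested boxes around y1, the inner one below z2. For s' near s each contains exactly one point
   of [A s'], hence the same one, so z2 separates this point from the rest. *)
have [z2 /andP[yz2 z2w]] := M_dense yw.
have [|v2 [w2 [vv2 /andP[vy2 yw2] w2z [[_ hn2]|[]//]]]] := hnrm y1 v z2;
  first by rewrite vy.
have zv2 := le_trans zv vv2.
have nA y : z < y -> y < z2 -> A s y -> y = y1.
  move=> zy yz As; have := hmin y (conj As zy);
    rewrite le_eqVlt => /orP[/eqP->//|y1y].
  have [t [_ ht]] := near_self hn1.
  have -> : y = t by apply: ht => //;
    rewrite (lt_trans vy y1y) (lt_trans yz z2w).
  by apply/esym/ht => //; rewrite vy yw.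
have nz2 : ~ A s z2.
  move=> As; have [t [_ ht]] := near_self hn1.
  have E1 : z2 = t by apply: ht => //; rewrite z2w (lt_trans vy).
  have E2 : y1 = t by apply: ht => //; rewrite vy yw.
  by move: yz2; rewrite E1 E2 ltxx.
have he : near s (fun s' => forall y, z <= y <= v2 -> ~ A s' y).
  apply: normal_empty => // y /andP[zy yv]; split=> // As.
  move: zy; rewrite le_eqVlt => /orP[/eqP E|zy]; first by apply: nz; rewrite E.
  have E := nA y zy (le_lt_trans yv (lt_trans vy2 yz2)) As.
  by move: vy2; rewrite -E ltNge yv.
have /IH hI : hasn n (fun y => A s y /\ z2 < y).
  apply: hasn_ext hn => y; split=> [[[As zy] y1y]|[As zy]]; split=> //.
  - rewrite ltNge; apply/negP => yz.
    move: yz; rewrite le_eqVlt => /orP[/eqP E|yz]; first by apply: nz2;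
      rewrite -E.
    by move: y1y; rewrite (nA y zy yz As) ltxx.
  - by split=> //; apply: lt_trans zy1 (lt_trans yz2 zy).
  - exact: lt_trans yz2 zy.
apply: near_mono (near_and (near_and hn1 hn2) (near_and he (hI nz2))) => s'.
move=> [[[t1 [[ht1 At1] h1]] [t2 [[ht2 At2] h2]]] [h3 [h4 h5]]].
split; first by apply: h3; rewrite lexx.
case/andP: ht2 => vt2 t2w.
have only y : A s' y -> z < y -> y <= z2 -> y = t2.
  move=> As zy yz.
  have vy' : v2 < y by rewrite ltNge; apply/negP => yv; apply: (h3 y) => //;
    rewrite ltW.
  have -> : y = t1 by apply: h1 => //;
    rewrite (le_lt_trans vv2 vy') (le_lt_trans yz z2w).
  apply/esym/h1 => //; rewrite (le_lt_trans vv2 vt2).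
  exact: lt_trans t2w (le_lt_trans w2z z2w).
exists t2; split.
- by split=> //; apply: le_lt_trans vt2.
- move=> y [As zy]; case: (leP y z2) => yz; first by rewrite (only y).
  by apply: ltW; apply: lt_trans t2w (le_lt_trans w2z yz).
- apply: hasn_ext h5 => y; split=> [[As zy]|[[As zy] ty]].
    by split; [split=> //; apply: le_lt_trans zv2 (lt_trans vt2 (lt_trans t2w
      (le_lt_trans w2z zy)))|
      apply: lt_trans t2w (le_lt_trans w2z zy)].
  split=> //; rewrite ltNge; apply/negP => yz; by move: ty;
    rewrite (only y) // ltxx.
Qed.

Lemma jump_const s n : ~ jump s -> hasn n (A s) -> near s (fun s' =>
  hasn n (A s')).
Proof.
move=> /contrapT [[v hv] hb hnrm] hn; have hs := near_self hv.
have nAv : ~ A s v by move=> /hs; rewrite ltxx.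
apply: near_mono (near_and hv (normal_card hnrm hb nAv (_ : hasn n _))) =>
  [s' [h1 [_]]|].
  by apply: hasn_ext => y; split=> [[]|As] //; split=> //; apply: h1.
by apply: hasn_ext hn => y; split=> [As|[]] //; split=> //; apply: hs.
Qed.

(** Inside the box of a, the only possible point of [A s'] is trapped in a smaller box around a; the
    part of the box above the smaller one is empty for s' near s. This is why the infimum of the
    abnormal points is itself abnormal in [least_abnormal]. *)
Lemma normal_open s a : normal s a -> exists c, a < c /\ forall y,
  a < y < c -> normal s y.
Proof.
move=> na; have [v0 v0a] := M_below a; have [w0 aw0] := M_above a.
have [|v [w [_ /andP[va aw] _ hn]]] := na v0 w0; first by rewrite v0a.
exists w; split=> // y /andP[ay yw] v1 w1 /andP[v1y yw1].
suff [m [ma hm]] : exists m, m < y /\ near s (fun s' =>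
  forall z, m < z < w -> ~ A s' z).
  exists (Order.max m v1), (Order.min w w1).
  rewrite le_max lexx orbT gt_max lt_min ma v1y yw yw1 ge_min lexx orbT;
    split=> //; right.
  split; first by apply: (near_self hm); rewrite ma.
  apply: near_mono hm => s' h z;
    rewrite gt_max lt_min => /andP[/andP[mz _] /andP[zw _]].
  by apply: h; rewrite mz.
case: hn => [[As hn]|[_ hn]]; last first.
  by exists a; split=> //; apply: near_mono hn => s' h z /andP[az zw];
    apply: h; rewrite zw (lt_trans va).
have [m /andP[am my]] := M_dense ay; exists m; split=> //.
have [|v2 [w2 [vv2 /andP[va2 aw2] w2m [[_ hn2]|[]//]]]] := na v m;
  first by rewrite va.
apply: near_mono (near_and hn hn2) =>
  s' [[t [[ht At] h]] [t2 [[/andP[vt2 t2w] At2] h2]]] z /andP[mz zw] Az.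
have E : z = t2.
  have -> : z = t by apply: h => //; rewrite zw (lt_trans va (lt_trans am mz)).
  apply/esym/h => //; rewrite (le_lt_trans vv2 vt2).
  exact: lt_trans t2w (le_lt_trans w2m (lt_trans my yw)).
by move: t2w; rewrite -E ltNge (le_trans w2m) // ltW.
Qed.

(** Here and in the next three lemmas, gaps and bounds are stated as fat sets of thresholds, so that
    [fat_fubini] turns them into one threshold common to an interval of s. *)
Lemma finite_above s y : fat (fun w =>
  y < w /\ forall y', A s y' -> y < y' -> w < y').
Proof.
case: (pselect (exists y', A s y' /\ y < y')) => [ex|no].
  have [||m [[Am ym] hm]] := nonfat_min (P := fun y' =>
    A s y' /\ y < y') _ _ ex.
  - by dfn_tac.
  - by move=> h; apply: (Anf (s := s)); apply: fat_mono h => ? [].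
  exists y, m; split=> // w /andP[yw wm]; split=> // y' Ay' yy'.
  by apply: lt_le_trans wm _; apply: hm.
have [w yw] := M_above y; exists y, w; split=> // w' /andP[yw' _];
  split=> // y' Ay' yy'.
by case: no; exists y'.
Qed.

Lemma finite_below s y : fat (fun w =>
  w < y /\ forall y', A s y' -> y' < y -> y' < w).
Proof.
case: (pselect (exists y', A s y' /\ y' < y)) => [ex|no].
  have [||m [[Am ym] hm]] := nonfat_max (P := fun y' =>
    A s y' /\ y' < y) _ _ ex.
  - by dfn_tac.
  - by move=> h; apply: (Anf (s := s)); apply: fat_mono h => ? [].
  exists m, y; split=> // w /andP[mw wy]; split=> // y' Ay' yy'.
  by apply: le_lt_trans mw; apply: hm.
have [w yw] := M_below y; exists w, y; split=> // w' /andP[_ yw'];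
  split=> // y' Ay' yy'.
by case: no; exists y'.
Qed.

Lemma finite_lower s : fat (fun w => forall y', A s y' -> w < y').
Proof.
case: (pselect (exists y, A s y)) => [ex|no].
  have [m [Am hm]] := nonfat_min (dA s) (Anf (s := s)) ex.
  by apply: fat_mono (finite_below s m) => w [wm _] y' /hm; apply: lt_le_trans.
have [a] := M_point; have [b ab] := M_above a; exists a, b;
  split=> // w _ y' Ay'.
by case: no; exists y'.
Qed.

Lemma finite_upper s : fat (fun w => forall y', A s y' -> y' < w).
Proof.
case: (pselect (exists y, A s y)) => [ex|no].
  have [m [Am hm]] := nonfat_max (dA s) (Anf (s := s)) ex.
  by apply: fat_mono (finite_above s m) => w [wm _] y' /hm h;
    apply: le_lt_trans wm.
have [a] := M_point; have [b ab] := M_above a; exists a, b;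
  split=> // w _ y' Ay'.
by case: no; exists y'.
Qed.

Lemma least_abnormal s : (exists v, near s (fun s' =>
  forall y, A s' y -> v < y)) ->
  (exists y, ~ normal s y) ->
  exists y, ~ normal s y /\ forall y', y' < y -> normal s y'.
Proof.
move=> [v hv] [y0 ny0]; pose Q y := forall y', y' <= y -> normal s y'.
have hQ : dfn Q.
  have h := @dfn_normal (M * M) _ (fun _ =>
    s) snd ltac:(dmap_tac) ltac:(dmap_tac).
  rewrite /Q; apply: dfn_all; apply: dfn_imp; [by dfn_tac|exact: h].
have [||x y xy Qy y' yx|a [alo ahi]] := dfn_sup hQ.
- have [u uv] := M_below v; exists u => y yu v1 w1 /andP[v1y yw1].
  exists v1, (Order.min v w1); rewrite lexx v1y lt_min yw1 (le_lt_trans yu uv)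
    ge_min lexx orbT.
  split=> //; right; split.
    by move=> /(near_self hv); rewrite ltNge (le_trans yu) // ltW.
  apply: near_mono hv => s' h z; rewrite lt_min => /andP[_ /andP[zv _]] /h.
  by rewrite ltNge ltW.
- by exists y0 => /(_ y0 (lexx _)).
- by apply: Qy; apply: le_trans yx xy.
exists a; split=> [na|y' /alo]; last by apply.
have [c [ac hc]] := normal_open na; have [m /andP[am mc]] := M_dense ac.
apply: (ahi m am) => y ym; case: (ltgtP y a) => [/alo|ay|->//]; first by apply.
by apply: hc; rewrite ay (le_lt_trans ym).
Qed.

(** On an interval of jumps, [fat_fubini] excludes local unboundedness, so there is a least abnormal
    point y(s). A second use isolates y(s) in a box that does not depend on s, where [A s] has no
    other point. Then y(s) is normal for some s after all. *)
Lemma nonfat_jump : ~ fat jump.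
Proof.
have fub (R : M -> M -> Prop) e e' : dfn2 R -> e < e' -> (forall t,
  e < t < e' -> fat (R t)) ->
    exists v f f', f < f' /\ forall t, f < t < f' -> e < t < e' /\ R t v.
  move=> hR ee' h; have [v [f [f' [ff' hf]]]] := fat_fubini hR ee' h.
  by exists v, f, f'; split.
pose U1 s := exists v, near s (fun s' => forall y, A s' y -> v < y).
pose U2 s := exists v, near s (fun s' => forall y, A s' y -> y < v).
have dN : dfn2 normal by apply: (@dfn_normal _ _ fst snd); dmap_tac.
move=> fj; have : fat (fun s =>
  ~ U1 s \/ ~ U2 s \/ (U1 s /\ exists y, ~ normal s y)).
  apply: fat_mono fj => s hj; apply: contrapT =>
    /not_orP [/contrapT h1 /not_orP [/contrapT h2 h3]].
  by apply: hj; split=> // y; apply: contrapT => ny; apply: h3; split=> //;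
    exists y.
case/fat_or; first by rewrite /U1 /near; dfn_tac.
  move=> [e [e' [ee' he]]]; have [||v [f [f' [ff' hf]]]] := fub (fun s v =>
    forall y, A s y -> v < y) e e' _ ee'.
  - by dfn_tac.
  - by move=> s _; apply: finite_lower.
  have [s hs] := M_dense ff'; apply: (he s); first by case: (hf s hs).
  by exists v, f, f'; split=> // s' /hf [].
case/fat_or; first by rewrite /U2 /near; dfn_tac.
  move=> [e [e' [ee' he]]]; have [||v [f [f' [ff' hf]]]] := fub (fun s v =>
    forall y, A s y -> y < v) e e' _ ee'.
  - by dfn_tac.
  - by move=> s _; apply: finite_upper.
  have [s hs] := M_dense ff'; apply: (he s); first by case: (hf s hs).
  by exists v, f, f'; split=> // s' /hf [].
move=> [e [e' [ee' he]]].
pose B s y := ~ normal s y /\ forall y', y' < y -> normal s y'.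
have dB : dfn2 B by rewrite /B; dfn_tac.
have B_inj s y y' : B s y -> B s y' -> y = y'.
  by move=> [h1 h2] [h3 h4]; case: (ltgtP y y') => // [/h4|/h2].
have B_ex s : e < s < e' -> exists y, B s y by move=> /he [h1 h2];
  apply: least_abnormal.
have [||w [f [f' [ff' hf]]]] := fub (fun s w =>
  exists y, B s y /\ y < w /\ forall y', A s y' -> y < y' -> w < y') e e' _ ee'.
- by dfn_tac.
- by move=> s /B_ex [y By]; apply: fat_mono (finite_above s y) => w' [? ?];
    exists y.
have [||v [g [g' [gg' hg]]]] := fub (fun s w =>
  exists y, B s y /\ w < y /\ forall y', A s y' -> y' < y -> y' < w) f f' _ ff'.
- by dfn_tac.
- by move=> s /hf [/B_ex [y By] _];
    apply: fat_mono (finite_below s y) => w' [? ?]; exists y.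
have key s : g < s < g' -> exists y, [/\ B s y, v < y < w & forall y',
  v <= y' <= w -> A s y' -> y' = y].
  move=> /hg [/hf [_ [y [By [yw h1]]]] [y2 [By2 [vy h2]]]].
  have E := B_inj _ _ _ By2 By; rewrite {y2 By2}E in vy h2.
  exists y; split=> //; first by rewrite vy.
  move=> y' /andP[vy' yw'] Ay'; case: (ltgtP y' y) => // h.
    by have := h2 _ Ay' h; rewrite ltNge vy'.
  by have := h1 _ Ay' h; rewrite ltNge yw'.
(* Either y(s) is never in [A s] on a subinterval, and the box is empty there; or it always is, and
   in the box the family is the graph of y, which has a point of continuity. *)
have [c [gc cg' [hc|hc]]] := @fat_itv (fun s =>
  exists y, B s y /\ A s y) ltac:(dfn_tac) _ _ gg'; last first.
  have [s hs] := M_dense gc; have sub t : g < t < c -> g < t < g'.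
    by move=> /andP[-> tc]; apply: lt_le_trans tc cg'.
  have [y [By /andP[vy yw] _]] := key s (sub s hs).
  have nA t : g < t < c -> forall z, v <= z <= w -> ~ A t z.
    move=> ht z hz Az; have [y' [By' _ h]] := key t (sub t ht).
    by apply: (hc t ht); exists y'; split=> //; rewrite -(h z).
  case: By => ny _; apply: ny => v1 w1 /andP[v1y yw1].
  exists (Order.max v v1), (Order.min w w1).
  rewrite le_max lexx orbT gt_max lt_min vy yw v1y yw1 ge_min lexx orbT;
    split=> //; right.
  split; first by apply: nA; rewrite // !ltW.
  exists g, c; split=> // t ht z;
    rewrite gt_max lt_min => /andP[/andP[vz _] /andP[zw _]].
  by apply: nA; rewrite // !ltW.
have [||s [y [hs By hcont]]] := @continuity_point B g c dB gc.
- exact: B_inj.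
- by move=> s hs; have [y [By _]] := hc s hs; exists y.
have sub t : g < t < c -> g < t < g'.
  by move=> /andP[-> tc]; apply: lt_le_trans tc cg'.
have [y2 [By2 /andP[vy yw] _]] := key s (sub s hs).
have E := B_inj _ _ _ By2 By; rewrite {y2 By2}E in vy yw.
have [y2 [By2 Ay]] := hc s hs; have E := B_inj _ _ _ By2 By;
  rewrite {y2 By2}E in Ay.
case: (By) => ny _; apply: ny => v1 w1 /andP[v1y yw1].
exists (Order.max v v1), (Order.min w w1).
rewrite le_max lexx orbT gt_max lt_min vy yw v1y yw1 ge_min lexx orbT;
  split=> //; left; split=> //.
have [|l [u [hlu h]]] := hcont (Order.max v v1) (Order.min w w1).
  by rewrite gt_max lt_min vy yw v1y yw1.
apply: near_mono (near_and (near_itv hlu) (near_itv hs)) =>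
  t [/h {}h /[dup] ht /h [z [Bz hz]]].
have [z2 [Bz2 Az]] := hc t ht; have E := B_inj _ _ _ Bz2 Bz;
  rewrite {z2 Bz2}E in Az.
exists z; split=> // z' hz' Az'; have [z2 [Bz2 _ h2]] := key t (sub t ht).
have -> : z = z2 := B_inj _ _ _ Bz Bz2.
apply: h2 => //; move: hz'; rewrite gt_max lt_min =>
  /andP[/andP[vz _] /andP[zw _]].
by rewrite !ltW.
Qed.
End Jumps.

Lemma dfn_jump {X} {dX : dtype X} (A : X -> M -> M -> Prop) :
  dfn3 A -> dfn2 (fun x s => jump (A x) s).
Proof. by move=> hA; rewrite /jump /normal /near; dfn_tac. Qed.

(** Definable maps, described by how they pull back definable relations with extra variables:
    composition is immediate, and for values in M a definable graph is enough. *)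
Definition dfun {X Y} {dX : dtype X} {dY : dtype Y} (f : X -> Y) : Prop :=
  forall Z (dZ : dtype Z) (P : Y -> Z -> Prop), dfn2 P -> dfn2 (fun x z =>
    P (f x) z).

Lemma dmap_dfun {X Y} {dX : dtype X} {dY : dtype Y} (f : X -> Y) : dmap f ->
  dfun f.
Proof. by move=> hf Z dZ P hP; dfn_tac. Qed.

Lemma dfun_comp {X Y Z} {dX : dtype X} {dY : dtype Y} {dZ : dtype Z} (g : Y ->
  Z) (f : X -> Y) :
  dfun g -> dfun f -> dfun (fun x => g (f x)).
Proof. by move=> hg hf W dW P /hg /hf. Qed.

Lemma dfun_graph {X} {dX : dtype X} (f : X -> M) (G : X -> M -> Prop) :
  dfn2 G -> (forall x s, G x s <-> f x = s) -> dfun f.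
Proof.
move=> hG fG Z dZ P hP; apply: (@dfn_ext _ _ _ (fun p =>
  exists s, G p.1 s /\ P s p.2)).
  by move=> p; split=> [h|[s [/fG <-]]] //; exists (f p.1); split=> //;
    apply/fG.
by dfn_tac.
Qed.

Lemma dfun_pair {X Y Z} {dX : dtype X} {dY : dtype Y} {dZ : dtype Z}
  (f : X -> Y) (g : X -> Z) : dfun f -> dfun g -> dfun (fun x => (f x, g x)).
Proof.
move=> hf hg V dV P hP.
have h1 : dfn2 (fun (y : Y) (q : Z * V) => P (y, q.1) q.2) by dfn_tac.
have h2 : dfn2 (fun (z : Z) (q : X * V) => P (f q.1, z) q.2).
  by apply: (@dfn_app2 _ _ _ _ _ _ _ (fun w : Z * (X * V) =>
    w.2.1) (fun w => (w.1, w.2.2)) (hf _ _ _ h1)); dmap_tac.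
by apply: (@dfn_app2 _ _ _ _ _ _ _ (fun w : X * V => w.1) (fun w =>
  (w.1, w.2)) (hg _ _ _ h2)); dmap_tac.
Qed.

(* Counting functions of definable families of finite sets are tame; tameness,
   unlike cardinality, passes to the value of N on the j-th interval of constancy
   in the first coordinate, which makes [tame_bounded] amenable to induction. *)
Definition tame {T} {dT : dtype T} (N : T -> nat) : Prop :=
  (forall n, dfn (fun t => N t = n)) /\
  forall E (dE : dtype E) (f : E * M -> T), dfun f -> exists J : E -> M -> Prop,
    [/\ dfn2 J, forall e, ~ fat (J e) &
        forall e s, ~ J e s -> near s (fun s' => N (f (e, s')) = N (f (e, s)))].

Lemma tame_comp {T U} {dT : dtype T} {dU : dtype U} (N : T -> nat) (g : U -> T)
  :
  tame N -> dfun g -> tame (fun u => N (g u)).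
Proof.
move=> [lev jmp] hg; split=> [n|E dE f hf].
  have h : dfn2 (fun (t : T) (_ : unit) => N t = n).
    by apply: (@dfn_comp _ _ _ _ fst _ (lev n)); dmap_tac.
  by apply: (@dfn_comp _ _ _ _ (fun u : U => (u, tt)) _ (hg _ _ _ h)); dmap_tac.
exact: (jmp E dE (fun p => g (f p)) (dfun_comp hg hf)).
Qed.

Lemma tame_card {T} {dT : dtype T} (A : T -> M -> Prop) (N : T -> nat) :
  dfn2 A -> (forall t, ~ fat (A t)) -> (forall t, hasn (N t) (A t)) -> tame N.
Proof.
move=> hA nf hN; split=> [n|E dE f hf].
  apply: (@dfn_ext _ _ _ (fun t => hasn n (A t))); last by dfn_tac.
  by move=> t; split=> [<-//|h]; apply: hasn_inj (hN t) h.
have h := hf _ _ _ hA.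
have h3 : dfn3 (fun e s y => A (f (e, s)) y).
  by apply: (@dfn_app2 _ _ _ _ _ _ _ (fun w : E * M * M =>
    (w.1.1, w.1.2)) snd h); dmap_tac.
exists (fun e s => jump (fun s => A (f (e, s))) s).
have h2 e : dfn2 (fun s => A (f (e, s))).
  by apply: (@dfn_comp _ _ _ _ (fun w : M * M => (e, w.1, w.2)) _ h3); dmap_tac.
split=> [|e|e s nj].
- exact: dfn_jump.
- by apply: nonfat_jump => // s; apply: nf.
- have := @jump_const (fun s => A (f (e, s))) (h2 e) s _ nj (hN _).
  by apply: near_mono => s'; apply: hasn_inj.
Qed.

Lemma below_card (P : M -> Prop) k s : hasn k P ->
  exists j, (j <= k)%N /\ hasn j (fun x => P x /\ x < s).
Proof.
move=> /hasn_seq [r [<- _ hr]]; by apply: (@seq_hasn r) => x [/hr].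
Qed.

Lemma choice_ex X Y (P : X -> Y -> Prop) : (forall x, exists y, P x y) ->
  exists f : X -> Y, forall x, P x (f x).
Proof. by move=> /choice [f hf]; exists f. Qed.

(** The exceptional set [J t] of the first coordinate is finite, and its cardinality is tame in t,
    hence bounded by induction. It remains to bound N at the jth point of [J t] and on the jth
    interval between its points; both are tame functions of t in one variable less. *)
Lemma tame_bounded n (N : pw n -> nat) : tame N -> exists b, forall t,
  (N t <= b)%N.
Proof.
elim: n N => [|n IH] N hN; first by exists (N tt) => -[].
have [lev jmp] := hN.
have d0 : dfun (fun p : pw n * M => (p.2, p.1) : pw n.+1) by apply: dmap_dfun;
  dmap_tac.
have [J [hJ Jnf Jc]] := jmp _ _ _ d0.
have dJ t : dfn (J t) by dfn_tac.
have [k hk] : exists k : pw n -> nat, forall t, hasn (k t) (J t).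
  by apply: (@choice_ex _ _ (fun t n => hasn n (J t))) => t; apply: nonfat_hasn.
have [K hK] := IH k (tame_card hJ Jnf hk).
(* [Sg j t] is the jth interval of the complement of [J t], and [Pt j t] contains just the jth
   point, counted from 0. *)
pose Sg j t s := ~ J t s /\ hasn j (fun x => J t x /\ x < s).
pose Pt j t s := J t s /\ hasn j (fun x => J t x /\ x < s).
have hSg j : dfn2 (Sg j) by rewrite /Sg; dfn_tac.
have hPt j : dfn2 (Pt j) by rewrite /Pt; dfn_tac.
have [bP hbP] : exists b : nat -> nat, forall j t s, Pt j t s -> (N (s,
  t) <= b j)%N.
  apply: (@choice_ex _ _ (fun j b =>
    forall t s, Pt j t s -> (N (s, t) <= b)%N)) => j.
  have hPj := hPt j.
  have Pt_inj t s s' : Pt j t s -> Pt j t s' -> s = s'.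
    have W r r' : Pt j t r -> Pt j t r' -> ~ r < r'.
      move=> [Jr hr] [Jr' hr'] rr'; suff : (j < j)%N by rewrite ltnn.
      apply: (hasn_ltn (z := r) hr hr') => //.
        by move=> x [Jx xr]; split=> //; apply: lt_trans rr'.
      by rewrite ltxx => -[].
    by move=> h h'; case: (ltgtP s s') => // [/(W _ _ h h')|/(W _ _ h' h)].
  (* The default value of the jth point when [J t] has at most j points. *)
  have [a0] := M_point.
  have [g hg] : exists g : pw n -> M, forall t, Pt j t (g t) \/ (forall s,
    ~ Pt j t s) /\ g t = a0.
    apply: (@choice_ex _ _ (fun t v =>
      Pt j t v \/ (forall s, ~ Pt j t s) /\ v = a0)) => t.
    case: (pselect (exists s, Pt j t s)) => [[s hs]|no]; first by exists s;
      left.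
    by exists a0; right; split=> // s hs; apply: no; exists s.
  have dg : dfun g.
    apply: (@dfun_graph _ _ _ (fun t v =>
      Pt j t v \/ (forall s, ~ Pt j t s) /\ v = a0)).
      by dfn_tac.
    move=> t v; split=> [[hv|[no ->]]|<-]; last exact: hg.
      by case: (hg t) => [h|[no _]]; [apply: Pt_inj h hv|case: (no v)].
    by case: (hg t) => [h|[]//]; case: (no (g t)).
  have [b hb] := IH _ (tame_comp hN (dfun_pair dg (dmap_dfun dmap_id))).
  exists b => t s hs; have := hb t.
  by case: (hg t) => [h|[no _]]; [rewrite (Pt_inj _ _ _ h hs)|case: (no s)].
have [bS hbS] : exists b : nat -> nat, forall j t s, Sg j t s -> (N (s,
  t) <= b j)%N.
  apply: (@choice_ex _ _ (fun j b =>
    forall t s, Sg j t s -> (N (s, t) <= b)%N)) => j.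
  have hSj := hSg j.
  have Nconst t s s' : Sg j t s -> Sg j t s' -> N (s, t) = N (s', t).
    have W r r' : Sg j t r -> Sg j t r' -> r < r' -> N (r, t) = N (r', t).
      move=> [nJr hr] [nJr' hr'] rr'.
      suff [_ ->] : (N (r, t) = N (r', t)) <-> (N (r', t) = N (r', t)) by [].
      apply: (@dfn_connected (fun x => N (x, t) = N (r', t))) rr' _.
        by apply: (@dfn_comp _ _ _ _ (fun x => (x, t)) _ (lev (N (r', t))));
          dmap_tac.
      move=> z /andP[rz zr']; have nJz : ~ J t z.
        move=> Jz; suff : (j < j)%N by rewrite ltnn.
        move: rz zr'; rewrite !le_eqVlt => /orP[/eqP E|rz];
          first by case: nJr; rewrite E.
        move=> /orP[/eqP E|zr']; first by case: nJr'; rewrite -E.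
        apply: (hasn_ltn (z := z) hr hr') => //.
          by move=> x [Jx xr]; split=> //; apply: lt_trans xr (lt_trans rz zr').
        by move=> [_ zr]; move: rz; rewrite ltNge ltW.
      have [l [u [hlu h]]] := Jc _ _ nJz; exists l, u; split=> // w hw.
      by rewrite (h w hw).
    by move=> h h'; case: (ltgtP s s') => [/(W _ _ h h')|/(W _ _ h' h)/esym|->].
  (* [Nj t] is the constant value of N on the jth interval, and 0 if this interval is empty. *)
  have [Nj hNj] : exists Nj : pw n -> nat, forall t, (forall s,
    Sg j t s -> N (s, t) = Nj t) /\
      ((forall s, ~ Sg j t s) -> Nj t = 0%N).
    apply: (@choice_ex _ _ (fun t v => (forall s, Sg j t s -> N (s, t) = v) /\
      ((forall s, ~ Sg j t s) -> v = 0%N))) => t.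
    case: (pselect (exists s, Sg j t s)) => [[s hs]|no].
      exists (N (s, t)); split=> [s' hs'|/(_ s)//]; exact: Nconst.
    by exists 0%N; split=> // s hs; case: no; exists s.
  suff hT : @tame _ (dtype_pw n) Nj by have [b hb] := IH _ hT;
    exists b => t s /(proj1 (hNj t)) ->.
  split=> [m|E dE f hf].
    pose Lm p := N p = m; have hLm : dfn Lm := lev m.
    apply: (@dfn_ext _ _ _ (fun t => (exists s, Sg j t s /\ Lm (s, t)) \/
       (forall s, ~ Sg j t s) /\ 0%N = m)).
      move=> t; case: (hNj t) => h1 h2; split=> [E|[[s [/h1 <-]]|[/h2 ->]]] //.
      case: (pselect (exists s, Sg j t s)) => [[s hs]|no]; [left|right].
        by exists s; split=> //; rewrite /Lm (h1 s hs).
      have ns s : ~ Sg j t s by move=> hs; apply: no; exists s.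
      by split=> //; rewrite -E h2.
    by dfn_tac.
  have df2 : dfun (fun p : E * M * M => (p.1.2, f (p.1.1, p.2))).
    apply: dfun_pair; first by apply: dmap_dfun; dmap_tac.
    by apply: dfun_comp hf (dmap_dfun _); dmap_tac.
  have [J2 [hJ2 J2nf J2c]] := jmp _ _ _ df2.
  have hSf := hf _ _ _ (hSg j).
  have hSf3 : dfn3 (fun e b s => Sg j (f (e, b)) s).
    by apply: (@dfn_app2 _ _ _ _ _ _ _ (fun w : E * M * M =>
      (w.1.1, w.1.2)) snd hSf); dmap_tac.
  pose Sf e b s := Sg j (f (e, b)) s; have {}hSf3 : dfn3 Sf := hSf3.
  (* At a good b, one s stays in the jth interval for all b' near b, with b outside the exceptional
     set of N along s; or the jth interval is empty all around b. In both cases [Nj] is locally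
     constant. *)
  pose good e b := (exists s, near b (fun b' => Sf e b' s /\ ~ J2 (e, s) b')) \/
                   near b (fun b' => forall s, ~ Sf e b' s).
  have hgood : dfn2 good by rewrite /good /near; dfn_tac.
  exists (fun e b => ~ good e b); split; first by dfn_tac.
    move=> e [c [c' [cc' hc]]].
    have [|c1 [cc1 c1c' [h|h]]] := @fat_itv (fun b =>
      exists s, Sf e b s) _ c c' cc'; first by dfn_tac.
      (* A nonempty interval between points of a finite set is fat, so a single s serves an interval
         of b. Removing the finite set [J2 (e, s)] leaves good points. *)
      have [||s [a [a' [aa' ha]]]] := @fat_fubini (Sf e) c c1 _ cc1;
        first by dfn_tac.
        move=> b /h [s [nJ hs]].
        have nfJ := Jnf (f (e, b)); have dJb := dJ (f (e, b)).
        have [l [ls hl]] : germL s (fun x => ~ J (f (e, b)) x).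
          have [[l [ls hl]]|//] := germL_dec dJb s.
          by case: nfJ; exists l, s.
        have [u [us hu]] : germR s (fun x => ~ J (f (e, b)) x).
          have [[u [us hu]]|//] := germR_dec dJb s.
          by case: nfJ; exists s, u.
        exists s, u; split=> // x /andP[sx xu]; split; first by apply: hu;
          rewrite sx.
        apply: hasn_ext hs => y; split=> [[Jy ys]|[Jy yx]]; split=> //;
          first exact: lt_trans ys sx.
        rewrite ltNge le_eqVlt; apply/negP => /orP[/eqP E'|sy];
          first by apply: nJ; rewrite E'.
        by apply: (hu y) => //; rewrite sy (lt_trans yx).
      have [|b1 [ab1 b1a' [h2|h2]]] := @fat_itv (J2 (e, s)) _ a a' aa';
        first by dfn_tac.
        by apply: (J2nf (e, s)); exists a, b1.
      have [b /[dup] hb /andP[ab bb1]] := M_dense ab1.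
      have sub x : a < x < b1 -> a < x < a'.
        by move=> /andP[-> xb]; apply: lt_le_trans xb b1a'.
      have [/andP[cb bc1] _] := ha _ (sub _ hb).
      apply: (hc b); first by rewrite cb (lt_le_trans bc1).
      left; exists s, a, b1; split=> // x hx; split;
        first by case: (ha x (sub x hx)).
      exact: h2.
    have [b /[dup] hb /andP[cb bc1]] := M_dense cc1.
    apply: (hc b); first by rewrite cb (lt_le_trans bc1).
    by right; exists c, c1; split=> // x /h hx s hs; apply: hx; exists s.
  move=> e b /contrapT [[s hs]|hs].
    have [hs1 hs2] := near_self hs; have := J2c _ _ hs2 => /= hn.
    apply: near_mono (near_and hn hs) => x [E' [hx _]].
    by rewrite -(proj1 (hNj _) _ hx) -(proj1 (hNj _) _ hs1).
  have h0 := near_self hs.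
  by apply: near_mono hs => x hx; rewrite !(proj2 (hNj _)).
(* The number j of points of [J t] below s ranges from 0 to K. *)
exists (\max_(j < K.+1) maxn (bP j) (bS j)) => -[s t].
have [j [jk hj]] := below_card s (hk t).
have jK : (j < K.+1)%N by rewrite ltnS; apply: leq_trans jk (hK t).
apply: leq_trans (leq_bigmax (Ordinal jK)) => /=.
case: (pselect (J t s)) => hJs; rewrite leq_max.
  by rewrite (hbP j).
by rewrite (hbS j) ?orbT.
Qed.

Lemma uniform_card {T} {dT : dtype T} (A : T -> M -> Prop) : dfn2 A -> (forall
  t, ~ fat (A t)) ->
  exists N, forall t, exists n, (n <= N)%N /\ hasn n (A t).
Proof.
move=> hA nf; have hA' : dfn2 (fun z : pw (dn T) => A (of_pw z)) by dfn_tac.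
have [k hk] : exists k : pw (dn T) -> nat, forall t, hasn (k t) (A (of_pw t)).
  by apply: (@choice_ex _ _ (fun t n => hasn n (A (of_pw t)))) => t;
    apply: nonfat_hasn => //; dfn_tac.
have [N hN] := tame_bounded (tame_card hA' (fun t => nf _) hk).
by exists N => t; exists (k (to_pw t)); split; rewrite // -[in A t](to_pwK t).
Qed.

(** * Dimension and equivalence classes *)

(* [dimge e P] : P has dimension >= e, computed fibrewise along the first
   coordinate. *)
Fixpoint dimge n (e : nat) : (pw n -> Prop) -> Prop :=
  match n return (pw n -> Prop) -> Prop with
  | 0 => fun P => e = 0%N /\ P tt
  | n.+1 => fun P => (exists u, dimge e (fun y : pw n => P (u, y))) \/
      match e with
      | 0 => False
      | e.+1 => fat (fun u => dimge e (fun y : pw n => P (u, y)))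
      end
  end.

Lemma dimge_mono n e (P Q : pw n -> Prop) : (forall x,
  P x -> Q x) -> dimge e P -> dimge e Q.
Proof.
elim: n e P Q => [|n IH] e P Q PQ /=; first by move=> [-> /PQ].
move=> [[u hu]|]; first by left; exists u; apply: IH hu => y; apply: PQ.
case: e => // e hf; right; apply: fat_mono hf => u; apply: IH => y; exact: PQ.
Qed.

Lemma dimge_ex n e (P : pw n -> Prop) : dimge e P -> exists x, P x.
Proof.
elim: n e P => [|n IH] e P /=; first by move=> [_]; exists tt.
move=> [[u /IH [y]]|]; first by exists (u, y).
case: e => // e [a [b [/M_dense [u hu] /(_ u hu) /IH [y]]]]; by exists (u, y).
Qed.

Lemma dfn_dimge n e {X} {dX : dtype X} (A : X -> pw n -> Prop) :
  dfn2 A -> dfn (fun x => dimge e (A x)).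
Proof.
elim: n e X dX A => [|n IH] e X dX A hA /=; first by dfn_tac.
have h (f : nat) : dfn2 (fun x u => dimge f (fun y => A x (u, y))).
  by apply: (IH f _ _ (fun (p : X * M) y => A p.1 (p.2, y))); dfn_tac.
apply: dfn_or; first exact: (dfn_ex (h e)).
by case: e => [|e]; [apply: dfn_const|apply: dfn_fat].
Qed.

Ltac dfn_dim ::= lazymatch goal with
  | |- dfn (fun x => @dimge ?n ?e (@?A x)) => apply (@dfn_dimge n e _ _ A)
  end.

(** * Bounds on the number of equivalence classes *)

Section Representatives.
Variables (X : Type) (E : X -> X -> Prop).
Hypotheses (Esym : forall x y, E x y -> E y x) (Etrans : forall x y z,
  E x y -> E y z -> E x z).

Definition reps N (P : X -> Prop) := exists r : seq X,
  (size r <= N)%N /\ forall x, P x -> exists y, List.In y r /\ E x y.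

Fixpoint separated (s : seq X) : Prop :=
  if s is x :: s' then (forall y,
    List.In y s' -> ~ E x y) /\ separated s' else True.

Lemma In_cat (T : Type) (s r : seq T) x : List.In x (s ++ r) <-> List.In x s \/
  List.In x r.
Proof. by elim: s => /= [|y s ->]; [split=> [h|[]//]; right|rewrite orA]. Qed.

Lemma reps_or N N' P Q : reps N P -> reps N' Q -> reps (N + N') (fun x =>
  P x \/ Q x).
Proof.
move=> [r [hr cr]] [r' [hr' cr']]; exists (r ++ r');
  rewrite size_cat leq_add //; split=> //.
by move=> x [/cr|/cr'] [y [yr Exy]]; exists y; rewrite In_cat; split;
  [left| |right|].
Qed.

Lemma reps_mono N P Q : (forall x, P x -> Q x) -> reps N Q -> reps N P.
Proof. by move=> PQ [r [hr cr]]; exists r; split=> // x /PQ /cr. Qed.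

Lemma reps_union N (P : M -> X -> Prop) (us : seq M) : (forall u,
  u \in us -> reps N (P u)) ->
  reps (size us * N) (fun x => exists u, u \in us /\ P u x).
Proof.
elim: us => [|u us IH] h; first by exists [::]; split=> // x [u []].
have h1 : reps N (P u) by apply: h; rewrite inE eqxx.
have hI := IH (fun v vus => h v (mem_behead (s := u :: us) vus)).
rewrite /= mulSn; apply: reps_mono (reps_or h1 hI) => x [v []].
by rewrite inE => /orP[/eqP->|vus] Px; [left|right; exists v].
Qed.

Lemma separated_size (s r : seq X) : separated s ->
  (forall x, List.In x s -> exists y,
    List.In y r /\ E x y) -> (size s <= size r)%N.
Proof.
elim: s r => //= x s IH r [xs hs] hr.
have [y [yr Exy]] := hr x (or_introl erefl).
have [r1 [r2 Er]] := List.in_split _ _ yr; have {}Er : r = r1 ++ y :: r2 by [].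
have /(IH (r1 ++ r2) hs) : forall x', List.In x' s -> exists y',
  List.In y' (r1 ++ r2) /\ E x' y'.
  move=> x' x's; have [y' []] := hr x' (or_intror x's).
  rewrite Er In_cat /= => -[y'r|[yy'|y'r]] Ex'; first by exists y';
    rewrite In_cat; split=> //; left.
    by case: (xs x' x's); apply: Etrans Exy (Esym _); rewrite yy'.
  by exists y'; rewrite In_cat; split=> //; right.
by rewrite Er !size_cat /= addnS ltnS.
Qed.

(** A list of pairwise inequivalent elements of P that cannot be extended meets every class of P. *)
Lemma separated_reps N (P : X -> Prop) : (forall s, separated s ->
  (forall x, List.In x s -> P x) -> (size s <= N)%N) -> reps N P.
Proof.
move=> h; suff [[s [s1 s2 s3]]|//] : (exists s, [/\ separated s, forall x,
  List.In x s -> P x & size s = N.+1]) \/ reps N P.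
  by have := h s s1 s2; rewrite s3 ltnn.
elim: N.+1 => [|k [[s [s1 s2 s3]]|]]; [by left; exists [::]| |by right].
case: (pselect (exists x, P x /\ forall y, List.In y s -> ~ E x y)) =>
  [[x [Px hx]]|no].
  by left; exists (x :: s); split; rewrite /= ?s3 // => y [<-|/s2].
right; exists s; split; first exact: h.
move=> x Px; apply: contrapT => nx; apply: no; exists x; split=> // y ys Exy.
by apply: nx; exists y.
Qed.
End Representatives.

Lemma germR_all {X} (s : seq X) (P : X -> M -> Prop) l :
  (forall x, List.In x s -> germR l (P x)) -> exists u, forall x,
    List.In x s -> P x u.
Proof.
move=> h; suff [b [lb hb]] : germR l (fun u => forall x, List.In x s -> P x u).
  by have [u /hb hu] := M_dense lb; exists u.
elim: s h => [|x s IH] h; first by have [b lb] := M_above l; exists b.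
have [b [lb hb]] := h x (or_introl erefl).
have [|b' [lb' hb']] := IH; first by move=> y ys; apply: h; right.
exists (Order.min b b'); rewrite lt_min lb; split=> // u;
  rewrite lt_min => /andP[lu /andP[ub ub']].
by move=> y [<-|ys]; [apply: hb|apply: hb'] => //; rewrite lu.
Qed.

Lemma germN_all {X} (s : seq X) (P : X -> M -> Prop) :
  (forall x, List.In x s -> germN (P x)) -> exists u, forall x,
    List.In x s -> P x u.
Proof.
move=> h; suff [b hb] : germN (fun u => forall x, List.In x s -> P x u).
  by have [u ub] := M_below b; exists u; apply: hb.
elim: s h => [|x s IH] h; first by have [a] := M_point; exists a.
have [b hb] := h x (or_introl erefl).
have [|b' hb'] := IH; first by move=> y ys; apply: h; right.
exists (Order.min b b') => u; rewrite lt_min => /andP[ub ub'].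
by move=> y [<-|ys]; [apply: hb|apply: hb'].
Qed.

Lemma reps_image {X Y} (f : Y -> X) (E : X -> X -> Prop) N (P : Y -> Prop) (Q :
  X -> Prop) :
  (forall x y z, E x y -> E y z -> E x z) ->
  reps (fun y y' => E (f y) (f y')) N P ->
  (forall x, Q x -> exists y, P y /\ E x (f y)) -> reps E N Q.
Proof.
move=> tr [r [hr cr]] h; exists [seq f y | y <- r]; rewrite size_map;
  split=> // x /h.
move=> [y [/cr [y' [y'r Ey]] Ex]]; exists (f y'); split; last exact: tr Ex Ey.
by elim: {hr cr} r y'r => //= z r IH [->|/IH]; [left|right].
Qed.

(* By [fat_fubini] only boundedly many points can be left ends of the sets Q x
   of those u at which the class of x has a fibre of dimension e, and each of them
   is the left end for boundedly many classes. *)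
Lemma finite_classes n e {T} {dT : dtype T} (K : T -> pw n -> Prop) (E : T ->
  pw n -> pw n -> Prop) :
  dfn2 K -> dfn3 E -> (forall t x, E t x x) -> (forall t x y,
    E t x y -> E t y x) ->
  (forall t x y z, E t x y -> E t y z -> E t x z) ->
  (forall t, ~ dimge e.+1 (K t)) ->
  exists N, forall t, reps (E t) N (fun x => K t x /\ dimge e (fun y =>
    K t y /\ E t x y)).
Proof.
elim: n e T dT K E => [|n IH] e T dT K E hK hE rE sE tE hdim.
  by exists 1%N => t; exists [:: tt]; split=> // -[] _; exists tt; split=> //;
    left.
pose F t u := dimge e (fun y : pw n => K t (u, y)).
have hF : dfn2 F by rewrite /F; dfn_tac.
have Fnf t : ~ fat (F t) by move=> h; apply: (hdim t) => /=; right.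
pose E1 (p : T * M) (y y' : pw n) := E p.1 (p.2, y) (p.2, y').
have hE1 : dfn3 E1 by rewrite /E1; dfn_tac.
have rE1 p y : E1 p y y by apply: rE.
have sE1 p y z : E1 p y z -> E1 p z y by apply: sE.
have tE1 p x y z : E1 p x y -> E1 p y z -> E1 p x z by apply: tE.
pose K1 (p : T * M) (y : pw n) := K p.1 (p.2, y).
have hK1 : dfn2 K1 by rewrite /K1; dfn_tac.
have hdim1 p : ~ dimge e.+1 (K1 p) by move=> h; apply: (hdim p.1); left;
  exists p.2.
have [N1 hN1] := uniform_card hF Fnf.
have [N2 hN2] := IH e _ _ K1 E1 hK1 hE1 rE1 sE1 tE1 hdim1.
pose C t x y := K t y /\ E t x y.
have step e' t u x : dimge e' (fun y => C t x (u, y)) ->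
    exists y, (K t (u, y) /\ dimge e' (fun y' =>
      K t (u, y') /\ E t (u, y) (u, y'))) /\ E t x (u, y).
  move=> h; have [y [Ky Exy]] := dimge_ex h; exists y; split=> //; split=> //.
  by apply: dimge_mono h => y' [Ky' Exy']; split=> //;
    apply: tE (sE _ _ _ Exy) Exy'.
have kind1 t : reps (E t) (N1 * N2) (fun x => exists u, dimge e (fun y =>
  C t x (u, y))).
  have [m [mN /hasn_seq [us [su _ hus]]]] := hN1 t.
  have [|r [hr cr]] := @reps_union _ (E t) N2 (fun u x => dimge e (fun y =>
    C t x (u, y))) us.
    move=> u _; apply: (reps_image (f := fun y =>
      (u, y)) (tE t) (hN2 (t, u))) => x /step.
    by [].
  exists r; split; first by apply: leq_trans hr _; rewrite leq_mul2r su mN orbT.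
  move=> x [u hu]; apply: cr; exists u; split=> //; apply/hus.
  by apply: dimge_mono hu => y [].
(* For e = 0 only the first alternative of [dimge] is possible, which [kind1] counts. From here on e
   is the old e minus one. *)
case: e => [|e] in hdim F hF Fnf hN1 hdim1 hN2 kind1 *.
  by exists (N1 * N2)%N => t; apply: reps_mono (kind1 t) => x [_ [|//]].
pose Q t x u := ~ F t u /\ dimge e (fun y => C t x (u, y)).
have hQ : dfn3 Q by rewrite /Q /C; dfn_tac.
(* Emptying the fibres over [F] leaves fibres of dimension at most e, as the induction hypothesis
   demands for every parameter. *)
pose K2 (p : T * M) (y : pw n) := ~ F p.1 p.2 /\ K p.1 (p.2, y).
have hK2 : dfn2 K2 by rewrite /K2; dfn_tac.
have hdim2 p : ~ dimge e.+1 (K2 p).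
  move=> h; have [y [nF _]] := dimge_ex h; apply: nF.
  by apply: dimge_mono h => y' [].
have [N3 hN3] := IH e _ _ K2 E1 hK2 hE1 rE1 sE1 tE1 hdim2.
have Qreps t u : reps (E t) N3 (fun x => Q t x u).
  apply: (reps_image (f := fun y => (u, y)) (tE t) (hN3 (t, u))) =>
    x [nF /step [y [[Ky h] Exy]]].
  exists y; split=> //; split=> //; apply: dimge_mono h => y' [Ky' Eyy'].
  by split.
have QE t x x' u : E t x x' -> Q t x u -> Q t x' u.
  move=> Exx' [nF h]; split=> //; apply: dimge_mono h => y [Ky Exy]; split=> //.
  by apply: tE Exy; apply: sE.
pose LE t x l := germR l (Q t x) /\ forall l', l' < l -> ~ germR l' (Q t x).
have hLE : dfn3 LE by rewrite /LE; dfn_tac.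
have LE_inj t x l l' : LE t x l -> LE t x l' -> l = l'.
  by move=> [h1 h2] [h3 h4]; case: (ltgtP l l') => // [/h4|/h2].
have QEE t x x' : E t x x' -> Q t x = Q t x'.
  move=> Exx'; apply: functional_extensionality_dep => u;
    apply: propositional_extensionality.
  by split; apply: QE => //; apply: sE.
pose LL t l := exists x, K t x /\ LE t x l.
have hL : dfn2 LL by rewrite /LL; dfn_tac.
have Lnf t : ~ fat (LL t).
  (* On an interval of left ends, one b bounds from below the length of the first interval of the
     corresponding [Q t x]. Then a single u lies in infinitely many of them, with different left
     ends, against [Qreps]. *)
  move=> [c [c' [cc' hc]]].
  have [||b [e1 [e2 [e12 he]]]] := @fat_fubini (fun l b => l < b /\
     exists x, K t x /\ LE t x l /\ forall z, l < z < b -> Q t x z) c c' _ cc'.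
  - by dfn_tac.
  - move=> l /hc [x [Kx /[dup] LEx [[b [lb hb]] _]]]; exists l, b;
      split=> // b' /andP[lb' b'b].
    split=> //; exists x; split=> //; split=> // z /andP[lz zb']; apply: hb.
    by rewrite lz (lt_trans zb').
  have [u /[dup] hu /andP[e1u ue2]] := M_dense e12; have [_ [ub _]] := he u hu.
  have [r [_ cr]] := Qreps t u.
  have [|y x x' [z [LEz Ez]] [z' [LEz' Ez']]|l [/andP[e1l lu] nl]] :=
     @fat_not_cover (fun l => e1 < l < u) _ r (fun y l =>
       exists x, LE t x l /\ E t x y).
  - by exists e1, u.
  - apply: LE_inj LEz _; rewrite /LE (QEE _ _ z') //;
      exact: tE Ez (sE _ _ _ Ez').
  - have [|_ [_ [x [Kx [LEx hx]]]]] := he l; first by rewrite e1l (lt_trans lu).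
    have [|y [yr Exy]] := cr x; first by apply: hx; rewrite lu.
    by apply: (nl y yr); exists x.
have [N4 hN4] := uniform_card hL Lnf.
have kindN t : reps (E t) N3 (fun x => germN (Q t x)).
  apply: (separated_reps (E := E t)) => s ss hs; have [u hu] := germN_all hs.
  have [r [hr cr]] := Qreps t u; apply: leq_trans hr.
  by apply: (separated_size (sE t) (tE t) ss) => x /hu /cr.
have kindR t l : reps (E t) N3 (fun x => germR l (Q t x)).
  apply: (separated_reps (E := E t)) => s ss hs; have [u hu] := germR_all hs.
  have [r [hr cr]] := Qreps t u; apply: leq_trans hr.
  by apply: (separated_size (sE t) (tE t) ss) => x /hu /cr.
(* The three terms count the classes with a fibre of full dimension, those for which [Q t x]
   contains a neighbourhood of minus infinity, and those for which it has a left end, at most N3 for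
   each of at most N4 points. *)
exists (N1 * N2 + (N3 + N4 * N3))%N => t.
have [m [mN /hasn_seq [us [su _ hus]]]] := hN4 t.
have [r [hr cr]] := @reps_union _ (E t) N3 (fun l x =>
  germR l (Q t x)) us (fun l _ => kindR t l).
have kL : reps (E t) (N4 * N3) (fun x => exists l, l \in us /\ germR l (Q t x)).
  by exists r; split=> //; apply: leq_trans hr _; rewrite leq_mul2r su mN orbT.
apply: reps_mono (reps_or (kind1 t) (reps_or (kindN t) kL)) => x [Kx [h|h]];
  [by left|right].
have /left_end [|h'|[l hl]] : fat (Q t x).
- have /fat_or : fat (fun u => Q t x u \/ F t u).
    apply: fat_mono h => u hu; case: (pselect (F t u)) => Fu;
      [by right|by left].
  by case=> [|//|/Fnf]; first dfn_tac.
- by dfn_tac.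
- by left.
- by right; exists l; split; [apply/hus; exists x|case: hl].
Qed.

(** * Cuts of definable preorders *)

Inductive type1_kind := At | RightOf | LeftOf | AtPlusInfty | AtMinusInfty.

(** Membership of P in a definable 1-type, realized or one of the four germs. For fixed k this is
    first order in a, so quantifying over these types is quantifying over a for each of five
    kinds. *)
Definition mostly (k : type1_kind) (a : M) (P : M -> Prop) : Prop :=
  match k with
  | At => P a
  | RightOf => germR a P
  | LeftOf => germL a P
  | AtPlusInfty => germP P
  | AtMinusInfty => germN P
  end.

Lemma mostly_mono k a (P Q : M -> Prop) : (forall x,
  P x -> Q x) -> mostly k a P -> mostly k a Q.
Proof.
move=> PQ; case: k => /=; [exact: PQ|exact: germR_mono|exact: germL_mono| |];
  by move=> [b hb]; exists b => x /hb /PQ.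
Qed.

Lemma mostly_meet k a (P Q : M -> Prop) : mostly k a P -> mostly k a Q ->
  exists x, P x /\ Q x.
Proof.
case: k => /=.
- by exists a.
- move=> [b [ab hb]] [c [ac hc]];
    have [x /andP[ax]] : exists x, a < x < Order.min b c.
    by apply: M_dense; rewrite lt_min ab.
  by rewrite lt_min => /andP[xb xc]; exists x; split; [apply: hb|apply: hc];
    rewrite ax.
- move=> [b [ab hb]] [c [ac hc]];
    have [x /andP[]] : exists x, Order.max b c < x < a.
    by apply: M_dense; rewrite gt_max ab.
  by rewrite gt_max => /andP[bx cx] xa; exists x; split;
    [apply: hb|apply: hc]; rewrite ?bx ?cx.
- move=> [b hb] [c hc]; have [x] := M_above (Order.max b c).
  by rewrite gt_max => /andP[bx cx]; exists x; split; [apply: hb|apply: hc].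
- move=> [b hb] [c hc]; have [x] := M_below (Order.min b c).
  by rewrite lt_min => /andP[bx cx]; exists x; split; [apply: hb|apply: hc].
Qed.

Lemma dfn_mostly k {X} {dX : dtype X} (f : X -> M) (A : X -> M -> Prop) :
  dmap f -> dfn2 A -> dfn (fun x => mostly k (f x) (A x)).
Proof. by move=> hf hA; case: k => /=; dfn_tac. Qed.

(** A downward directed definable family of nonempty subsets of M lies in a definable 1-type. Let a
    be the infimum of the v such that every [V w] meets the points up to v; the type is at a, on one
    side of a, or at infinity when there is no such infimum. *)
Lemma nested_type {X} {dX : dtype X} (I : X -> Prop) (V : X -> M -> Prop) : dfn
  I -> dfn2 V ->
  (forall w, I w -> exists u, V w u) ->
  (forall w w', I w -> I w' -> exists w'', I w'' /\ forall u,
    V w'' u -> V w u /\ V w' u) ->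
  exists k a, forall w, I w -> mostly k a (V w).
Proof.
move=> hI hV Vex dir; pose Y v := forall w, I w -> exists u, u <= v /\ V w u.
have hY : dfn Y by rewrite /Y; dfn_tac.
have dV w : dfn (V w) by dfn_tac.
have nY v : ~ Y v -> exists w, I w /\ forall u, V w u -> v < u.
  move=> nYv; apply: contrapT => no; apply: nYv => w Iw;
    apply: contrapT => nu; apply: no.
  exists w; split=> // u Vu; rewrite ltNge; apply/negP => uv; apply: nu;
    by exists u.
case: (pselect (exists v, Y v)) => [exY|noY]; last first.
  have [a0] := M_point; exists AtPlusInfty, a0 => w Iw;
    case: (germP_dec (dV w)) => // -[b hb].
  have [w0 [Iw0 h0]] := nY b (fun h => noY (ex_intro _ b h)).
  have [w1 [Iw1 h1]] := dir _ _ Iw Iw0; have [u /h1 [Vu /h0]] := Vex _ Iw1.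
  by move=> /hb [].
case: (pselect (exists v, ~ Y v)) => [exnY|allY]; last first.
  have [a0] := M_point; exists AtMinusInfty, a0 => w Iw;
    case: (germN_dec (dV w)) => // -[b hb].
  have [v vb] := M_below b; have Yv : Y v by apply: contrapT => h;
    apply: allY; exists v.
  have [u [uv Vu]] := Yv w Iw; by case: (hb u (le_lt_trans uv vb)).
have [||||a [alo ahi]] := @dfn_sup (fun v => ~ Y v).
- by dfn_tac.
- by [].
- by case: exY => v Yv; exists v.
- move=> x y xy nYy Yx; apply: nYy => w /Yx [u [ux Vu]]; exists u; split=> //;
    exact: le_trans ux xy.
case: (pselect (Y a)) => [Ya|nYa]; last first.
  exists RightOf, a => w Iw /=; case: (germR_dec (dV w) a) => // -[b [ab hb]].
  have [w0 [Iw0 h0]] := nY a nYa; have [v /andP[av vb]] := M_dense ab.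
  have Yv : Y v by apply: contrapT (ahi v av).
  have [w1 [Iw1 h1]] := dir _ _ Iw Iw0;
    have [u [uv /h1 [Vu /h0 au]]] := Yv _ Iw1.
  by case: (hb u); rewrite ?au ?(le_lt_trans uv vb).
case: (pselect (forall w, I w -> V w a)) => [allV|]; first by exists At, a.
move=> /existsNP [w1 /not_implyP [Iw1 nV1]].
exists LeftOf, a => w Iw /=; case: (germL_dec (dV w) a) => // -[b [ba hb]].
have [v /andP[bv va]] := M_dense ba; have [w0 [Iw0 h0]] := nY v (alo v va).
have [w2 [Iw2 h2]] := dir _ _ Iw Iw0; have [w3 [Iw3 h3]] := dir _ _ Iw2 Iw1.
have [u [ua /h3 [/h2 [Vu /h0 vu] V1u]]] := Ya w3 Iw3.
case: (hb u) => //; rewrite (lt_trans bv vu) lt_neqAle ua andbT.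
by apply/negP => /eqP E; apply: nV1; rewrite -E.
Qed.

(** One definable family, uniform in t, contains all members of [C t]; further members are
    allowed. *)
Definition covered {T X} {dT : dtype T} {dX : dtype X} (C : T -> (X -> Prop) ->
  Prop) : Prop :=
  exists Z (dZ : dtype Z) (psi : T -> Z -> X -> Prop),
    dfn3 psi /\ forall t I, C t I -> exists z, I = psi t z.

Lemma predE X (P Q : X -> Prop) : (forall x, P x <-> Q x) -> P = Q.
Proof.
by move=> PQ; apply: functional_extensionality_dep => x;
  apply: propositional_extensionality.
Qed.

Section Covered.
Context {T X : Type} {dT : dtype T} {dX : dtype X}.

Lemma covered_sub (C C' : T -> (X -> Prop) -> Prop) :
  (forall t I, C t I -> C' t I) -> covered C' -> covered C.
Proof. by move=> CC' [Z [dZ [psi [h1 h2]]]]; exists Z, dZ, psi;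
  split=> // t I /CC' /h2. Qed.

Lemma covered_or (C C' : T -> (X -> Prop) -> Prop) : covered C -> covered C' ->
  covered (fun t I => C t I \/ C' t I).
Proof.
move=> [Z [dZ [psi [h1 h2]]]] [Z' [dZ' [psi' [h1' h2']]]].
(* The pair in M * M is a tag: equal entries select the first family, distinct ones the second. The
   same device recurs in [ufam_or] and [types_uniform2]. *)
exists (Z * Z' * (M * M))%type, _, (fun t p x =>
  p.2.1 = p.2.2 /\ psi t p.1.1 x \/
   p.2.1 <> p.2.2 /\ psi' t p.1.2 x); split; first by dfn_tac.
have [a] := M_point; have [b ab] := M_above a.
have ne : a <> b by move=> E; rewrite E ltxx in ab.
pose z0 := @mk Z dZ (fun _ => a); pose z0' := @mk Z' dZ' (fun _ => a).
move=> t I [/h2 [z ->]|/h2' [z ->]];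
  [exists (z, z0', (a, a))|exists (z0, z, (a, b))];
  apply: predE => x /=; split; [by left|by case=> -[]|by right|by case=> -[]].
Qed.

Lemma covered_bigor (C : nat -> T -> (X -> Prop) -> Prop) n : (forall i,
  covered (C i)) ->
  covered (fun t I => exists i, (i < n)%N /\ C i t I).
Proof.
move=> hC; elim: n => [|n IH].
  by exists unit, _, (fun _ _ _ => True); split; [dfn_tac|move=> t I [i []]].
apply: covered_sub (covered_or (hC n) IH) => t I [i []].
by rewrite ltnS leq_eqVlt => /orP[/eqP->|ilt] h; [left|right; exists i].
Qed.

(** The form in which induction hypotheses are applied: I is recovered by a definable operation F
    from a set I' already covered and an extra parameter s. *)
Lemma covered_op {S' X'} {dS : dtype S'} {dX' : dtype X'} (C : T -> (X -> Prop)
  -> Prop)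
    (C' : T * S' -> (X' -> Prop) -> Prop) (F : T -> S' -> (X' -> Prop) -> X ->
      Prop) :
  covered C' ->
  (forall Z (dZ : dtype Z) (psi : T * S' -> Z -> X' -> Prop), dfn3 psi ->
     dfn3 (fun t (p : S' * Z) x => F t p.1 (psi (t, p.1) p.2) x)) ->
  (forall t I, C t I -> exists s I', C' (t, s) I' /\ forall x,
    I x <-> F t s I' x) ->
  covered C.
Proof.
move=> [Z [dZ [psi [h1 h2]]]] hF h;
  exists (S' * Z)%type, _, (fun t p x => F t p.1 (psi (t, p.1) p.2) x).
split; first exact: hF.
move=> t I /h [s [I' [/h2 [z ->] hI]]]; exists (s, z); exact: predE.
Qed.
End Covered.

Section Chains.
Variables (X : Type) (R : X -> X -> Prop) (B : X -> Prop).

(** Having a chain of length i but none of length i + 1 below it is a first-order way of naming the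
    ith of finitely many linearly ordered classes. *)
Fixpoint chain_below i (g : X) : Prop :=
  match i with
  | 0 => True
  | i.+1 => exists g', [/\ B g', R g' g & chain_below i g']
  end.

Lemma chain_index N g : ~ chain_below N g ->
  exists i, [/\ (i < N)%N, chain_below i g & ~ chain_below i.+1 g].
Proof.
elim: N => [|N IH]; first by move=> [].
case: (pselect (chain_below N g)) => [h h'|/IH [i [iN h h']] _].
  by exists N.
by exists i; split=> //; apply: ltnW.
Qed.

Lemma chain_separated (E : X -> X -> Prop) i g : (forall x y, E x y -> E y x) ->
  (forall x y z, R x y -> R y z -> R x z) -> (forall x y, R x y -> ~ E x y) ->
  chain_below i g ->
  exists s : seq X, [/\ size s = i, separated E s & forall x,
    List.In x s -> B x /\ R x g].
Proof.
move=> Es Rt RE; elim: i g => [|i IH] g /=; first by exists [::].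
move=> [g' [Bg' Rg' /IH [s [ss sep hs]]]]; exists (g' :: s); rewrite /= ss;
  split=> //.
  by split=> // y /hs [_ /RE h] /Es.
by move=> x [<-|/hs [Bx Rx]]; split=> //; apply: Rt Rx Rg'.
Qed.
End Chains.

Lemma dfn_chain i {T X} {dT : dtype T} {dX : dtype X} (R : T -> X -> X -> Prop)
  (B : T -> X -> Prop) :
  dfn3 R -> dfn2 B -> dfn2 (fun t g => chain_below (R t) (B t) i g).
Proof.
move=> hR hB; elim: i => [|i IH] /=; first by dfn_tac.
pose c t g := chain_below (R t) (B t) i g; have hc : dfn2 c := IH.
apply: (@dfn_ext _ _ _ (fun p =>
  exists g', [/\ B p.1 g', R p.1 g' p.2 & c p.1 g'])) => //.
by dfn_tac.
Qed.

Definition cut_of {X} {dX : dtype X} (K : X -> Prop) (le : X -> X -> Prop) (I :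
  X -> Prop) : Prop :=
  [/\ dfn I, forall x, I x -> K x & forall x y, I y -> K x -> le x y -> I x].

Lemma dimge0 n (P : pw n -> Prop) x : P x -> dimge 0 P.
Proof. by elim: n P x => [|n IH] P x Px; [split=> //; case: x Px|left;
  exists x.1; apply: (IH _ x.2); case: x Px]. Qed.

(** If each [D i] missed some [V w], a common refinement of these N sets would miss all of them,
    although they cover M. *)
Lemma pigeonhole_directed {X} (I : X -> Prop) (V : X -> M -> Prop) (D : nat ->
  M -> Prop) N :
  (exists w, I w) -> (forall w, I w -> exists u, V w u) ->
  (forall w w', I w -> I w' -> exists w'', I w'' /\ forall u,
    V w'' u -> V w u /\ V w' u) ->
  (forall u, exists i, (i < N)%N /\ D i u) ->
  exists i, (i < N)%N /\ forall w, I w -> exists u, V w u /\ D i u.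
Proof.
move=> [w0 Iw0] Vex dir hD; apply: contrapT => no.
have bad i : (i < N)%N -> exists w, I w /\ forall u, V w u -> ~ D i u.
  move=> iN; apply: contrapT => nw; apply: no; exists i; split=> // w Iw.
  apply: contrapT => nu; apply: nw; exists w; split=> // u Vu Du; apply: nu;
    by exists u.
suff [w [Iw hw]] : exists w, I w /\ forall i, (i < N)%N -> forall u,
  V w u -> ~ D i u.
  by have [u Vu] := Vex w Iw; have [i [iN Du]] := hD u; apply: (hw i iN u).
elim: {hD no} N bad => [|N IH] bad; first by exists w0.
have [|w [Iw hw]] := IH; first by move=> i iN; apply: bad; apply: ltnW.
have [w' [Iw' hw']] := bad N (leqnn _); have [v [Iv hv]] := dir _ _ Iw Iw'.
exists v; split=> // i; rewrite ltnS leq_eqVlt =>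
  /orP[/eqP->|iN] u /hv [Vu Vu']; first exact: hw'.
exact: (hw i iN).
Qed.

(** * The generic cut: gaps of the fibres around it *)

Section CutStep.
Variables (n e : nat) (T : Type) (dT : dtype T).
Variables (K : T -> pw n.+1 -> Prop) (le : T -> pw n.+1 -> pw n.+1 -> Prop).
Hypotheses (hK : dfn2 K) (hle : dfn3 le).
Hypothesis le_total : forall t x y, le t x y \/ le t y x.
Hypothesis le_trans' : forall t x y z, le t x y -> le t y z -> le t x z.
Hypothesis hdim : forall t, ~ dimge e.+1 (K t).

(** With p = (t, u): x and y have the same position relative to every point of the fibre of K over
    u. A gap of the fibre is a class of this equivalence. *)
Definition same_cut (p : T * M) (x y : pw n.+1) := forall v : pw n,
  K p.1 (p.2, v) ->
  (le p.1 x (p.2, v) <-> le p.1 y (p.2, v)) /\ (le p.1 (p.2,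
    v) x <-> le p.1 (p.2, v) y).

Definition big_class p g := K p.1 g /\ dimge e (fun y =>
  K p.1 y /\ same_cut p g y).

Definition below_class p (x y : pw n.+1) := ~ le p.1 y x /\ ~ same_cut p x y.

(** Over u, some point at or above x lies below the ith big class. When this class is the gap around
    the cut I, it says that some point of I over u is at or above x, without mentioning I. *)
Definition lower_part i t (x : pw n.+1) u := exists v : pw n, [/\ K t (u, v),
  le t x (u, v) &
  exists g, [/\ big_class (t, u) g, chain_below (below_class (t,
    u)) (big_class (t, u)) i g,
    ~ chain_below (below_class (t, u)) (big_class (t,
      u)) i.+1 g & ~ le t g (u, v)]].

Lemma le_refl' t x : le t x x.
Proof. by case: (le_total t x x). Qed.

Lemma same_sym p x y : same_cut p x y -> same_cut p y x.
Proof. by move=> h v Kv; have [h1 h2] := h v Kv; split; apply: iff_sym. Qed.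

Lemma same_trans p x y z : same_cut p x y -> same_cut p y z -> same_cut p x z.
Proof.
move=> h h' v Kv; have [h1 h2] := h v Kv; have [h3 h4] := h' v Kv.
by split; [apply: iff_trans h1 h3|apply: iff_trans h2 h4].
Qed.

Lemma same_convex p x y z : le p.1 x y -> le p.1 y z -> same_cut p x z ->
  same_cut p x y.
Proof.
move=> xy yz h v /h [h1 h2]; split; split=> hv.
- by apply: le_trans' yz _; apply/h1.
- exact: le_trans' xy hv.
- exact: le_trans' hv xy.
- by apply/h2; apply: le_trans' hv yz.
Qed.

Lemma below_trans p x y z : below_class p x y -> below_class p y z ->
  below_class p x z.
Proof.
move=> [nyx nxy] [nzy nyz].
have xy : le p.1 x y by case: (le_total p.1 x y).
have yz : le p.1 y z by case: (le_total p.1 y z).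
split=> [zx|]; first by apply: nyx; apply: le_trans' yz zx.
by move=> /(same_convex xy yz).
Qed.

Lemma dfn_same : dfn3 same_cut.
Proof. by rewrite /same_cut; dfn_tac. Qed.

Lemma dfn_big : dfn2 big_class.
Proof. by have h := dfn_same; rewrite /big_class; dfn_tac. Qed.

Lemma dfn_lower i : dfn3 (lower_part i).
Proof.
have hB := dfn_big; have hS := dfn_same.
have hR : dfn3 below_class by rewrite /below_class; dfn_tac.
pose c j p g := chain_below (below_class p) (big_class p) j g.
have hc j : dfn2 (c j) by apply: dfn_chain.
have h1 := hc i; have h2 := hc i.+1.
apply: (@dfn_ext _ _ _ (fun q : T * pw n.+1 * M =>
  exists v : pw n, [/\ K q.1.1 (q.2, v), le q.1.1 q.1.2 (q.2, v) &
  exists g, [/\ big_class (q.1.1, q.2) g, c i (q.1.1, q.2) g, ~ c i.+1 (q.1.1,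
    q.2) g & ~ le q.1.1 g (q.2, v)]])) => //.
by dfn_tac.
Qed.

Lemma big_bounded : exists N, forall p g, big_class p g ->
  exists i, [/\ (i < N)%N, chain_below (below_class p) (big_class p) i g &
             ~ chain_below (below_class p) (big_class p) i.+1 g].
Proof.
have hK3 : dfn2 (fun p : T * M => K p.1) by dfn_tac.
have [||||N hN] := @finite_classes n.+1 e _ _ (fun p : T * M =>
  K p.1) same_cut hK3 dfn_same.
- by move=> p x v Kv.
- exact: same_sym.
- exact: same_trans.
- by move=> p; apply: hdim.
exists N => p g Bg; apply: chain_index => hc.
have [|||s [ss sep hs]] := chain_separated (E := same_cut p) _ _ _ hc.
- exact: same_sym.
- exact: below_trans.
- by move=> x y [].
have [r [rN cr]] := hN p.
suff : (N.+1 <= size r)%N by rewrite leqNgt ltnS rN.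
rewrite -ss; apply: (@separated_size _ (same_cut p) (@same_sym p) (@same_trans
  p) (g :: s)).
  by split=> // y /hs [_ [_ h]] /same_sym.
by move=> x [<-|/hs [Bx _]]; apply: cr.
Qed.

Definition between t x0 x1 x := [/\ K t x, le t x0 x & le t x x1].

(* The gap of the fibre over u around the cut is a single class of [same_cut],
   of dimension e, hence one of boundedly many; nearly all fibres have the same
   index i, and their gaps shrink to the cut. *)
Lemma cut_generic : exists N, forall t I, cut_of (K t) (le t) I ->
  (exists x, I x) -> (exists x, K t x /\ ~ I x) ->
  (forall x0 x1, I x0 -> K t x1 -> ~ I x1 -> dimge e (between t x0 x1)) ->
  (forall u, exists x, I x /\ forall v : pw n, I (u, v) -> ~ le t x (u, v)) ->
  (forall u, exists x, [/\ K t x, ~ I x & forall v : pw n, K t (u,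
    v) -> ~ I (u, v) -> ~ le t (u, v) x]) ->
  exists i, (i < N)%N /\ exists k a, forall x,
    I x <-> K t x /\ mostly k a (lower_part i t x).
Proof.
have [N hN] := big_bounded; exists N =>
  t I [dI IK Idn] [xI Ix] [xU [KxU nIx]] hbig hI hU.
have hB := dfn_big; have hS := dfn_same.
have hR : dfn3 below_class by rewrite /below_class; dfn_tac.
pose c j p g := chain_below (below_class p) (big_class p) j g.
have hc j : dfn2 (c j) by apply: dfn_chain.
(* g lies in the gap that the cut leaves in the fibre over u. *)
pose G u g := K t g /\ forall v : pw n, K t (u, v) ->
  (I (u, v) -> ~ le t g (u, v)) /\ (~ I (u, v) -> ~ le t (u, v) g).
have hG : dfn2 G by rewrite /G; dfn_tac.
have tot u g v : ~ le t g (u, v) -> le t (u, v) g by case: (le_total t g (u,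
  v)).
have tot' u g v : ~ le t (u, v) g -> le t g (u, v) by case: (le_total t g (u,
  v)).
have GE u g g' : G u g -> G u g' -> same_cut (t, u) g g'.
  move=> [_ hg] [_ hg'] v Kv; have [h1 h2] := hg v Kv; have [h3 h4] := hg' v Kv.
  case: (pselect (I (u, v))) => Iv.
    have n1 := h1 Iv; have n3 := h3 Iv; split; split=> // _; exact: tot.
  have n1 := h2 Iv; have n3 := h4 Iv; split; split=> // _; exact: tot'.
have IU x y : I x -> K t y -> ~ I y -> ~ le t y x.
  by move=> Ix' Ky nIy yx; apply: nIy; apply: Idn yx.
have Gex u : exists g, G u g /\ big_class (t, u) g.
  have [x0 [Ix0 h0]] := hI u; have [x1 [Kx1 nIx1 h1]] := hU u.
  have G0 : G u x0.
    split=> [|v Kv]; first exact: IK.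
    by split=> [Iv|nIv]; [apply: h0|apply: IU].
  exists x0; split=> //; split; first exact: IK.
  apply: dimge_mono (hbig _ _ Ix0 Kx1 nIx1) => x [Kx l0 l1]; split=> //.
  apply: GE => //; split=> // v Kv; split=> [Iv le1|nIv le1].
    by apply: (h0 v Iv); apply: le_trans' le1.
  by apply: (h1 v Kv nIv); apply: le_trans' l1.
pose D i u := exists g, [/\ G u g, big_class (t, u) g, c i (t,
  u) g & ~ c i.+1 (t, u) g].
have hD i : dfn (D i) by have h1 := hc i; have h2 := hc i.+1; rewrite /D;
  dfn_tac.
pose V x u := exists v : pw n, I (u, v) /\ le t x (u, v).
have hV : dfn2 V by rewrite /V; dfn_tac.
have Vex x : I x -> exists u, V x u.
  by case: x => u v Iv; exists u, v; split=> //; apply: le_refl'.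
have dir w w' : I w -> I w' -> exists w'', I w'' /\ forall u,
  V w'' u -> V w u /\ V w' u.
  move=> Iw Iw'; case: (le_total t w w') => l; [exists w'|exists w];
    split=> // u [v [Iv lv]];
  by split; exists v; split=> //; apply: le_trans' l lv.
(* [V x] shrinks as x increases in I. For some index i all its intersections with [D i] are
   nonempty, hence lie in one definable 1-type of u. *)
have [||i [iN hi]] := @pigeonhole_directed _ I V D N _ Vex dir.
- by exists xI.
- by move=> u; have [g [Gg Bg]] := Gex u; have [i [iN h1 h2]] := hN _ _ Bg;
    exists i; split=> //; exists g.
exists i; split=> //.
have [|||k [a hka]] := @nested_type _ _ I (fun x u => V x u /\ D i u) dI.
- by have h1 := hD i; dfn_tac.
- by [].
- move=> w w' Iw Iw'; have [w'' [Iw'' h]] := dir _ _ Iw Iw'; exists w'';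
    split=> // u [/h [? ?] ?].
  by split.
exists k, a.
(* Two big classes with exactly i big classes below them coincide, so for u in [D i] the class used
   by [lower_part] is the gap, and below the gap means in I. *)
have key x u : D i u -> lower_part i t x u <-> V x u.
  move=> [g [Gg Bg cg ncg]]; split=> [[v [Kv xv [g2 [Bg2 cg2 ncg2 lg2]]]]|[v
    [Iv xv]]].
    exists v; split=> //; apply: contrapT => nIv.
    have Egg : same_cut (t, u) g g2.
      apply: contrapT => nE; case: (pselect (le t g2 g)) => l1; last first.
        by apply: ncg2; exists g; split=> //; split.
      case: (pselect (le t g g2)) => l2; last first.
        by apply: ncg; exists g2; split=> //; split=> // /same_sym.
      apply: nE => v' Kv'; split; split=> h.
      - exact: le_trans' l1 h.
      - exact: le_trans' l2 h.
      - exact: le_trans' h l2.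
      - exact: le_trans' h l1.
    have [_ /(_ v Kv) [_ /(_ nIv) n1]] := Gg.
    have [h1 _] := Egg v Kv; by apply: lg2; apply/h1; apply: tot'.
  exists v; split=> //; first exact: IK.
  exists g; split=> //; have [_ /(_ v (IK _ Iv)) [h1 _]] := Gg; exact: h1.
move=> x; split=> [Ix'|[Kx hm]].
  split; first exact: IK.
  by apply: mostly_mono (hka x Ix') => u [Vu Du]; apply/key.
have [u [lu [_ Du]]] := mostly_meet hm (hka xI Ix).
by have /(key x u Du) [v [Iv xv]] := lu; apply: Idn Iv Kx xv.
Qed.
End CutStep.

Theorem definable_cuts n e {T} {dT : dtype T} (K : T -> pw n -> Prop) (le : T
  -> pw n -> pw n -> Prop) :
  dfn2 K -> dfn3 le -> (forall t x y, le t x y \/ le t y x) ->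
  (forall t x y z, le t x y -> le t y z -> le t x z) ->
  (forall t, ~ dimge e (K t)) ->
  covered (fun t I => cut_of (K t) (le t) I).
Proof.
elim: n e T dT K le => [|n IHn] e T dT K le hK hle tot tr hdim.
  have [a] := M_point; have [b ab] := M_above a.
  exists (M * M)%type, _, (fun _ p _ => p.1 = p.2); split; first by dfn_tac.
  move=> t I _; case: (pselect (I tt)) => h; [exists (a, a)|exists (a, b)];
    apply: predE => -[] /=.
    by split.
  by split=> // E; rewrite E ltxx in ab.
elim: e T dT K le hK hle tot tr hdim => [|e IHe] T dT K le hK hle tot tr hdim.
  exists unit, _, (fun _ _ _ => False); split; first by dfn_tac.
  move=> t I [_ IK _]; exists tt; apply: predE => x; split=> // /IK /dimge0;
    exact: hdim.
pose C t (I : pw n.+1 -> Prop) := @cut_of _ (dtype_pw n.+1) (K t) (le t) I.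
pose C1 t I := C t I /\ exists x0 x1, [/\ I x0, K t x1,
  ~ I x1 & ~ dimge e (between K le t x0 x1)].
pose C2 t I := C t I /\ exists u, forall x, I x -> exists v : pw n, I (u,
  v) /\ le t x (u, v).
pose C3 t I := C t I /\ exists u, forall x, K t x -> ~ I x -> exists v : pw n,
  [/\ K t (u, v), ~ I (u, v) & le t (u, v) x].
have cov0 : covered (fun (t : T) (I : pw n.+1 -> Prop) => forall x, ~ I x).
  exists unit, _, (fun _ _ _ => False); split; first by dfn_tac.
  by move=> t I h; exists tt; apply: predE => x; split=> // /h.
have covK : covered (fun (t : T) (I : pw n.+1 -> Prop) =>
  forall x, I x <-> K t x).
  exists unit, _, (fun t _ x => K t x); split; first by dfn_tac.
  by move=> t I h; exists tt; apply: predE.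
have cov1 : covered C1.
  pose bt (p : T * (pw n.+1 * pw n.+1)) := between K le p.1 p.2.1 p.2.2.
  have hbt : dfn2 bt by rewrite /bt /between; dfn_tac.
  (* The added conjunct empties [K'] when the interval is large, so that the dimension bound of the
     induction hypothesis holds for every parameter. *)
  pose K' p x := bt p x /\ ~ dimge e (bt p).
  have hK' : dfn2 K' by rewrite /K'; dfn_tac.
  pose le' (p : T * (pw n.+1 * pw n.+1)) := le p.1.
  have hle' : dfn3 le' by rewrite /le'; dfn_tac.
  have hc := IHe _ _ K' le' hK' hle' (fun p => tot p.1) (fun p => tr p.1).
  apply: (covered_op (F := fun t s I' x =>
    K t x /\ (le t x s.1 \/ I' x)) (hc _)).
  - move=> p h; have [x [_ nd]] := dimge_ex h; apply: nd;
      by apply: dimge_mono h => y [].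
  - by move=> Z dZ psi hpsi; dfn_tac.
  move=> t I [[dI IK Idn] [x0 [x1 [Ix0 Kx1 nIx1 nd]]]];
    exists (x0, x1), (fun x => I x /\ K' (t, (x0, x1)) x).
  split.
    split=> [|x []//|x y [Iy Ky] Kx xy]; first by dfn_tac.
    by split=> //; apply: Idn Iy _ xy; case: Kx => -[].
  move=> x; split=> [Ix|[Kx [h|[]//]]]; last by apply: Idn Ix0 Kx h.
  have Kx := IK x Ix; split=> //; case: (tot t x x0) => h; [by left|right].
  split=> //; split=> //; split=> //; case: (tot t x x1) => // h'.
  by case: nIx1; apply: Idn Ix Kx1 h'.
pose K1 (p : T * M) (v : pw n) := K p.1 (p.2, v).
have hK1 : dfn2 K1 by rewrite /K1; dfn_tac.
pose le1 (p : T * M) (v w : pw n) := le p.1 (p.2, v) (p.2, w).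
have hle1 : dfn3 le1 by rewrite /le1; dfn_tac.
have hc1 : covered (fun p I => cut_of (K1 p) (le1 p) I).
  apply: (IHn e.+1 _ _ K1 le1 hK1 hle1).
  - by move=> p v w; apply: tot.
  - by move=> p v w z; apply: tr.
  - by move=> p h; apply: (hdim p.1); left; exists p.2.
have cut1 t u I : C t I -> cut_of (K1 (t, u)) (le1 (t, u)) (fun v => I (u, v)).
  move=> [dI IK Idn]; split; first by dfn_tac.
    by move=> v /IK.
  by move=> v w Iw Kv; apply: Idn.
have cov2 : covered C2.
  apply: (covered_op (F := fun t u I' x =>
    K t x /\ exists v : pw n, I' v /\ le t x (u, v)) hc1).
  - by move=> Z dZ psi hpsi; dfn_tac.
  move=> t I [CI [u hu]]; exists u, (fun v => I (u, v)); split;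
    first exact: cut1.
  case: CI => dI IK Idn x; split=> [Ix|[Kx [v [Iv xv]]]];
    last exact: Idn Iv Kx xv.
  by split; [apply: IK|apply: hu].
have cov3 : covered C3.
  apply: (covered_op (F := fun t u I' x =>
    K t x /\ ~ exists v : pw n, [/\ K t (u, v), ~ I' v & le t (u, v) x]) hc1).
  - by move=> Z dZ psi hpsi; dfn_tac.
  move=> t I [CI [u hu]]; exists u, (fun v => I (u, v)); split;
    first exact: cut1.
  case: CI => dI IK Idn x; split=> [Ix|[Kx nv]].
    split; [exact: IK|move=> [v [Kv nIv vx]]; apply: nIv; exact: Idn Ix Kv vx].
  by apply: contrapT => nIx; apply: nv; apply: hu.
have [N hN] := cut_generic hK hle tot tr hdim.
pose C4 i k (t : T) (I : pw n.+1 -> Prop) :=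
  exists a, forall x, I x <-> K t x /\ mostly k a (lower_part e K le i t x).
have cov4 i k : covered (C4 i k).
  exists M, _, (fun t a x => K t x /\ mostly k a (lower_part e K le i t x));
    split.
    have hl := dfn_lower e hK hle i; apply: dfn_and; first by dfn_tac.
    by apply: dfn_mostly; [dmap_tac|dfn_tac].
  by move=> t I [a ha]; exists a; apply: predE.
have cov5 := covered_bigor N (fun i =>
  covered_or (covered_or (cov4 i At) (cov4 i RightOf))
  (covered_or (cov4 i LeftOf) (covered_or (cov4 i AtPlusInfty) (cov4 i
    AtMinusInfty)))).
apply: covered_sub (covered_or (covered_or cov0 covK) (covered_or cov1
  (covered_or (covered_or cov2 cov3) cov5))).
move=> t I CI; have [dI IK Idn] := CI.
case: (pselect (exists x, I x)) => [exI|noI]; last first.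
  by left; left => x Ix; apply: noI; exists x.
case: (pselect (exists x, K t x /\ ~ I x)) => [exU|noU]; last first.
  left; right => x; split=> [/IK//|Kx]; apply: contrapT => nIx; apply: noU;
    by exists x.
right; case: (pselect (C1 t I)) => [|n1]; [by left|right].
case: (pselect (C2 t I)) => [|n2]; [by left; left|].
case: (pselect (C3 t I)) => [|n3]; [by left; right|right].
have [|||i [iN [k [a ha]]]] := hN t I CI exI exU.
- move=> x0 x1 Ix0 Kx1 nIx1; apply: contrapT => nd; apply: n1; split=> //.
  by exists x0, x1.
- move=> u; apply: contrapT => nx; apply: n2; split=> //; exists u => x Ix.
  apply: contrapT => nv; apply: nx; exists x; split=> // v Iv xv; apply: nv;
    by exists v.
- move=> u; apply: contrapT => nx; apply: n3; split=> //; exists u => x Kx nIx.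
  apply: contrapT => nv; apply: nx; exists x; split=> // v Kv nIv xv;
    apply: nv; by exists v.
exists i; split=> //; case: k ha => ha.
- by left; left; exists a.
- by left; right; exists a.
- by right; left; exists a.
- by right; right; left; exists a.
- by right; right; right; exists a.
Qed.

Lemma dimge_le n e (P : pw n -> Prop) : dimge e P -> (e <= n)%N.
Proof.
elim: n e P => [|n IH] e P /=; first by move=> [->].
move=> [[u /IH /leqW //]|]; case: e =>
  // e [a [b [/M_dense [u hu] /(_ u hu) /IH]]].
by rewrite ltnS.
Qed.

Lemma definable_cuts_total {T Y} {dT : dtype T} {dY : dtype Y} (le : T -> Y ->
  Y -> Prop) :
  dfn3 le -> (forall t x y, le t x y \/ le t y x) ->
  (forall t x y z, le t x y -> le t y z -> le t x z) ->
  covered (fun t I => dfn I /\ forall x y, I y -> le t x y -> I x).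
Proof.
move=> hle tot tr.
pose le' t (x y : pw (@dn Y dY)) := le t (@of_pw Y dY x) (@of_pw Y dY y).
have hle' : dfn3 le' by rewrite /le'; dfn_tac.
have hK : @dfn2 _ _ dT (dtype_pw _) (fun (t : T) (_ : pw (@dn Y dY)) =>
  True) by dfn_tac.
have hc : covered (fun t I => cut_of (fun _ => True) (le' t) I).
  (* No subset of M^d has dimension d + 1. *)
  apply: (@definable_cuts (dn Y) (dn Y).+1 _ _ _ le' hK hle').
  - by move=> t x y; apply: tot.
  - by move=> t x y z; apply: tr.
  - by move=> t /dimge_le; rewrite ltnn.
have hc' : covered (fun (p : T * unit) I => cut_of (fun _ => True) (le' p.1) I).
  have [Z [dZ [psi [h1 h2]]]] := hc.
  by exists Z, dZ, (fun p => psi p.1); split=> [|t I /h2//]; dfn_tac.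
apply: (covered_op (F := fun t s I' y => I' (to_pw y)) hc').
  by move=> Z dZ psi hpsi; dfn_tac.
move=> t I [dI Idn]; exists tt, (fun x => I (of_pw x)); split=> [|x];
  last by rewrite to_pwK.
by split=> [|//|x y Iy _]; [dfn_tac|apply: Idn].
Qed.

(** * Definable types *)

(** Definable types over any [dtype], as predicates constrained only on definable sets;
    [deftype_definable] and [definable_deftype] compare them with [definable_type]. *)
Record deftype {X} {dX : dtype X} (p : (X -> Prop) -> Prop) : Prop := {
  dt_def : forall Y (dY : dtype Y) (A : X -> Y -> Prop),
    dfn2 A -> dfn (fun y => p (fun x => A x y));
  dt_T : p (fun _ => True);
  dt_F : ~ p (fun _ => False);
  dt_I : forall A B, dfn A -> dfn B -> p A -> p B -> p (fun x => A x /\ B x);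
  dt_up : forall A B, dfn A -> dfn B -> (forall x, A x -> B x) -> p A -> p B;
  dt_or : forall A, dfn A -> p A \/ p (fun x => ~ A x) }.

Section DefType.
Context {X : Type} {dX : dtype X} {p : (X -> Prop) -> Prop}.
Hypothesis hp : deftype p.

Lemma dt_all A : dfn A -> (forall x, A x) -> p A.
Proof. by move=> hA h; apply: (dt_up hp _ hA (fun x _ => h x) (dt_T hp));
  dfn_tac. Qed.

Lemma dt_up2 A B C : dfn A -> dfn B -> dfn C -> (forall x,
  A x -> B x -> C x) -> p A -> p B -> p C.
Proof.
move=> hA hB hC h pA pB; apply: (dt_up hp _ hC _ (dt_I hp hA hB pA pB));
  first by dfn_tac.
by move=> x [/h].
Qed.

Lemma dt_up3 A B C D : dfn A -> dfn B -> dfn C -> dfn D ->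
  (forall x, A x -> B x -> C x -> D x) -> p A -> p B -> p C -> p D.
Proof.
move=> hA hB hC hD h pA pB; apply: (dt_up2 _ hC hD _ (dt_I hp hA hB pA pB));
  first by dfn_tac.
by move=> x [/h].
Qed.

Lemma dt_not A : dfn A -> p (fun x => ~ A x) <-> ~ p A.
Proof.
move=> hA; split=> [pn pA|npA]; last by case: (dt_or hp hA).
by apply: (dt_F hp); apply: (dt_up2 hA _ _ _ pA pn); [dfn_tac|dfn_tac|].
Qed.

Lemma dt_imp A B : dfn A -> dfn B -> (p A -> p B) -> p (fun x => A x -> B x).
Proof.
move=> hA hB h; case: (dt_or hp hA) => pA.
  by apply: (dt_up hp hB _ _ (h pA)); [dfn_tac|].
by apply: (dt_up hp _ _ _ pA); [dfn_tac|dfn_tac|].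
Qed.

Lemma dt_iff A B C : dfn A -> dfn B -> dfn C -> p C -> (forall x,
  C x -> (A x <-> B x)) -> p A <-> p B.
Proof.
move=> hA hB hC pC h; split=> pA;
  [apply: (dt_up2 hC hA hB _ pC pA)|apply: (dt_up2 hC hB hA _ pC pA)];
  by move=> x /h ->.
Qed.

Lemma dfn_forall_lt N {W} {dW : dtype W} (A : nat -> W -> Prop) : (forall j,
  dfn (A j)) ->
  dfn (fun x => forall j, (j < N)%N -> A j x).
Proof.
move=> hA; elim: N => [|N IH].
  by apply: (@dfn_ext _ _ _ (fun _ => True)); [|dfn_tac].
have h := hA N; apply: (@dfn_ext _ _ _ (fun x =>
  A N x /\ forall j, (j < N)%N -> A j x)).
  move=> x; split=> [H|[h1 h2] j]; first by split=> [|j jN]; apply: H => //;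
    apply: ltnW.
  by rewrite ltnS leq_eqVlt => /orP[/eqP->|/h2].
by apply: dfn_and.
Qed.

Lemma dt_forall_lt N (A : nat -> X -> Prop) : (forall j, dfn (A j)) ->
  (forall j, (j < N)%N -> p (A j)) -> p (fun x => forall j, (j < N)%N -> A j x).
Proof.
move=> hA; elim: N => [|N IH] h; first by apply: dt_all => //;
  apply: dfn_forall_lt.
have h1 := dfn_forall_lt N hA.
apply: (dt_up2 (hA N) h1 (dfn_forall_lt N.+1 hA) _ (h N (leqnn _)) (IH _)).
  by move=> x h2 h3 j; rewrite ltnS leq_eqVlt => /orP[/eqP->|/h3].
by move=> j jN; apply: h; apply: ltnW.
Qed.
End DefType.

Lemma deftype_proj {X} {dX : dtype X} (p : (M * X -> Prop) -> Prop) : deftype p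
  ->
  deftype (fun A : X -> Prop => p (fun vx => A vx.2)).
Proof.
move=> hp; split.
- by move=> Y dY A hA; apply: (dt_def hp (A := fun vx y => A vx.2 y)); dfn_tac.
- exact: dt_T hp.
- exact: dt_F hp.
- by move=> A B hA hB; apply: (dt_I hp); dfn_tac.
- by move=> A B hA hB h; apply: (dt_up hp); [dfn_tac|dfn_tac|move=> x;
    apply: h].
- by move=> A hA; apply: (dt_or hp (A := fun vx => A vx.2)); dfn_tac.
Qed.

Lemma mostly_and k a (P Q : M -> Prop) : mostly k a P -> mostly k a Q -> mostly
  k a (fun x => P x /\ Q x).
Proof.
case: k => //=.
- move=> [b [ab hb]] [c [ac hc]]; exists (Order.min b c); rewrite lt_min ab;
    split=> // x.
  by rewrite lt_min => /andP[ax /andP[xb xc]]; split; [apply: hb|apply: hc];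
    rewrite ax.
- move=> [b [ab hb]] [c [ac hc]]; exists (Order.max b c); rewrite gt_max ab;
    split=> // x.
  by rewrite gt_max => /andP[/andP[xb xc] ax]; split; [apply: hb|apply: hc];
    rewrite ?xb ?xc.
- move=> [b hb] [c hc]; exists (Order.max b c) => x;
    rewrite gt_max => /andP[xb xc].
  by split; [apply: hb|apply: hc].
- move=> [b hb] [c hc]; exists (Order.min b c) => x;
    rewrite lt_min => /andP[xb xc].
  by split; [apply: hb|apply: hc].
Qed.

Lemma mostly_dec k a (P : M -> Prop) : dfn P -> mostly k a P \/ mostly k a (fun
  x => ~ P x).
Proof.
move=> hP; case: k => /=; [by case: (pselect (P a));
  [left|right]|exact: germR_dec|exact: germL_dec|exact: germP_dec|exact:
  germN_dec].
Qed.

Lemma mostly_true k a : mostly k a (fun _ => True).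
Proof.
have h : dfn (fun _ : M => True) by dfn_tac.
by case: (mostly_dec k a h) => // /mostly_mono; apply=> x [].
Qed.

(* The type of (v, x) where x realizes q and v realizes, over x, the 1-type k
   at the point b(x). *)
Lemma deftype_germ {X} {dX : dtype X} (q : (X -> Prop) -> Prop) (b : X -> M ->
  Prop) k :
  deftype q -> dfn2 b -> (forall x v v', b x v -> b x v' -> v = v') ->
  q (fun x => exists v, b x v) ->
  deftype (fun A : M * X -> Prop => q (fun x =>
    exists w, b x w /\ mostly k w (fun v => A (v, x)))).
Proof.
move=> hq hb inj bex.
have hm Y (dY : dtype Y) (A : M * X -> Y -> Prop) : dfn2 A ->
    dfn2 (fun x y => exists w, b x w /\ mostly k w (fun v => A (v, x) y)).
  move=> hA; apply: dfn_ex; apply: dfn_and; first by dfn_tac.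
  by apply: dfn_mostly; [dmap_tac|dfn_tac].
have hm1 (A : M * X -> Prop) : dfn A -> dfn (fun x =>
  exists w, b x w /\ mostly k w (fun v => A (v, x))).
  move=> hA; apply: dfn_ex; apply: dfn_and; first by dfn_tac.
  by apply: dfn_mostly; [dmap_tac|dfn_tac].
split.
- by move=> Y dY A hA; apply: (dt_def hq); apply: hm.
- by apply: (dt_up hq _ _ _ bex) => [||x [w bw]];
    [dfn_tac|apply: (hm1 (fun _ => True)); dfn_tac|exists w; split=> //;
    apply: mostly_true].
- move=> h; apply: (dt_F hq); apply: (dt_up hq _ _ _ h) => [||x [w [_ hw]]];
    [apply: (hm1 (fun _ => False)); dfn_tac|dfn_tac|].
  by have [? []] := mostly_meet hw hw.
- move=> A B hA hB; apply: (dt_up2 hq (hm1 A hA) (hm1 B hB));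
    first by apply: (hm1 (fun y => A y /\ B y)); dfn_tac.
  move=> x [w [bw hw]] [w' [bw' hw']]; exists w; split=> //;
    apply: mostly_and => //.
  by rewrite (inj _ _ _ bw bw').
- move=> A B hA hB AB; apply: (dt_up hq (hm1 A hA) (hm1 B hB)).
  by move=> x [w [bw hw]]; exists w; split=> //; apply: mostly_mono hw => v;
    apply: AB.
- move=> A hA; case: (dt_or hq (hm1 A hA)) => h; [by left|right].
  apply: (dt_up2 hq _ _ _ _ bex h) => [|||x [w bw] nw];
    [by dfn_tac| |by apply: (hm1 (fun y => ~ A y)); dfn_tac|].
    by apply: dfn_not; apply: (hm1 A hA).
  exists w; split=> //; have [//|hw|//] := @mostly_dec k w (fun v =>
    A (v, x)); first by dfn_tac.
  by case: nw; exists w.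
Qed.

(** * Endpoints of definable subsets of the line *)

Definition boundary (P : M -> Prop) v :=
  ~ (near v P \/ near v (fun w => ~ P w)).

(** For P the fibre of phi over (x, y), this is the graph of the partial function f_i(x, y), with
    ranks counted from 0. *)
Definition nth_boundary i (P : M -> Prop) v :=
  boundary P v /\ hasn i (fun w => boundary P w /\ w < v).

Lemma dfn_boundary {X} {dX : dtype X} (A : X -> M -> Prop) : dfn2 A -> dfn2
  (fun x => boundary (A x)).
Proof. by move=> hA; rewrite /boundary /near; dfn_tac. Qed.

Lemma dfn_nth_boundary i {X} {dX : dtype X} (A : X -> M -> Prop) :
  dfn2 A -> dfn2 (fun x => nth_boundary i (A x)).
Proof.
move=> hA; pose B x := boundary (A x); have hB : dfn2 B by apply: dfn_boundary.
by apply: (@dfn_ext _ _ _ (fun p => B p.1 p.2 /\ hasn i (fun w =>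
  B p.1 w /\ w < p.2))); [|dfn_tac].
Qed.

Lemma nonfat_boundary (P : M -> Prop) : dfn P -> ~ fat (boundary P).
Proof.
move=> hP [a [b [ab h]]]; have [c [ac cb hc]] := fat_itv hP ab.
have [x /[dup] hx /andP[ax xc]] := M_dense ac; apply: (h x);
  first by rewrite ax (lt_le_trans xc).
by case: hc => hc; [left|right]; exists a, c.
Qed.

Lemma boundary_const (P : M -> Prop) v w : dfn P -> v < w ->
  (forall z, v <= z <= w -> ~ boundary P z) -> (P v <-> P w).
Proof.
move=> hP vw h; apply: dfn_connected => // z /h /contrapT [] hz.
  have Pz := near_self hz; case: hz => [l [u [hlu hu]]]; exists l, u;
    split=> // x /hu Px.
  by split.
have Pz := near_self hz; case: hz => [l [u [hlu hu]]]; exists l, u;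
  split=> // x /hu Px.
by split.
Qed.

Lemma nth_boundary_inj i P v w : nth_boundary i P v -> nth_boundary i P w -> v
  = w.
Proof.
have W r s : nth_boundary i P r -> nth_boundary i P s -> ~ r < s.
  move=> [Br hr] [Bs hs] rs; suff : (i < i)%N by rewrite ltnn.
  apply: (hasn_ltn (z := r) hr hs) => //; last by move=> []; rewrite ltxx.
  by move=> x [Bx xr]; split=> //; apply: lt_trans rs.
by move=> hv hw; case: (ltgtP v w) => // [/(W _ _ hv hw)|/(W _ _ hw hv)].
Qed.

Lemma uniform_boundary {T} {dT : dtype T} (A : T -> M -> Prop) : dfn2 A ->
  exists N, forall t v, boundary (A t) v -> exists i,
    (i < N)%N /\ nth_boundary i (A t) v.
Proof.
move=> hA; have dA t : dfn (A t) by dfn_tac.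
have [N hN] := uniform_card (dfn_boundary hA) (fun t => nonfat_boundary (dA t)).
exists N => t v Bv; have [m [mN hm]] := hN t;
  have [i [_ hi]] := below_card v hm.
exists i; split=> //; apply: leq_trans mN;
  apply: (hasn_ltn (z := v) hi hm) => //.
  by move=> x [].
by move=> []; rewrite ltxx.
Qed.

Section Directed.
Variables (Y : Type) (I : Y -> Prop) (le : Y -> Y -> Prop).
Hypothesis tot : forall y y', I y -> I y' -> le y y' \/ le y' y.
Hypothesis tr : forall x y z, le x y -> le y z -> le x z.

Lemma directed_max y y' : I y -> I y' -> exists z, [/\ I z, le y z & le y' z].
Proof.
move=> Iy Iy'; have r z : I z -> le z z by move=> Iz; case: (tot Iz Iz).
by case: (tot Iy Iy') => h; [exists y'|exists y]; split=> //; apply: r.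
Qed.

(** Each [m i] can only switch from false to true as y grows, so beyond a suitable y1 none of the
    first N switches any more. *)
Lemma stabilize (m : nat -> Y -> Prop) N : (exists y, I y) ->
  (forall i y y', I y -> I y' -> le y y' -> m i y -> m i y') ->
  exists y1, I y1 /\ forall y2, I y2 -> le y1 y2 -> forall i,
    (i < N)%N -> m i y2 -> m i y1.
Proof.
move=> [y0 Iy0] mono; elim: N => [|N [y1 [Iy1 h1]]]; first by exists y0.
case: (pselect (exists y, I y /\ m N y)) => [[y [Iy my]]|no].
  have [z [Iz l1 l2]] := directed_max Iy1 Iy; exists z; split=> // y2 Iy2 l i.
  rewrite ltnS leq_eqVlt => /orP[/eqP->|iN] mi; first exact: mono my.
  by apply: (mono _ y1) => //; apply: (h1 y2) => //; apply: tr l1 l.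
exists y1; split=> // y2 Iy2 l i;
  rewrite ltnS leq_eqVlt => /orP[/eqP->|iN] mi; last exact: (h1 y2).
by case: no; exists y2.
Qed.
End Directed.

Section CofinalType.
Context {X Y : Type} {dX : dtype X} {dY : dtype Y}.
Variables (q : (X -> Prop) -> Prop) (b : X -> Y -> M -> Prop).
Hypotheses (hq : deftype q) (hb : dfn3 b) (b_inj : forall x y v v',
  b x y v -> b x y v' -> v = v').

(** The partial functions sending x to b(x, y) are compared through their germs at q. *)
Definition has_germ y := q (fun x => exists w, b x y w).
Definition germ_le y y' := q (fun x =>
  exists w w', [/\ b x y w, b x y' w' & w <= w']).

Lemma dfn_has_germ : dfn has_germ.
Proof. by apply: (dt_def hq); dfn_tac. Qed.

Lemma dfn_germ_le : dfn2 germ_le.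
Proof.
apply: (@dt_def _ _ _ hq (Y * Y)%type _ (fun x p =>
  exists w w', [/\ b x p.1 w, b x p.2 w' & w <= w'])).
by dfn_tac.
Qed.

Lemma germ_le_total y y' : has_germ y -> has_germ y' -> germ_le y y' \/ germ_le
  y' y.
Proof.
move=> hy hy'; have h : dfn (fun x =>
  exists w w', [/\ b x y w, b x y' w' & w <= w']) by dfn_tac.
case: (dt_or hq h) => hl; [by left|right].
apply: (dt_up3 hq _ _ _ _ _ hy hy' hl); rewrite ?/germ_le; try by dfn_tac.
move=> x [w bw] [w' bw'] n; exists w', w; split=> //; apply: ltW; rewrite ltNge.
by apply/negP => l; apply: n; exists w, w'.
Qed.

Lemma germ_le_trans y y' y'' : germ_le y y' -> germ_le y' y'' -> germ_le y y''.
Proof.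
apply: (dt_up2 hq); try by dfn_tac.
move=> x [w [w' [bw bw' l]]] [v [v' [bv bv' l']]]; exists w, v'; split=> //.
by apply: le_trans l _; rewrite (b_inj bw' bv).
Qed.

Lemma germ_le_dom y y' : germ_le y y' -> has_germ y /\ has_germ y'.
Proof.
by move=> h; split; apply: (dt_up hq _ _ _ h); try (by dfn_tac);
  move=> x [w [w' [bw bw' _]]];
  [exists w|exists w'].
Qed.

Lemma germ_le_refl y : has_germ y -> germ_le y y.
Proof. by move=> h; case: (germ_le_total h h). Qed.

(* The type of (v, x) where x realizes q and v is the limit of b(x, y) as y
   grows in I. *)
Definition cofinal_type (I : Y -> Prop) (A : M * X -> Prop) := exists y1,
  I y1 /\
  forall y2, I y2 -> germ_le y1 y2 -> q (fun x =>
    exists w, b x y2 w /\ A (w, x)).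

(** The point is that every definable A is decided. Over x, A has boundedly many boundary points; as
    y grows in I, b(x, y) passes each of them at most once, so q decides A at b(x, y) in the same
    way for all large y. *)
Lemma deftype_cofinal (I : Y -> Prop) : dfn I -> (exists y, I y) -> (forall y,
  I y -> has_germ y) ->
  deftype (cofinal_type I).
Proof.
move=> hI exI Idom; have hle := dfn_germ_le.
have tot y y' : I y -> I y' -> germ_le y y' \/ germ_le y' y.
  by move=> /Idom h /Idom h'; apply: germ_le_total.
have hev y (A : M * X -> Prop) : dfn A -> dfn (fun x =>
  exists w, b x y w /\ A (w, x)).
  by move=> hA; dfn_tac.
split.
- move=> Z dZ A hA; pose c y2 z := q (fun x =>
    exists w, b x y2 w /\ A (w, x) z).
  have hc : dfn2 c.
    apply: (@dt_def _ _ _ hq (Y * Z)%type _ (fun x p =>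
      exists w, b x p.1 w /\ A (w, x) p.2)).
    by dfn_tac.
  apply: (@dfn_ext _ _ _ (fun z =>
    exists y1, I y1 /\ forall y2, I y2 -> germ_le y1 y2 -> c y2 z)) => //.
  by dfn_tac.
- have [y Iy] := exI; exists y; split=> // y2 Iy2 _.
  by apply: (dt_up hq _ _ _ (Idom _ Iy2)); try (by dfn_tac); move=> x [w bw];
    exists w.
- move=> [y1 [Iy1 h]]; apply: (dt_F hq).
  by apply: (dt_up hq _ _ _ (h y1 Iy1 (germ_le_refl (Idom _ Iy1))));
    try (by dfn_tac); move=> x [w []].
- move=> A B hA hB [y1 [Iy1 h1]] [y2 [Iy2 h2]].
  have [z [Iz l1 l2]] := directed_max tot Iy1 Iy2; exists z; split=> // y Iy l.
  apply: (dt_up2 hq (hev y A hA) (hev y B hB) _ _ (h1 y Iy (germ_le_trans l1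
    l)) (h2 y Iy (germ_le_trans l2 l))).
    by dfn_tac.
  by move=> x [w [bw Aw]] [w' [bw' Bw']]; exists w; have E := b_inj bw' bw;
    do !split=> //; rewrite -E.
- move=> A B hA hB AB [y1 [Iy1 h]]; exists y1; split=> // y2 Iy2 l.
  apply: (dt_up hq (hev y2 A hA) (hev y2 B hB) _ (h y2 Iy2 l)).
  by move=> x [w [bw Aw]]; exists w; split=> //; apply: AB.
move=> A hA; have hA2 : dfn2 (fun x v => A (v, x)) by dfn_tac.
have [N hN] := uniform_boundary hA2.
pose nb j x v := nth_boundary j (fun v => A (v, x)) v.
have hnb j : dfn2 (nb j) by apply: dfn_nth_boundary.
(* [s1] and [s2]: the jth boundary point is at most, or strictly below, b(x, y). Both are monotone
   in y and can be stabilized. *)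
pose s1 j y x := exists w v, [/\ b x y w, nb j x v & v <= w].
pose s2 j y x := exists w v, [/\ b x y w, nb j x v & v < w].
have hs1 j y : dfn (s1 j y) by have h := hnb j; rewrite /s1; dfn_tac.
have hs2 j y : dfn (s2 j y) by have h := hnb j; rewrite /s2; dfn_tac.
have mono1 j y y' : germ_le y y' -> q (s1 j y) -> q (s1 j y').
  apply: (dt_up2 hq _ _ (hs1 j y')); [by dfn_tac|exact: hs1|].
  move=> x [w [w' [bw bw' l]]] [u [v [bu nv l']]]; exists w', v; split=> //.
  by apply: le_trans l' _; rewrite (b_inj bu bw).
have mono2 j y y' : germ_le y y' -> q (s2 j y) -> q (s2 j y').
  apply: (dt_up2 hq _ _ (hs2 j y')); [by dfn_tac|exact: hs2|].
  move=> x [w [w' [bw bw' l]]] [u [v [bu nv l']]]; exists w', v; split=> //.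
  by apply: lt_le_trans l' _; rewrite (b_inj bu bw).
have [|ya [Iya ha]] := @stabilize _ I germ_le tot germ_le_trans (fun j y =>
  q (s1 j y)) N exI.
  by move=> j y y' _ _; apply: mono1.
have [|yb [Iyb hb']] := @stabilize _ I germ_le tot germ_le_trans (fun j y =>
  q (s2 j y)) N exI.
  by move=> j y y' _ _; apply: mono2.
have [y1 [Iy1 la lb]] := directed_max tot Iya Iyb.
have key y2 : I y2 -> germ_le y1 y2 ->
    q (fun x => exists w, b x y2 w /\ A (w, x)) <-> q (fun x =>
      exists w, b x y1 w /\ A (w, x)).
  move=> Iy2 l; pose st j x := (s1 j y2 x -> s1 j y1 x) /\ (s2 j y2 x -> s2 j
    y1 x).
  have hst j : dfn (st j).
    by have h1 := hs1 j; have h2 := hs2 j; apply: dfn_and; apply: dfn_imp.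
  have hall := dfn_forall_lt N hst.
  have pst : q (fun x => forall j, (j < N)%N -> st j x).
    apply: dt_forall_lt => // j jN; apply: (dt_I hq); try by apply: dfn_imp.
      apply: dt_imp => // h; apply: (mono1 _ _ _ la); apply: (ha y2) => //.
      exact: germ_le_trans la l.
    apply: dt_imp => // h; apply: (mono2 _ _ _ lb); apply: (hb' y2) => //.
    exact: germ_le_trans lb l.
  have hl : dfn (fun x => exists w w', [/\ b x y1 w,
    b x y2 w' & w <= w']) by dfn_tac.
  apply: (dt_iff hq (hev y2 A hA) (hev y1 A hA) _ (dt_I hq hl hall l pst));
    first exact: dfn_and.
  move=> x [[w [w' [bw bw' ww']]] hx].
  suff E : A (w', x) <-> A (w, x).
    split=> [] [u [bu Au]]; [exists w|exists w']; split=> //; apply/E.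
      by rewrite (b_inj bw' bu).
    by rewrite (b_inj bw bu).
  move: ww'; rewrite le_eqVlt => /orP[/eqP->//|ww'].
  symmetry; apply: (@boundary_const (fun v => A (v, x))) => //;
    first by dfn_tac.
  (* A boundary point z between b(x, y1) and b(x, y2) must equal b(x, y1) by the stability of [s1],
     and this is excluded by that of [s2]. *)
  move=> z /andP[wz zw'] /hN [j [jN nz]]; have [i1 i2] := hx j jN.
  have [u [v [bu nv vu]]] : s1 j y1 x by apply: i1; exists w', z.
  have Ez : v = z := nth_boundary_inj nv nz; have Eu := b_inj bu bw.
  have zw : z = w by apply/eqP; rewrite eq_le wz andbT -Ez -Eu.
  have [u' [v' [bu' nv' v'u']]] : s2 j y1 x by apply: i2; exists w', z;
    split=> //; rewrite zw.
  have Ez' : v' = z := nth_boundary_inj nv' nz; have Eu' := b_inj bu' bw.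
  by move: v'u'; rewrite Ez' Eu' zw ltxx.
case: (dt_or hq (hev y1 A hA)) => h; [left|right]; exists y1;
  split=> // y2 Iy2 l.
  by apply/(key y2 Iy2 l).
have nA : ~ q (fun x => exists w, b x y2 w /\ A (w,
  x)) by move=> /(key _ Iy2 l); apply/(dt_not hq (hev y1 A hA)).
apply: (dt_up2 hq _ _ _ _ (Idom _ Iy2) (proj2 (dt_not hq (hev y2 A hA)) nA));
  try by dfn_tac.
by move=> x [w bw] nw; exists w; split=> // Aw; apply: nw; exists w.
Qed.
End CofinalType.

(* Some definable family contains D and consists of members of C. *)
Definition ufam {Y} {dY : dtype Y} (C D : (Y -> Prop) -> Prop) : Prop :=
  exists Z (dZ : dtype Z) (zeta : Z -> Prop) (psi : Z -> Y -> Prop),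
    [/\ dfn zeta, dfn2 psi, forall z, zeta z -> C (psi z) &
        forall P, D P -> exists z, zeta z /\ P = psi z].

Section Ufam.
Context {Y : Type} {dY : dtype Y}.

Lemma ufam_sub (C D D' : (Y -> Prop) -> Prop) : (forall P,
  D' P -> D P) -> ufam C D -> ufam C D'.
Proof. by move=> DD' [Z [dZ [z [psi [h1 h2 h3 h4]]]]]; exists Z, dZ, z, psi;
  split=> // P /DD' /h4. Qed.

Lemma ufam_or (C D D' : (Y -> Prop) -> Prop) : ufam C D -> ufam C D' -> ufam C
  (fun P => D P \/ D' P).
Proof.
move=> [Z [dZ [ze [psi [h1 h2 h3 h4]]]]] [Z' [dZ' [ze' [psi' [h1' h2' h3'
  h4']]]]].
have [a] := M_point; have [b ab] := M_above a.
have ne : a <> b by move=> E; rewrite E ltxx in ab.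
pose z0 := @mk Z dZ (fun _ => a); pose z0' := @mk Z' dZ' (fun _ => a).
exists (Z * Z' * (M * M))%type, _,
  (fun p => p.2.1 = p.2.2 /\ ze p.1.1 \/ p.2.1 <> p.2.2 /\ ze' p.1.2),
  (fun p y => p.2.1 = p.2.2 /\ psi p.1.1 y \/ p.2.1 <> p.2.2 /\ psi' p.1.2 y).
have E1 z z' : (fun y => a = a /\ psi z y \/ a <> a /\ psi' z' y) = psi z.
  by apply: predE => y; split=> [[[]|[]]|h] //; left.
have E2 c c' z z' : c <> c' -> (fun y =>
  c = c' /\ psi z y \/ c <> c' /\ psi' z' y) = psi' z'.
  by move=> n; apply: predE => y; split=> [[[]|[]]|h] //; right.
split.
- by dfn_tac.
- by dfn_tac.
- move=> [[z z'] [c c']] /= [[-> hz]|[n hz]]; last by rewrite E2 //; apply: h3'.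
  rewrite (_ : (fun y => _) = psi z); first exact: h3.
  by apply: predE => y; split=> [[[]|[]]|h] //; left.
- move=> P [/h4 [z [hz ->]]|/h4' [z [hz ->]]].
    by exists (z, z0', (a, a)); rewrite /= E1; split=> //; left.
  by exists (z0, z, (a, b)); rewrite /= E2 //; split=> //; right.
Qed.

Lemma ufam_bigor (C : (Y -> Prop) -> Prop) (D : nat -> (Y -> Prop) -> Prop) n :
  (forall i, ufam C (D i)) -> ufam C (fun P => exists i, (i < n)%N /\ D i P).
Proof.
move=> hD; elim: n => [|n IH].
  by exists unit, _, (fun _ => False), (fun _ _ => False); split;
    [dfn_tac|dfn_tac| |move=> P [i []]].
apply: ufam_sub (ufam_or (hD n) IH) => P [i []].
by rewrite ltnS leq_eqVlt => /orP[/eqP->|ilt] h; [left|right; exists i].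
Qed.
End Ufam.

(** * Definable families of traces of types *)

Definition types_on {X Y} {dX : dtype X} (phi : X -> Y -> Prop) (P : Y -> Prop)
  : Prop :=
  exists p, deftype p /\ P = (fun y => p (fun x => phi x y)).

Definition types_uniform X {dX : dtype X} : Prop :=
  forall Y (dY : dtype Y) (phi : X -> Y -> Prop),
    dfn2 phi -> ufam (types_on phi) (types_on phi).

(** Both traces come from the same type q, which two separate applications of uniformity would not
    give; the formulas are merged by a tag. *)
Lemma types_uniform2 X {dX : dtype X} Y Y' {dY : dtype Y} {dY' : dtype Y'}
    (phi : X -> Y -> Prop) (phi' : X -> Y' -> Prop) : @types_uniform X dX ->
      dfn2 phi -> dfn2 phi' ->
  exists Z (dZ : dtype Z) (zeta : Z -> Prop) (psi : Z -> Y -> Prop) (psi' : Z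
    -> Y' -> Prop),
    [/\ dfn zeta, dfn2 psi, dfn2 psi',
      forall z, zeta z -> exists q, [/\ deftype q, psi z = (fun y =>
        q (fun x => phi x y)) &
                              psi' z = (fun y => q (fun x => phi' x y))] &
      forall q, deftype q -> exists z, [/\ zeta z, psi z = (fun y =>
        q (fun x => phi x y)) &
                              psi' z = (fun y => q (fun x => phi' x y))]].
Proof.
move=> U hphi hphi'; have [a] := M_point; have [b ab] := M_above a.
have ne : a <> b by move=> E; rewrite E ltxx in ab.
pose th x (p : Y * Y' * (M * M)) := p.2.1 = p.2.2 /\ phi x p.1.1 \/ p.2.1 <>
  p.2.2 /\ phi' x p.1.2.
have hth : dfn2 th by rewrite /th; dfn_tac.
have [Z [dZ [ze [psi [h1 h2 h3 h4]]]]] := U _ _ th hth.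
pose y0 := @mk Y dY (fun _ => a); pose y0' := @mk Y' dY' (fun _ => a).
exists Z, dZ, ze, (fun z y => psi z (y, y0', (a, a))), (fun z y =>
  psi z (y0, y, (a, b))).
have E1 y : (fun x => th x (y, y0', (a, a))) = (fun x => phi x y).
  by apply: predE => x; rewrite /th /=; split=> [[[]|[]]|h] //; left.
have E2 y : (fun x => th x (y0, y, (a, b))) = (fun x => phi' x y).
  by apply: predE => x; rewrite /th /=; split=> [[[]|[]]|h] //; right.
split; [by []|by dfn_tac|by dfn_tac| |].
  move=> z /h3 [q [hq ->]]; exists q; split=> //;
    apply: functional_extensionality_dep => y.
    by rewrite E1.
  by rewrite E2.
move=> q hq; have [|z [hz E]] := h4 (fun y => q (fun x => th x y));
  first by exists q.
exists z; split=> //; apply: functional_extensionality_dep => y;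
  rewrite -E ?E1 //.
by rewrite E2.
Qed.

(* The three ways in which a definable type of (v, x) can place v among the
   boundary points of the fibres over x: below all of them, immediately to the
   right of one of them, or at the limit of a cofinal family of them. *)
Section Modes.
Context {X Y : Type} {dX : dtype X} {dY : dtype Y}.
Hypothesis U : @types_uniform X dX.
Variable phi : M * X -> Y -> Prop.
Hypothesis hphi : dfn2 phi.

Lemma uniform_minus_infty : ufam (types_on phi) (fun P => exists q, deftype q /\
  P = (fun y => q (fun x => germN (fun v => phi (v, x) y)))).
Proof.
have h : dfn2 (fun x y => germN (fun v => phi (v, x) y)) by dfn_tac.
have [Z [dZ [ze [psi [h1 h2 h3 h4]]]]] := U h; exists Z, dZ, ze, psi;
  split=> //.
move=> z /h3 [q [hq ->]]; have [a] := M_point.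
exists (fun A : M * X -> Prop => q (fun x =>
  exists w, w = a /\ mostly AtMinusInfty w (fun v => A (v, x)))).
split.
  apply: (deftype_germ (b := fun _ w => w = a)) => //; first by dfn_tac.
    by move=> x v v' -> ->.
  by apply: dt_all => //; [dfn_tac|move=> x; exists a].
apply: functional_extensionality_dep => y; congr q; apply: predE => x /=.
by split=> [hx|[w [_ ?]]] //; exists a.
Qed.

Section Germ.
Variable b : X -> Y -> M -> Prop.
Hypotheses (hb : dfn3 b) (b_inj : forall x y v v',
  b x y v -> b x y v' -> v = v').

Lemma uniform_right : ufam (types_on phi) (fun P => exists q y0,
  [/\ deftype q, has_germ q b y0 &
    P = (fun y => q (fun x => exists w, b x y0 w /\ germR w (fun v =>
      phi (v, x) y)))]).
Proof.
have h : dfn2 (fun x y => exists w, b x y w) by dfn_tac.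
have h' : dfn2 (fun x (p : Y * Y) =>
  exists w, b x p.1 w /\ germR w (fun v => phi (v, x) p.2)) by dfn_tac.
have [Z [dZ [ze [psi [psi' [h1 h2 h3 h4 h5]]]]]] := types_uniform2 U h h'.
exists (Z * Y)%type, _, (fun p => ze p.1 /\ psi p.1 p.2), (fun p y =>
  psi' p.1 (p.2, y)).
split; [by dfn_tac|by dfn_tac| |].
  move=> [z y0] /= [/h4 [q [hq E E']]]; rewrite E E' => hy0.
  exists (fun A : M * X -> Prop => q (fun x =>
    exists w, b x y0 w /\ mostly RightOf w (fun v => A (v, x)))).
  split=> //; apply: deftype_germ => //; first by dfn_tac.
  by move=> x v v'; apply: b_inj.
move=> P [q [y0 [hq hy0 ->]]]; have [z [hz E E']] := h5 q hq.
by exists (z, y0); rewrite /= E E'.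
Qed.

(** The parameter z gives the preorder of the endpoints and the values of phi at them for one q;
    [definable_cuts_total] then supplies a parameter w for the initial segment I. *)
Lemma uniform_cofinal : ufam (types_on phi) (fun P => exists q I,
  [/\ deftype q, dfn I, (exists y, I y /\ has_germ q b y),
    (forall y y', I y' -> ~ has_germ q b y \/ germ_le q b y y' -> I y) &
    P = (fun y => cofinal_type q b (fun y =>
      I y /\ has_germ q b y) (fun vx => phi vx y))]).
Proof.
have h : dfn2 (fun x (p : Y * Y) =>
  exists w w', [/\ b x p.1 w, b x p.2 w' & w <= w']) by dfn_tac.
have h' : dfn2 (fun x (p : Y * Y) =>
  exists w, b x p.1 w /\ phi (w, x) p.2) by dfn_tac.
have [Z [dZ [ze [psi [psi' [h1 h2 h3 h4 h5]]]]]] := types_uniform2 U h h'.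
have gE q y : deftype q -> has_germ q b y <-> germ_le q b y y.
  by move=> hq; split=> [/(germ_le_refl hq hb)//|/(germ_le_dom hq hb) []].
(* The germ preorder extended to a total preorder on all of Y for every z: elements without a germ
   come first, and for z outside [ze] all elements are equivalent. *)
pose le z y y' := ~ ze z \/ ~ psi z (y, y) \/ psi z (y, y').
have hle : dfn3 le by rewrite /le; dfn_tac.
have [||W [dW [chi [hchi cchi]]]] := definable_cuts_total hle.
- move=> z y y'; rewrite /le; case: (pselect (ze z)) => [/h4 [q [hq -> _]]|];
    last by left; left.
  case: (pselect (has_germ q b y)) => [d1|n1]; last by left; right; left=> hl;
    apply/n1/(gE q).
  case: (pselect (has_germ q b y')) => [d2|n2]; last by right; right;
    left=> hl; apply/n2/(gE q).
  by case: (germ_le_total hq hb d1 d2) => hl; [left|right]; right; right.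
- move=> z x y y'; rewrite /le;
    case: (pselect (ze z)) => [/[dup] hz /h4 [q [hq -> _]]|]; last by left.
  case=> [//|[n _|l]]; first by right; left.
  case=> [//|[n|l']]; last by right; right;
    apply: (germ_le_trans hq hb b_inj l l').
  by case: n; apply/(gE q) => //; case: (germ_le_dom hq hb l).
(* [chi] may have members that are not cuts; a nonempty J still gives a definable type by
   [deftype_cofinal]. *)
pose J (p : Z * W) y := chi p.1 p.2 y /\ psi p.1 (y, y).
have hJ : dfn2 J by rewrite /J; dfn_tac.
pose c (p : Z * W) y := exists y1, J p y1 /\ forall y2, J p y2 -> psi p.1 (y1,
  y2) -> psi' p.1 (y2, y).
exists (Z * W)%type, _, (fun p => ze p.1 /\ exists y, J p y), c.
have JE q z w : deftype q -> psi z = (fun p => q (fun x =>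
  exists w w', [/\ b x p.1 w, b x p.2 w' & w <= w'])) ->
    J (z, w) = (fun y => chi z w y /\ has_germ q b y).
  by move=> hq E; apply: predE => y; rewrite /J E gE.
split; [by dfn_tac|by rewrite /c; dfn_tac| |].
  move=> [z w] /= [/h4 [q [hq E E']] [y Jy]].
  exists (cofinal_type q b (J (z, w))); split.
    apply: deftype_cofinal => //; first by dfn_tac.
      by exists y.
    by move=> y'; rewrite (JE q) // => -[].
  by apply: functional_extensionality_dep => y';
    rewrite /c /cofinal_type /= E E'.
move=> P [q [I [hq dI [y0 [Iy0 hy0]] Idn ->]]]; have [z [hz E E']] := h5 q hq.
have [|w Ew] := cchi z I.
  split=> // y y' Iy' hl; apply: Idn Iy' _; move: hl;
    rewrite /le E => -[//|[n|l]]; last by right.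
  by left=> hg; apply: n; apply/(gE q).
exists (z, w); rewrite (_ : (fun y => I y /\ has_germ q b y) = J (z, w));
  last by rewrite (JE q) // -Ew.
split; first by split=> //; exists y0; rewrite (JE q) // -Ew.
by apply: functional_extensionality_dep => y'; rewrite /c /cofinal_type /= E E'.
Qed.
End Germ.
End Modes.

Lemma no_boundary_germN (P : M -> Prop) v : dfn P -> (forall w,
  w <= v -> ~ boundary P w) ->
  (P v <-> germN P).
Proof.
move=> hP h; have K w : w < v -> (P w <-> P v).
  by move=> wv; apply: boundary_const => // z /andP[_]; apply: h.
split=> [Pv|[c hc]]; first by exists v => w /K ->.
have [w] := M_below (Order.min c v); rewrite lt_min => /andP[wc wv].
by apply/(K w wv)/hc.
Qed.

Lemma no_boundary_germR (P : M -> Prop) f v : dfn P -> f < v ->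
  (forall w, f < w -> w <= v -> ~ boundary P w) -> (P v <-> germR f P).
Proof.
move=> hP fv h; have K w : f < w -> w < v -> (P w <-> P v).
  move=> fw wv; apply: boundary_const => // z /andP[wz zv]; apply: h => //.
  exact: lt_le_trans fw wz.
split=> [Pv|[c [fc hc]]].
  by exists v; split=> // w /andP[fw wv]; apply/K.
have [w /andP[fw]] : exists w, f < w < Order.min c v by apply: M_dense;
  rewrite lt_min fc.
by rewrite lt_min => /andP[wc wv]; apply/(K w fw wv)/hc; rewrite fw.
Qed.

(** Of finitely many pieces of a total preorder one is cofinal in their union: a new piece is
    dominated by the chosen one, or has an element that dominates it. It allows the endpoints below
    v to be replaced by those of a single rank. *)
Lemma cofinal_index Y (A : nat -> Y -> Prop) (cr : nat -> nat -> Y -> Y ->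
  Prop) N :
  (forall i j y z, A i y -> A j z -> cr i j y z \/ cr j i z y) ->
  (forall i j k x y z, cr i j x y -> cr j k y z -> cr i k x z) ->
  (exists j y, (j < N)%N /\ A j y) ->
  exists i, [/\ (i < N)%N, exists y, A i y &
    forall j y, (j < N)%N -> A j y -> exists z, A i z /\ cr j i y z].
Proof.
move=> tot tr; elim: N => [|N IH]; first by move=> [j [y []]].
have rf i y : A i y -> cr i i y y by move=> Ay; case: (tot _ _ _ _ Ay Ay).
case: (pselect (exists j y, (j < N)%N /\ A j y)) =>
  [/IH [i [iN exi hi]] _|no]; last first.
  move=> [j [y []]]; rewrite ltnS leq_eqVlt => /orP[/eqP-> Ay|jN Ay];
    last by case: no; exists j, y.
  exists N; split=> //; first by exists y.
  move=> k z; rewrite ltnS leq_eqVlt => /orP[/eqP-> Az|kN Az];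
    last by case: no; exists k, z.
  by exists z; split=> //; apply: rf.
case: (pselect (forall y, A N y -> exists z, A i z /\ cr N i y z)) => [hN|].
  exists i; split=> //; first exact: ltnW.
  by move=> k z; rewrite ltnS leq_eqVlt => /orP[/eqP->|kN] Az;
    [apply: hN|apply: hi].
move=> /existsNP [y0 /not_implyP [Ay0 n0]]; exists N; split=> //;
  first by exists y0.
move=> k z; rewrite ltnS leq_eqVlt => /orP[/eqP-> Az|kN Az].
  by exists z; split=> //; apply: rf.
have [z' [Az' c1]] := hi _ _ kN Az; exists y0; split=> //; apply: tr c1 _.
by case: (tot _ _ _ _ Ay0 Az') => // c; case: n0; exists z'.
Qed.

Lemma types_uniform_step X {dX : dtype X} : @types_uniform X dX ->
  @types_uniform (M * X) _.
Proof.
move=> U Y dY phi hphi.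
pose f (t : X * Y) v := phi (v, t.1) t.2.
have hf : dfn2 f by rewrite /f; dfn_tac.
have [N hN] := uniform_boundary hf.
pose nb i x y w := nth_boundary i (f (x, y)) w.
have hnb i : dfn3 (nb i) by apply: (dfn_nth_boundary i hf).
have nb_inj i x y v v' : nb i x y v -> nb i x y v' -> v = v' by apply:
  nth_boundary_inj.
have df x y : dfn (f (x, y)) by dfn_tac.
have cov := ufam_or (uniform_minus_infty U hphi) (ufam_bigor N (fun i =>
  ufam_or (uniform_right U hphi (hnb i) (nb_inj i)) (uniform_cofinal U hphi
    (hnb i) (nb_inj i)))).
apply: ufam_sub cov => P [p [hp ->]].
pose q (A : X -> Prop) := p (fun vx => A vx.2).
have hq : deftype q := deftype_proj hp.
pose le_v i y (vx : M * X) := exists w, nb i vx.2 y w /\ w <= vx.1.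
have hle_v i y : dfn (le_v i y) by have h := hnb i; rewrite /le_v; dfn_tac.
(* According to p, the endpoint f_i(x, y) exists and is at most v. *)
pose A i y := p (le_v i y).
have hA i : dfn (A i).
  apply: (@dt_def _ _ _ hp _ _ (fun vx y =>
    exists w, nb i vx.2 y w /\ w <= vx.1)).
  by have h := hnb i; dfn_tac.
pose cmp j i y z (vx : M * X) := exists w w', [/\ nb j vx.2 y w,
  nb i vx.2 z w' & w <= w'].
have hcmp j i y z : dfn (cmp j i y z).
  by have h := hnb i; have h' := hnb j; rewrite /cmp; dfn_tac.
pose cr j i y z := p (cmp j i y z).
have tot i j y z : A i y -> A j z -> cr i j y z \/ cr j i z y.
  move=> Ay Az; case: (dt_or hp (hcmp i j y z)) => h; [by left|right].
  apply: (dt_up3 hp (hle_v i y) (hle_v j z) (dfn_not (hcmp i j y z)) (hcmp j i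
    z y) _ Ay Az h).
  move=> vx [w [bw _]] [w' [bw' _]] n; exists w', w; split=> //.
  by apply: ltW; rewrite ltNge; apply/negP => l; apply: n; exists w, w'.
have tr i j k x y z : cr i j x y -> cr j k y z -> cr i k x z.
  apply: (dt_up2 hp (hcmp i j x y) (hcmp j k y z) (hcmp i k x z)).
  move=> vx [w [w' [bw bw' l]]] [v [v' [bv bv' l']]]; exists w, v'; split=> //.
  by apply: le_trans l _; rewrite (nb_inj _ _ _ _ _ bw' bv).
have down i j y z : cr i j y z -> A j z -> A i y.
  apply: (dt_up2 hp (hcmp i j y z) (hle_v j z) (hle_v i y)).
  move=> vx [w [w' [bw bw' l]]] [v [bv lv]]; exists w; split=> //.
  by apply: le_trans lv; rewrite (nb_inj _ _ _ _ _ bv bw').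
(* On this set, which belongs to p, only the ranks j with [A j y] have their endpoint at or below
   v. *)
pose H1 y (vx : M * X) := forall j, (j < N)%N -> A j y \/ ~ le_v j y vx.
have dH1 y : dfn (H1 y).
  by apply: (@dfn_forall_lt N _ _ (fun j vx => A j y \/ ~ le_v j y vx)) => j;
    have h := hle_v j y; dfn_tac.
have pH1 y : p (H1 y).
  apply: (@dt_forall_lt _ _ _ hp N (fun j vx => A j y \/ ~ le_v j y vx)).
    by move=> j; have h := hle_v j y; dfn_tac.
  move=> j _; have h := hle_v j y; case: (pselect (A j y)) => Ay.
    by apply: dt_all => //; [dfn_tac|move=> x; left].
  by apply: (dt_up hp _ _ _ (proj2 (dt_not hp h) Ay)); try (by dfn_tac); right.
have dphi y : dfn (fun vx => phi vx y) by dfn_tac.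
case: (pselect (exists j y, (j < N)%N /\ A j y)) => [exA|noA]; last first.
  left; exists q; split=> //; apply: predE => y.
  apply: (dt_iff hp (dphi y) _ (dH1 y) (pH1 y)); first by dfn_tac.
  move=> [v x] h /=; apply: (@no_boundary_germN (f (x, y))) =>
    // w wv /(hN (x, y)) [j [jN nw]].
  by case: (h j jN) => [Aj|]; [apply: noA; exists j, y|apply; exists w].
right; have [i [iN exi cof]] := cofinal_index tot tr exA; exists i; split=> //.
have dom y : A i y -> has_germ q (nb i) y.
  have h := hnb i; apply: (dt_up hp (hle_v i y)); first by dfn_tac.
  by move=> vx [w [bw _]]; exists w.
pose eq_v y (vx : M * X) := exists w, nb i vx.2 y w /\ w = vx.1.
have heq_v y : dfn (eq_v y) by have h := hnb i; rewrite /eq_v; dfn_tac.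
(* The cofinal mode applies once the values of phi at the endpoints of rank i eventually agree with
   p. Elements without a germ are added to [A i] to obtain an initial segment of Y. *)
have reduce : (forall y, exists y1, A i y1 /\ forall y2,
  A i y2 -> cr i i y1 y2 ->
    (q (fun x => exists w, nb i x y2 w /\ phi (w, x) y) <-> p (fun vx =>
      phi vx y))) ->
    exists q I, [/\ deftype q, dfn I, (exists y, I y /\ has_germ q (nb i) y),
    (forall y y', I y' -> ~ has_germ q (nb i) y \/ germ_le q (nb i) y y' -> I
      y) &
    (fun y => p (fun vx => phi vx y)) =
    (fun y => cofinal_type q (nb i) (fun y =>
      I y /\ has_germ q (nb i) y) (fun vx => phi vx y))].
  move=> core; exists q, (fun y => ~ has_germ q (nb i) y \/ A i y).
  have JE : (fun y => (~ has_germ q (nb i) y \/ A i y) /\ has_germ q (nb i) y)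
    = A i.
    by apply: predE => y; split=> [[[]//]|Ay]; split; [right|apply: dom].
  split=> //.
  - by have h := dfn_has_germ hq (hnb i); have h' := hA i; dfn_tac.
  - by have [y Ay] := exi; exists y; split; [right|apply: dom].
  - move=> y y' Iy' [n|l]; [by left|right];
      have [_ d'] := germ_le_dom hq (hnb i) l.
    by case: Iy' => // Ay'; apply: down l Ay'.
  rewrite JE; apply: predE => y; have [y1 [Ay1 h1]] := core y;
    split=> [Py|[y2 [Ay2 h2]]].
    by exists y1; split=> // y2 Ay2 l; apply/h1.
  have [z [Az l1 l2]] := directed_max (fun y z => @tot i i y z) Ay1 Ay2.
  by apply/(h1 z Az l1); apply: h2.
have happ y2 y : dfn (fun vx : M * X =>
  exists w, nb i vx.2 y2 w /\ phi (w, vx.2) y).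
  by have h := hnb i; dfn_tac.
(* If v is itself an endpoint of rank i, every later endpoint of [A i] equals v, so the limit is
   attained. *)
case: (pselect (exists y0, A i y0 /\ p (eq_v y0))) => [[y0 [Ay0 py0]]|noeq].
  right; apply: reduce => y; exists y0; split=> // y2 Ay2 l.
  apply: (dt_iff hp (happ y2 y) (dphi y) _ (dt_I hp (heq_v y0) _ py0 (dt_I hp
    (hcmp i i y0 y2) (hle_v i y2) l Ay2))).
  - by apply: dfn_and => //; apply: dfn_and.
  - by apply: dfn_and.
  move=> [v x] [[w0 [b0 /= e0]] [[w [w2 [bw b2 /= l02]]] [w2' [b2' /= l2v]]]].
  have E1 := nb_inj _ _ _ _ _ b2' b2; have E2 := nb_inj _ _ _ _ _ bw b0.
  have E : w2 = v by apply/eqP; rewrite eq_le -{1}E1 l2v -e0 -E2.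
  split=> [[u [bu hu]]|h]; first by rewrite -E -(nb_inj _ _ _ _ _ bu b2).
  by exists w2; split=> //=; rewrite E.
(* Without a greatest endpoint below v, some f_i(x, y1) exceeds strictly all endpoints at y that are
   at most v; beyond y1 no boundary point at y separates f_i from v. *)
case: (pselect (forall y, A i y -> exists y', A i y' /\ ~ cr i i y' y)) =>
  [nomax|].
  pose st j y z (vx : M * X) := exists w w', [/\ nb j vx.2 y w,
    nb i vx.2 z w' & w < w'].
  have hst j y z : dfn (st j y z) by have h := hnb i; have h' := hnb j;
    rewrite /st; dfn_tac.
  have above y n : (n <= N)%N -> exists y1, A i y1 /\ forall j,
    (j < n)%N -> A j y -> p (st j y y1).
    elim: n => [|n IH] nN; first by have [y1 Ay1] := exi; exists y1.
    have [y1 [Ay1 h1]] := IH (ltnW nN).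
    case: (pselect (A n y)) => Any; last first.
      by exists y1; split=> // j; rewrite ltnS leq_eqVlt => /orP[/eqP->|/h1].
    have [y2 [Ay2 l2]] := cof _ _ nN Any; have [y3 [Ay3 n3]] := nomax _ Ay2.
    have [z [Az l1 l3]] := directed_max (fun y z => @tot i i y z) Ay1 Ay3.
    exists z; split=> // j; rewrite ltnS leq_eqVlt => /orP[/eqP-> _|jn Ajy].
      have n3' := proj2 (dt_not hp (hcmp i i y3 y2)) n3.
      apply: (dt_up3 hp (hcmp n i y y2) (dfn_not (hcmp i i y3 y2)) (hcmp i i y3
        z) (hst n y z) _ l2 n3' l3).
      move=> vx [w [w2 [bw b2 l]]] nl [w3 [wz [b3 bz lz]]]; exists w, wz;
        split=> //.
      apply: lt_le_trans lz; apply: le_lt_trans l _; rewrite ltNge;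
        apply/negP => l32.
      by apply: nl; exists w3, w2.
    apply: (dt_up2 hp (hst j y y1) (hcmp i i y1 z) (hst j y z) _ (h1 j jn Ajy)
      l1).
    move=> vx [w [w1 [bw b1 l]]] [w1' [wz [b1' bz lz]]]; exists w, wz;
      split=> //.
    by apply: lt_le_trans lz; rewrite (nb_inj _ _ _ _ _ b1' b1).
  right; apply: reduce => y; have [y1 [Ay1 h1]] := above y N (leqnn _).
  exists y1; split=> // y2 Ay2 l.
  pose H2 vx := forall j, (j < N)%N -> A j y -> st j y y1 vx.
  have dH2j j : dfn (fun vx => A j y -> st j y y1 vx) by have h := hst j y y1;
    dfn_tac.
  have dH2 : dfn H2 by apply: dfn_forall_lt.
  have pH2 : p H2.
    apply: (dt_forall_lt hp dH2j) => j jN; case: (pselect (A j y)) => Ajy.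
      by apply: (dt_up hp (hst j y y1) (dH2j j) _ (h1 j jN Ajy)).
    by apply: dt_all.
  have c1 := dt_I hp (hcmp i i y1 y2) (hle_v i y2) l Ay2.
  have d1 := dfn_and (hcmp i i y1 y2) (hle_v i y2).
  have c2 := dt_I hp (dH1 y) dH2 (pH1 y) pH2; have d2 := dfn_and (dH1 y) dH2.
  apply: (dt_iff hp (happ y2 y) (dphi y) (dfn_and d1 d2) (dt_I hp d1 d2 c1 c2)).
  move=> [v x] [[[w1 [w2 [b1 b2 /= l12]]] [w2' [b2' /= l2v]]] [h2 h3]].
  have E2 := nb_inj _ _ _ _ _ b2' b2; rewrite {w2' b2'}E2 in l2v.
  suff E : f (x, y) w2 <-> f (x, y) v.
    split=> [[u [bu hu]]|h]; last by exists w2; split=> //; apply/E.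
    by apply/E; rewrite /f /= -(nb_inj _ _ _ _ _ bu b2).
  move: l2v; rewrite le_eqVlt => /orP[/eqP->//|w2v].
  apply: boundary_const => // z /andP[w2z zv] /(hN (x, y)) [j [jN nz]].
  case: (h2 j jN) => [Aj|]; last by apply; exists z.
  have [w [w1' [bw b1' /= ww1]]] := h3 j jN Aj.
  have E1 := nb_inj _ _ _ _ _ b1' b1; have Ez := nb_inj _ _ _ _ _ bw nz.
  by move: ww1; rewrite E1 Ez ltNge (le_trans l12 w2z).
(* The greatest endpoint f_i(x, y0) is strictly below v and nothing at y separates the two, so v
   behaves like the germ to its right. *)
move=> /existsNP [y0 /not_implyP [Ay0 max]]; left.
have {}max y' : A i y' -> cr i i y' y0 by move=> Ay'; apply: contrapT => n;
  apply: max; exists y'.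
exists q, y0; split=> //; first exact: dom.
apply: predE => y.
have py0 : p (fun vx => ~ eq_v y0 vx).
  by apply/(dt_not hp (heq_v y0)) => h; apply: noeq; exists y0.
pose H3 vx := forall j, (j < N)%N -> A j y -> cmp j i y y0 vx.
have dH3j j : dfn (fun vx => A j y -> cmp j i y y0 vx) by have h := hcmp j i y
  y0; dfn_tac.
have dH3 : dfn H3 by apply: dfn_forall_lt.
have pH3 : p H3.
  apply: (dt_forall_lt hp dH3j) => j jN; case: (pselect (A j y)) => Ajy.
    have [y' [Ay' l]] := cof j y jN Ajy.
    by apply: (dt_up hp (hcmp j i y y0) (dH3j j) _ (tr _ _ _ _ _ _ l (max _
      Ay'))).
  by apply: dt_all.
have nl := dfn_not (heq_v y0).
have c1 := dt_I hp (hle_v i y0) nl Ay0 py0; have d1 := dfn_and (hle_v i y0) nl.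
have c2 := dt_I hp (dH1 y) dH3 (pH1 y) pH3; have d2 := dfn_and (dH1 y) dH3.
apply: (dt_iff hp (dphi y) _ (dfn_and d1 d2) (dt_I hp d1 d2 c1 c2)).
  by have h := hnb i; dfn_tac.
move=> [v x] [[[w0 [b0 /= l0]] n0] [h2 h3]] /=.
have w0v : w0 < v.
  by rewrite lt_neqAle l0 andbT; apply/negP => /eqP E; apply: n0; exists w0.
have E : f (x, y) v <-> germR w0 (f (x, y)).
  apply: no_boundary_germR => // z w0z zv /(hN (x, y)) [j [jN nz]].
  case: (h2 j jN) => [Aj|]; last by apply; exists z.
  have [w [w0' [bw b0' /= ww0]]] := h3 j jN Aj.
  by move: w0z; rewrite -(nb_inj _ _ _ _ _ b0' b0) ltNge -(nb_inj _ _ _ _ _ bw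
    nz) ww0.
split=> [/E h|[w [bw h]]]; first by exists w0.
by apply/E; rewrite (nb_inj _ _ _ _ _ b0 bw).
Qed.

Lemma types_uniform_pw n : @types_uniform (pw n) _.
Proof.
elim: n => [|n IH]; last exact: types_uniform_step IH.
move=> Y dY phi hphi; exists unit, _, (fun _ => True), (fun _ y => phi tt y).
split; [by dfn_tac|by dfn_tac| |].
  move=> _ _; exists (fun A => A tt); split=> //; split=> //.
  - by move=> Z dZ A hA; dfn_tac.
  - by move=> A B hA hB AB; apply: AB.
  - by move=> A hA; case: (pselect (A tt)); [left|right].
move=> P [p [hp ->]]; exists tt; split=> //; apply: predE => y.
have E : (fun x : unit => phi x y) = (fun _ => phi tt y) by apply: predE => -[].
rewrite E; case: (pselect (phi tt y)) => h.
  by split=> // _; apply: dt_all => //; dfn_tac.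
by split=> // pp; case: (dt_F hp);
  rewrite (_ : (fun _ => False) = (fun _ : pw 0 => phi tt y)) //; apply: predE.
Qed.

(** * Definable compactness *)

Lemma deftype_comp {X Y} {dX : dtype X} {dY : dtype Y} (p : (X -> Prop) ->
  Prop) (f : X -> Y) :
  dmap f -> deftype p -> deftype (fun A : Y -> Prop => p (fun x => A (f x))).
Proof.
move=> hf hp; have hc (A : Y -> Prop) : dfn A -> dfn (fun x =>
  A (f x)) by move=> hA; dfn_tac.
split.
- by move=> Z dZ A hA; apply: (dt_def hp (A := fun x z => A (f x) z)); dfn_tac.
- exact: dt_T hp.
- exact: dt_F hp.
- by move=> A B hA hB; apply: (dt_I hp); apply: hc.
- by move=> A B hA hB AB; apply: (dt_up hp (hc A hA) (hc B hB)) => x; apply: AB.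
- by move=> A hA; apply: (dt_or hp (hc A hA)).
Qed.

Lemma types_uniform_all X {dX : dtype X} : @types_uniform X dX.
Proof.
move=> Y dY phi hphi.
have h : dfn2 (fun (z : pw (dn X)) y => phi (of_pw z) y) by dfn_tac.
have [Z [dZ [ze [psi [h1 h2 h3 h4]]]]] := types_uniform_pw h;
  exists Z, dZ, ze, psi; split=> //.
  move=> z /h3 [p [hp ->]]; exists (fun A => p (fun z => A (of_pw z)));
    split=> //.
  by apply: deftype_comp hp; dmap_tac.
move=> P [p [hp ->]]; apply: h4; exists (fun A => p (fun x => A (to_pw x)));
  split.
  by apply: deftype_comp hp; dmap_tac.
apply: functional_extensionality_dep => y; congr p; apply: predE => x;
  by rewrite to_pwK.
Qed.

Lemma coords_tuple n (t : n.-tuple M) : @coords _ (dtype_tuple n) t = t.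
Proof. by apply: eq_from_tnth => i; rewrite tnth_mktuple. Qed.

Lemma coords_pair k {Y} {dY : dtype Y} (t : k.-tuple M) (y : Y) :
  @coords _ (@dtype_prod (k.-tuple M) Y (dtype_tuple k) dY) (t,
    y) = cat_tuple t (coords y).
Proof.
apply: eq_from_tnth => i; rewrite tnth_mktuple /=; case: splitP => j e.
  by rewrite (_ : i = lshift _ j) ?tnth_lshift //; apply: val_inj.
by rewrite (_ : i = rshift _ j) ?tnth_rshift ?tnth_mktuple //; apply: val_inj.
Qed.

Lemma definableE n (A : set (n.-tuple M)) : definable S A <-> @dfn _
  (dtype_tuple n) A.
Proof.
split=> [[phi ->]|[phi hphi]]; exists phi; first by move=> x;
  rewrite coords_tuple.
by apply: predE => x; rewrite hphi coords_tuple.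
Qed.

Lemma dfn_fiber k m (phi : formula L M (k + m)) :
  @dfn2 (k.-tuple M) (m.-tuple M) _ _ (fun x b => fiber S phi b x).
Proof. by exists phi => -[x b]; rewrite coords_pair coords_tuple. Qed.

Lemma dfn_fiber_const k m (phi : formula L M (k + m)) b : @dfn _ (dtype_tuple
  k) (fiber S phi b).
Proof.
have h := dfn_fiber phi.
by apply: (@dfn_comp _ _ _ _ (fun x : k.-tuple M => (x, b)) _ h); dmap_tac.
Qed.

Lemma dfn2_formula k {Y} {dY : dtype Y} (A : k.-tuple M -> Y -> Prop) : dfn2 A
  ->
  exists phi : formula L M (k + dn Y), forall x y,
    A x y <-> fiber S phi (coords y) x.
Proof.
by move=> [phi hphi]; exists phi => x y; have := hphi (x, y);
  rewrite coords_pair.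
Qed.

Lemma deftype_definable k (p : set (set (k.-tuple M))) : definable_type S p ->
  deftype p.
Proof.
move=> [[pd pT p0 pI pup por] pdef]; split.
- move=> Y dY A /dfn2_formula [phi hphi]; have [psi hpsi] := pdef _ phi.
  exists psi => y; rewrite -[sat _ _ _]/([set b | sat S psi b] (coords y))
    -hpsi /=.
  by rewrite (_ : (fun x => A x y) = fiber S phi (coords y)) //;
    apply: predE => x.
- exact: pT.
- by rewrite (_ : (fun _ => False) = set0).
- by move=> A B _ _; apply: pI.
- by move=> A B _ /definableE dB AB pA; apply: pup pA dB AB.
- by move=> A /definableE /por.
Qed.

(** A [deftype] may hold of undefinable predicates; these are discarded to obtain a family of
    definable sets. *)
Lemma definable_deftype k (p : (k.-tuple M -> Prop) -> Prop) : deftype p ->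
  definable_type S (fun A : set (k.-tuple M) => dfn A /\ p A).
Proof.
move=> hp; split.
  split.
  - by move=> A [/definableE].
  - by split; [exact: dfn_const|exact: dt_T hp].
  - by move=> [_]; exact: dt_F hp.
  - by move=> A A' [hA pA] [hA' pA']; split; [apply: dfn_and|apply: dt_I].
  - by move=> A A' [hA pA] /definableE hA' AA'; split=> //; apply: dt_up pA.
  - move=> A /definableE hA; case: (dt_or hp hA) => h; [by left|right].
    by split=> //; apply: dfn_not.
move=> m phi; apply/definableE.
apply: (@dfn_ext _ _ _ (fun b => p (fiber S phi b))).
  by move=> b; split=> [[]|h] //; split=> //; apply: dfn_fiber_const.
exact: (dt_def hp (dfn_fiber phi)).
Qed.

Lemma dmap_cat n m {X} {dX : dtype X} (f : X -> n.-tuple M) (g : X -> m.-tuple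
  M) :
  dmap f -> dmap g -> dmap (fun x => cat_tuple (f x) (g x)).
Proof.
move=> hf hg i; rewrite /= -(splitK i).
by case: (split i) => j /=; [have := hf j|have := hg j]; case=> -[k hk];
  [left|right|left|right];
  exists k => x; rewrite ?tnth_lshift ?tnth_rshift; apply: hk.
Qed.

Local Open Scope classical_set_scope.

(** The type has to be traced on the neighbourhoods U and on [Xc], which tells for which c it
    contains X_c. With both traces in one definable family, the condition that defines D is first
    order. *)
Lemma compact_definable k n m (B : set ((n + m).-tuple M))
    (sigma : formula L M (k + (n + m))) (C : set (m.-tuple M))
    (X : m.-tuple M -> set (k.-tuple M)) (tau : m.-tuple M -> set (set
      (k.-tuple M))) :
  definable_family_of_spaces S B sigma C X tau ->
  exists D : set (m.-tuple M),
    [/\ definable S D, D `<=` C &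
        forall c, C c -> (definably_compact S (X c) (tau c) <-> D c)].
Proof.
move=> [/definableE dB CE _ hC].
pose U (x : k.-tuple M) (bc : n.-tuple M * m.-tuple M) := fiber S sigma
  (cat_tuple bc.1 bc.2) x.
have hU : dfn2 U.
  have h := dfn_fiber sigma.
  apply: (@dfn_app2 _ _ _ _ _ _ _ (fun w : k.-tuple M * (n.-tuple M * m.-tuple
    M) => w.1)
    (fun w => cat_tuple w.2.1 w.2.2) h); [by dmap_tac|by apply: dmap_cat;
      dmap_tac].
pose Bc (b : n.-tuple M) (c : m.-tuple M) := B (cat_tuple b c).
have hB : dfn2 Bc by apply: (dfn_comp dB); apply: dmap_cat; dmap_tac.
(* X_c is open in itself, hence the union of its basic sets and definable uniformly in c. *)
pose Xc (x : k.-tuple M) (c : m.-tuple M) := exists b, Bc b c /\ U x (b, c).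
have hXc : dfn2 Xc by rewrite /Xc; dfn_tac.
have dC : @dfn _ (dtype_tuple m) C.
  by apply: (@dfn_ext _ _ _ (fun c => exists b, Bc b c)); [rewrite CE|dfn_tac].
have [Z [dZ [ze [psi [psi' [h1 h2 h3 h4 h5]]]]]] := types_uniform2
  (@types_uniform_all _ (dtype_tuple k)) hU hXc.
exists (fun c => C c /\ forall z, ze z -> psi' z c -> exists x, Xc x c /\
  forall b, Bc b c -> U x (b, c) -> psi z (b, c)); split.
- by apply/definableE; dfn_tac.
- by move=> c [].
move=> c Cc; have [[tsub t0 tX tI tU] [Fsub Fbase]] := hC c Cc.
have XE : X c = (fun x => Xc x c).
  apply: predE => x; split=> [Xx|[b [Bb Ux]]].
    have [V [[b Bb <-] Vx _]] := Fbase _ x tX Xx; by exists b.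
  by apply: (tsub (fiber S sigma (cat_tuple b c))) => //; apply: Fsub; exists b.
have dU b : @dfn _ (dtype_tuple k) (fun x => U x (b, c)) by dfn_tac.
have dX : @dfn _ (dtype_tuple k) (X c) by rewrite XE; dfn_tac.
split=> [comp|[_ hD] p hp pX].
  split=> // z /h4 [q [hq -> ->]] qX.
  have [|x [Xx hx]] := comp _ (definable_deftype hq); first by split=> //;
    rewrite XE.
  exists x; split=> [|b Bb Ux]; first by rewrite XE in Xx.
  have [//|qn] := dt_or hq (dU b).
  suff [_ /(_ Ux) //] : X c x /\ ~ U x (b, c).
  (* The complement of the basic neighbourhood is closed and would belong to the type, so the limit
     x would lie outside its own neighbourhood. *)
  apply: (hx (fun x => X c x /\ ~ U x (b, c))); last first.
    by split; [dfn_tac|apply: (dt_I hq) => //; [dfn_tac|rewrite XE]].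
  split=> [y []//|]; rewrite (_ : _ `\` _ = fiber S sigma (cat_tuple b c)).
    by apply: Fsub; exists b.
  apply: predE => y; split=> [[Xy]|Uy];
    first by move=> /not_andP [//|/contrapT].
  split=> [|[_]//]; apply: (tsub (fiber S sigma (cat_tuple b c))) => //.
  by apply: Fsub; exists b.
have hq := deftype_definable hp; have [z [hz Ez Ez']] := h5 _ hq.
have [|x [Xx hx]] := hD z hz; first by rewrite Ez' -XE.
exists x; split=> [|W [WX tW] pW]; first by rewrite XE.
(* If x were outside the closed set W, some basic neighbourhood of x would be disjoint from W, and
   the type contains both. *)
apply: contrapT => nW; have [|V [[b Bb <-] Vx VW]] := Fbase _ x tW;
  first by split=> //; rewrite XE.
have := hx b Bb Vx; rewrite Ez => pU; apply: (dt_F hq).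
have [[_ _ p0 pI _ _] _] := hp;
  rewrite (_ : (fun _ => False) = W `&` (fun x => U x (b, c))).
  exact: pI.
by apply: predE => y; split=> // -[Wy /VW []].
Qed.

Lemma topology_subspace T (X Y : set T) tau : topology_on X tau -> Y `<=` X ->
  topology_on Y (subspace_topology tau Y).
Proof.
move=> [ts t0 tX tI tU] YX; split.
- by move=> _ [V tV <-] x [].
- by exists set0 => //; rewrite set0I.
- by exists X => //; apply/seteqP; split=> [x []//|x Yx]; split=> //; apply: YX.
- move=> _ _ [V tV <-] [W tW <-]; exists (V `&` W); first exact: tI.
  by rewrite setIACA setIid.
move=> F hF; exists (\bigcup_(V in [set V | tau V /\ F (V `&` Y)]) V).
  by apply: tU => V [].
apply/seteqP; split=> [x [[V [tV FV] Vx] Yx]|x [W FW Wx]];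
  first by exists (V `&` Y).
have [V tV E] := hF W FW; rewrite -E in Wx FW; case: Wx => Vx Yx.
by split=> //; exists V.
Qed.

(** Basic sets of the ambient space are intersected with the subset of index c, so the parameters
    range over a product. *)
Lemma subspace_family k m (X : set (k.-tuple M)) (tau : set (set (k.-tuple M)))
    (C : set (m.-tuple M)) (phi : formula L M (k + m)) :
  definable_topological_space S X tau -> definable S C -> C !=set0 ->
  (forall c, C c -> fiber S phi c `<=` X) ->
  exists n (B : set ((n + m).-tuple M)) (sigma : formula L M (k + (n + m))),
    definable_family_of_spaces S B sigma C (fiber S phi)
      (fun c => subspace_topology tau (fiber S phi c)).
Proof.
move=> [ttop [_ [[n [B0 [psi [/definableE dB0 [b0 Bb0] ->]]]] [Fsub Fbase]]]]
  /definableE dC exC sub.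
pose lpart (t : (n + m).-tuple M) : n.-tuple M := [tuple tnth t (lshift m i) |
  i < n].
pose rpart (t : (n + m).-tuple M) : m.-tuple M := [tuple tnth t (rshift n i) |
  i < m].
have hl : @dmap _ (dtype_tuple (n + m)) _ (dtype_tuple n) lpart.
  by move=> i; left; exists (lshift m i) => t; rewrite /= tnth_mktuple.
have hr : @dmap _ (dtype_tuple (n + m)) _ (dtype_tuple m) rpart.
  by move=> i; left; exists (rshift n i) => t; rewrite /= tnth_mktuple.
have lE b c : lpart (cat_tuple b c) = b.
  by apply: eq_from_tnth => i; rewrite tnth_mktuple tnth_lshift.
have rE b c : rpart (cat_tuple b c) = c.
  by apply: eq_from_tnth => i; rewrite tnth_mktuple tnth_rshift.
pose A (x : k.-tuple M) t := fiber S psi (lpart t) x /\ fiber S phi (rpart t) x.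
have hA : @dfn2 _ _ (dtype_tuple k) (dtype_tuple (n + m)) A.
  pose P1 (x : k.-tuple M) b := fiber S psi b x;
    have h1 : dfn2 P1 := dfn_fiber psi.
  pose P2 (x : k.-tuple M) b := fiber S phi b x;
    have h2 : dfn2 P2 := dfn_fiber phi.
  apply: (@dfn_ext _ _ _ (fun p : k.-tuple M * (n + m).-tuple M =>
    P1 p.1 (lpart p.2) /\ P2 p.1 (rpart p.2))) => //.
  by dfn_tac.
have [sigma hsigma] := dfn2_formula hA.
have sE b c : fiber S sigma (cat_tuple b c) = fiber S psi b `&` fiber S phi c.
  apply: predE => x; rewrite -[cat_tuple b c in X in X <-> _]coords_tuple
    -hsigma /A.
  by rewrite lE rE.
exists n, (fun t => B0 (lpart t) /\ C (rpart t)), sigma; split=> //.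
- by apply/definableE; dfn_tac.
- apply: predE => c; split=> [Cc|[b [_]]]; last by rewrite rE.
  by exists b0; rewrite /= lE rE.
move=> c Cc; split; first exact: topology_subspace ttop (sub c Cc).
split=> [_ [b [Bb _] <-]|_ x [V tV <-] [Vx Yx]].
  by rewrite sE; exists (fiber S psi b) => //; apply: Fsub; exists b => //;
    rewrite lE in Bb.
have [_ [[b Bb <-] bx bV]] := Fbase V x tV Vx.
exists (fiber S psi b `&` fiber S phi c); split=> //.
  by exists b; rewrite ?sE //= lE rE.
by move=> y [/bV].
Qed.

End OMinimal.

Theorem proposition5p22 (L : language) (d : Order.disp_t) (M : orderType d)
    (S : structure L M) (HM : o_minimal S) :
  (forall (k n m : nat) (B : set ((n + m).-tuple M))
      (sigma : formula L M (k + (n + m))) (C : set (m.-tuple M))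
      (X : m.-tuple M -> set (k.-tuple M))
      (tau : m.-tuple M -> set (set (k.-tuple M))),
    definable_family_of_spaces S B sigma C X tau ->
    exists D : set (m.-tuple M),
      [/\ definable S D, D `<=` C &
          forall c, C c -> (definably_compact S (X c) (tau c) <-> D c)])
  /\
  (forall (k m : nat) (X : set (k.-tuple M)) (tau : set (set (k.-tuple M)))
      (C : set (m.-tuple M)) (phi : formula L M (k + m)),
    definable_topological_space S X tau ->
    definable S C -> C !=set0 ->
    (forall c, C c -> fiber S phi c `<=` X) ->
    exists D : set (m.-tuple M),
      [/\ definable S D, D `<=` C &
          forall c, C c ->
            (definably_compact S (fiber S phi c)
               (subspace_topology tau (fiber S phi c)) <-> D c)]).
Proof.
split; first by move=> k n m B sigma C X tau; apply: compact_definable.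
move=> k m X tau C phi htau hC exC sub.
have [n [B [sigma h]]] := subspace_family htau hC exC sub.
exact: (compact_definable HM h).
Qed.
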